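(* Let $K\in\Omega_\Sigma$ and $K'\in\Omega_{\Sigma'}$ be conformal Cantor sets given by maps $g,g'$, with fixed base points $c_a\in K\cap G(a)$ $(a\in\mathbb{A})$ and $c'_{a'}\in K'\cap G'(a')$ $(a'\in\mathbb{A}')$. The following properties are true: 1. Every recurrent compact set is contained in an immediately recurrent compact set. 2. Given a recurrent compact set $\mathcal{L}$ (resp. immediately recurrent) for $(g,g')$, for any $(\tilde g,\tilde g')$ in a small neighbourhood of $(g,g')$ in $\Omega_\Sigma\times\Omega_{\Sigma'}$, defining Cantor sets $\tilde K,\tilde K'$, one can choose base points $\tilde c_a\in\tilde K\cap\tilde G(a)$ and $\tilde c'_{a'}\in\tilde K'\cap\tilde G'(a')$, respectively close to $c_a$ and $c'_{a'}$, such that $\mathcal{L}$ is also a recurrent (resp. immediately recurrent) compact set for $(\tilde g,\tilde g')$ (with respect to these base points). 3. Any relative configuration contained in a recurrent compact set has stable intersections; that is, if $[(A,\underline\theta),(A',\underline\theta')]$ belongs to a recurrent compact set then the relative configuration $[A\circ k^{\underline\theta},A'\circ k'^{\,\underline\theta'}]$ has stable intersections.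
   Context: Identify $\mathbb{C}\equiv\mathbb{R}^2$; $\varepsilon>0$ is a fixed exponent. $\mathrm{Aff}(\mathbb{C})$ is the group of maps $z\mapsto\alpha z+\beta$, $\alpha\in\mathbb{C}^*$, $\beta\in\mathbb{C}$. **Conformal Cantor sets.** A conformal Cantor set $K\subset\mathbb{C}$ is given by: a finite alphabet $\mathbb{A}$ and a set $B\subset\mathbb{A}^2$ of admissible pairs; pairwise disjoint compact connected sets $G(a)\subset\mathbb{C}$, $a\in\mathbb{A}$; a $C^{1+\varepsilon}$ map $g:V\to\mathbb{C}$ on an open neighbourhood $V$ of $\bigsqcup_aG(a)$, such that $(a,b)\in B$ implies $G(b)\subset g(G(a))$, otherwise $G(b)\cap g(G(a))=\emptyset$; each $g|_{G(a)}$ extends to a $C^{1+\varepsilon}$ embedding with $C^{1+\varepsilon}$ inverse of a neighbourhood of $G(a)$ with $m(Dg)>1$, where $m(A)=\inf_{v\neq0}\|Av\|/\|v\|$; the subshift $\Sigma=\{(a_i)_{i\ge0}:(a_i,a_{i+1})\in B\}$ is topologically mixing; and $Dg(x)$ is multiplication by a complex number for every $x\in K:=\bigcap_{n\ge0}g^{-n}(\bigsqcup_aG(a))$. One also assumes that each $G(a)$ is the closure of its interior and that $m(Dg)>\mu$ on a neighbourhood of each $G(a)$ for some $\mu>1$. The data are considered part of $K$, and $K$ is also denoted by its map $g$. Write $K(a)=K\cap G(a)$. Objects for a second Cantor set $K'$ carry a prime, those for $\tilde K$ a tilde. $\Omega_\Sigma$ is the set of conformal Cantor sets of type $\Sigma$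 (same $\mathbb{A},B$), with topology generated by the sets $U_{K,\delta}$ of those $\tilde K$ (given by $\tilde g:\tilde V\to\mathbb{C}$ and pieces $\tilde G(a)$) such that $G(a)\subset V_\delta(\tilde G(a))$, $\tilde G(a)\subset V_\delta(G(a))$ ($V_\delta$ = $\delta$-neighbourhood) and $g,\tilde g$ are $\delta$-close in the $C^{1+\varepsilon}$ metric on $V\cap\tilde V$. **Words and limit geometries.** $\Sigma^{fin}$ is the set of finite admissible words $(a_0,\dots,a_n)$; such a word has size $n$. $\Sigma^-$ is the set of admissible left-infinite sequences $\underline\theta=(\dots,\theta_{-1},\theta_0)$ (with the usual product topology). For $\underline a=(a_0,\dots,a_n)$ let $f_{\underline a}=(g|_{G(a_0)})^{-1}\circ\cdots\circ(g|_{G(a_{n-1})})^{-1}:G(a_n)\to\mathbb{C}$. If $\theta_0=a_0$, $\underline{\theta}\,\underline{a}=(\dots,\theta_{-1},a_0,\dots,a_n)$. With $\underline\theta_n=(\theta_{-n},\dots,\theta_0)$, let $\Phi_{\underline\theta_n}\in\mathrm{Aff}(\mathbb{C})$ be the affine map with $\Phi_{\underline\theta_n}(f_{\underline\theta_n}(c_{\theta_0}))=0$ and $D(\Phi_{\underline\theta_n}\circ f_{\underline\theta_n})(c_{\theta_0})=1$. The limit geometry $k^{\underline\theta}:G(\theta_0)\to\mathbb{C}$ is the limit $k^{\underline\theta}=\lim_n\Phi_{\underline\theta_n}\circ f_{\underline\theta_n}$ (which exists in the $C^{1+\varepsilon}$ topology). For $\underline a\in\Sigma^{fin}$ with $a_0=\theta_0$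 there is a unique $F^{\underline\theta\,\underline a}\in\mathrm{Aff}(\mathbb{C})$ with $F^{\underline\theta\,\underline a}\circ k^{\underline\theta\,\underline a}=k^{\underline\theta}\circ f_{\underline a}$. **Configurations.** A configuration of the piece $G(a)$ is a $C^{1+\varepsilon}$ diffeomorphism $h:G(a)\to U\subset\mathbb{C}$ onto its image; $\mathcal{P}(a)$ is the space of these with the $C^{1+\varepsilon}$ topology and $\mathcal{P}=\bigcup_a\mathcal{P}(a)$. $\mathcal{Q}$ is the quotient of $\mathcal{P}\times\mathcal{P}'$ by the diagonal left action of $\mathrm{Aff}(\mathbb{C})$; its elements $[h,h']$ are relative configurations. A pair $(h,h')\in\mathcal{P}(a)\times\mathcal{P}'(a')$ (or its class) has stable intersections if $\tilde h(\tilde K(a))\cap\tilde h'(\tilde K'(a'))\ne\emptyset$ for all $(\tilde K,\tilde K')$ in a small neighbourhood of $(K,K')$ in $\Omega_\Sigma\times\Omega_{\Sigma'}$ and all configuration pairs $(\tilde h,\tilde h')$ of the corresponding pieces of $\tilde K,\tilde K'$ sufficiently close to $(h,h')$ in the $C^{1+\varepsilon}$ topology on $G(a)\cap\tilde G(a)$ and $G'(a')\cap\tilde G'(a')$. **Recurrent compact sets.** Let $\mathcal{A}=\mathrm{Aff}(\mathbb{C})\times\Sigma^-$ and likewise $\mathcal{A}'$; $(A,\underline\theta)$ represents the configuration $A\circ k^{\underline\theta}$. $\mathcal{C}$ is the quotient of $\mathcal{A}\times\mathcal{A}'$ by the diagonal left action of $\mathrm{Aff}(\mathbb{C})$ on the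 affine components. For words $\underline a,\underline a'$ with $a_0=\theta_0$, $a'_0=\theta'_0$, the renormalization operator is $\mathcal{T}_{\underline a,\underline a'}[(A,\underline\theta),(A',\underline\theta')]=[(A\circ F^{\underline\theta\,\underline a},\underline\theta\,\underline a),(A'\circ F'^{\,\underline\theta'\underline a'},\underline\theta'\underline a')]$; one of the words may be void, in which case the operator is trivial on that coordinate (size $0$). A compact set $\mathcal{L}\subset\mathcal{C}$ is recurrent (for $(g,g')$) if for every $v\in\mathcal{L}$ there are words $\underline a,\underline a'$, not both of size $0$, with $\mathcal{T}_{\underline a,\underline a'}(v)\in\mathrm{int}\,\mathcal{L}$; it is immediately recurrent if these words can always be chosen with total combined size equal to one.
   Formalization: Closeness of configurations is measured on G̃(a) near G(a), against an extension of h, not only on G(a)∩G̃(a), where item 3 fails; the C^{1+ε} metric also includes the first-order Taylor remainder, automatic on convex sets. *)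

(* Defs.v *)
From HB Require Import structures.
From mathcomp Require Import all_boot all_order all_algebra.
From mathcomp Require Import all_classical all_reals all_analysis.
From mathcomp Require Import complex.

Set Implicit Arguments.
Unset Strict Implicit.
Unset Printing Implicit Defensive.

Import Order.TTheory GRing.Theory Num.Theory.
Import numFieldNormedType.Exports.

Local Open Scope classical_set_scope.
Local Open Scope ring_scope.
Local Open Scope quotient_scope.

(* The plane is [Rcomplex R]: the field of complex numbers, seen as a real
   vector space with the Euclidean norm.  Its field, [R]-module and norm
   structures come from the library; the norm topology is added here, so that
   ['d f x] is the real differential of [f] at [x]. *)
HB.instance Definition _ (R : realType) :=
  PseudoMetric.copy (Rcomplex R) (pseudoMetric_normed (Rcomplex R)).
HB.instance Definition _ (R : realType) := isPointed.Build (Rcomplex R) 0.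
HB.instance Definition _ (R : realType) :=
  NormedZmod_PseudoMetric_eq.Build R (Rcomplex R) erefl.

Lemma Rcomplex_normZ (R : realType) (l : R) (z : Rcomplex R) :
  `|l *: z| = `|l| * `|z|.
Proof.
case: z => x y; rewrite /Num.norm /= /GRing.scale /=.
by rewrite !exprMn -mulrDr sqrtrM ?sqr_ge0// sqrtr_sqr.
Qed.

HB.instance Definition _ (R : realType) :=
  PseudoMetricNormedZmod_Lmodule_isNormedModule.Build R (Rcomplex R)
    (@Rcomplex_normZ R).

Section C1eps.
Context {R : realType} (eps : R).
Local Notation C := (Rcomplex R).

(* Maps defined on a subset of the plane are represented by total functions
   whose values off that subset are irrelevant. *)

Definition C1eps (U : set C) (f : C -> C) : Prop :=
  (forall x, U x -> differentiable f x) /\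
  (forall x, U x -> exists M r : R, 0 < r /\
    forall y z v, ball x r y -> ball x r z ->
      `|'d f y v - 'd f z v| <= M * `|y - z| `^ eps * `|v|).

Definition C1eps_embedding (W : set C) (f : C -> C) : Prop :=
  exists f' : C -> C, [/\ C1eps W f, open (f @` W), C1eps (f @` W) f' &
    forall x, W x -> f' (f x) = x].

(* The distance between [f] and [h] in C^{1+eps}(E) is less than [delta].
   As [E] need not be convex, nor even locally quasiconvex, the norm includes
   the first-order Taylor remainder, as in the Whitney-Stein norm of
   Lip(1+eps, E); when [E] is convex the bound on the remainder follows from
   the Hoelder bound on the differential. *)
Definition C1eps_close (delta : R) (E : set C) (f h : C -> C) : Prop :=
  exists2 r : R, 0 <= r < delta & forall x, E x ->
    [/\ `|f x - h x| <= r,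
        forall v, `|'d f x v - 'd h x v| <= r * `|v|,
        forall y v, E y ->
          `|('d f x v - 'd h x v) - ('d f y v - 'd h y v)|
            <= r * `|x - y| `^ eps * `|v| &
        forall y, E y ->
          `|(f y - h y) - (f x - h x) - ('d f x (y - x) - 'd h x (y - x))|
            <= r * `|x - y| `^ (1 + eps)].

Definition conorm (L : C -> C) : R :=
  inf [set `|L v| / `|v| | v in [set v | v != 0]].

Definition thickening (delta : R) (G : set C) : set C :=
  [set z | exists2 w, G w & `|z - w| < delta].

End C1eps.

Section Subshift.
Context {A : finType} (B : rel A).

Definition subshift : set {ptws nat -> discrete_topology A} :=
  [set s | forall n, B (s n) (s n.+1)].

Definition topologically_mixing : Prop :=
  forall U V : set {ptws nat -> discrete_topology A}, open U -> open V ->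
    (subshift `&` U) !=set0 -> (subshift `&` V) !=set0 ->
    exists N, forall n, (N <= n)%N ->
      exists s, [/\ subshift s, U s & V (fun i => s (n + i)%N)].

End Subshift.

Section Cantor.
Context {R : realType} (eps : R) {A : finType} (B : rel A).
Local Notation C := (Rcomplex R).

Definition invariant_set (G : A -> set C) (g : C -> C) : set C :=
  [set x | forall n, exists a, G a (iter n g x)].

Record is_conformal_cantor (G : A -> set C) (V : set C) (g : C -> C) : Prop :=
  IsConformalCantor {
    piece_nonempty : forall a, G a !=set0 ;
    piece_compact : forall a, compact (G a) ;
    piece_connected : forall a, connected (G a) ;
    piece_disjoint : forall a b, a != b -> G a `&` G b = set0 ;
    piece_regular : forall a, G a = closure (interior (G a)) ;
    dom_open : open V ;
    piece_dom : forall a, G a `<=` V ;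
    map_C1eps : C1eps eps V g ;
    markov_in : forall a b, B a b -> G b `<=` g @` G a ;
    markov_out : forall a b, ~~ B a b -> G b `&` g @` G a = set0 ;
    branch_embedding : forall a, exists W F,
      [/\ open W, G a `<=` W, forall x, G a x -> F x = g x,
          C1eps_embedding eps W F & forall x, W x -> 1 < conorm ('d F x)] ;
    map_expanding : exists2 mu : R, 1 < mu & forall a, exists W,
      [/\ open W, G a `<=` W, W `<=` V &
          forall x, W x -> mu < conorm ('d g x)] ;
    map_mixing : topologically_mixing B ;
    map_conformal : forall x, invariant_set G g x ->
      exists l : C, forall v, 'd g x v = l * v }.

Record Omega : Type := MkOmega {
  piece : A -> set C ;
  dom : set C ;
  cmap : C -> C ;
  Omega_axioms : is_conformal_cantor piece dom cmap }.

HB.instance Definition _ := gen_eqMixin Omega.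
HB.instance Definition _ := gen_choiceMixin Omega.

Definition Omega_nbhd (K : Omega) (delta : R) : set Omega :=
  [set Kt | [/\ forall a, piece K a `<=` thickening delta (piece Kt a),
                forall a, piece Kt a `<=` thickening delta (piece K a) &
                C1eps_close eps delta (dom K `&` dom Kt) (cmap K) (cmap Kt)]].

HB.instance Definition _ := @isSubBaseTopological.Build Omega (set Omega)
  [set U | exists K delta, 0 < delta /\ U = Omega_nbhd K delta] id.

Definition cantor_set (K : Omega) : set C := invariant_set (piece K) (cmap K).

Definition cantor_piece (K : Omega) (a : A) : set C :=
  cantor_set K `&` piece K a.

Definition base_points (K : Omega) (c : A -> C) : Prop :=
  forall a, cantor_piece K a (c a).

End Cantor.

Section Affine.
Context (R : realType).
Local Notation C := (Rcomplex R).

(* [(alpha, beta)] stands for z |-> alpha z + beta. *)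
Definition aff : Type := set_type [set p : C * C | p.1 != 0].
HB.instance Definition _ := Topological.on aff.

Definition aff_fun (T : aff) (z : C) : C := (\val T).1 * z + (\val T).2.

Lemma aff_neq0 (T : aff) : (\val T).1 != 0.
Proof. exact: (set_mem (valP T)). Qed.

Definition mkaff (a b : C) (a0 : a != 0) : aff :=
  exist _ (a, b) (mem_set (a0 : [set p : C * C | p.1 != 0] (a, b))).

Definition aff1 : aff := mkaff 0 (oner_neq0 C).

Definition aff_comp (S T : aff) : aff :=
  mkaff ((\val S).1 * (\val T).2 + (\val S).2)
        (mulf_neq0 (aff_neq0 S) (aff_neq0 T)).

Definition aff_inv (T : aff) : aff :=
  mkaff (- ((\val T).1^-1 * (\val T).2)) (invr_neq0 (aff_neq0 T)).

Lemma aff_compA S T U : aff_comp S (aff_comp T U) = aff_comp (aff_comp S T) U.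
Proof. by apply: val_inj; rewrite /= !mulrA mulrDr mulrA addrA. Qed.

Lemma aff_comp1 T : aff_comp aff1 T = T.
Proof.
by apply: val_inj; rewrite /= !mul1r addr0; case: (\val T).
Qed.

Lemma aff_compV T : aff_comp (aff_inv T) T = aff1.
Proof. by apply: val_inj; rewrite /= mulVf ?aff_neq0// subrr. Qed.

End Affine.

Section Words.
Context {A : finType} (B : rel A).

(* The sequence (..., theta_{-1}, theta_0) is encoded as n |-> theta_{-n}. *)
Definition past : Type :=
  set_type [set t : {ptws nat -> discrete_topology A} |
            forall n, B (t n.+1) (t n)].
HB.instance Definition _ := Topological.on past.

Definition pastE (theta : past) : nat -> A := \val theta.

(* The word (theta_{-n}, ..., theta_0). *)
Definition past_word (theta : past) (n : nat) : seq A :=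
  rev (mkseq (pastE theta) n.+1).

(* A word (a_0, ..., a_n) has size n; the void word [::] has size 0 too. *)
Definition admissible_word (w : seq A) : bool := sorted B w.
Definition word_size (w : seq A) : nat := (size w).-1.

(* [w] is void or begins with theta_0. *)
Definition composable (theta : past) (w : seq A) : bool :=
  admissible_word w && (head (pastE theta 0%N) w == pastE theta 0%N).

Definition concat_fun (theta : nat -> A) (w : seq A) : nat -> A :=
  fun n => if (n < size w)%N then nth (theta 0%N) (rev w) n
           else theta (n - word_size w)%N.

(* theta w, when [composable theta w]. *)
Definition concat (theta : past) (w : seq A) : past :=
  insubd theta (concat_fun (pastE theta) w).

End Words.

Section LimitGeometry.
Context {R : realType} {eps : R} {A : finType} {B : rel A}.
Local Notation C := (Rcomplex R).
Context (K : Omega eps B).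

Definition branch (a : A) (z : C) : C :=
  xget 0 [set w | piece K a w /\ cmap K w = z].

(* f_w = (g|G(a_0))^-1 o ... o (g|G(a_{n-1}))^-1 on G(a_n), for
   w = (a_0, ..., a_n); the identity when w is void. *)
Fixpoint word_map (w : seq A) : C -> C :=
  match w with
  | a :: ((_ :: _) as w') => branch a \o word_map w'
  | _ => id
  end.

Context (c : A -> C).

(* A map on G(a) is differentiated through a C^{1+eps} extension to a
   neighbourhood; as G(a) is the closure of its interior, the differential does
   not depend on the extension. *)
Definition Phi (theta : past B) (n : nat) : aff R :=
  let a := pastE theta 0%N in
  let f := word_map (past_word theta n) in
  xget (aff1 R) [set T | aff_fun T (f (c a)) = 0 /\
    exists W F, [/\ open W, piece K a `<=` W, C1eps eps W F,
      forall z, piece K a z -> F z = aff_fun T (f z) &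
      forall v, 'd F (c a) v = v]].

Definition limit_geometry (theta : past B) (z : C) : C :=
  lim (aff_fun (Phi theta n) (word_map (past_word theta n) z) @[n --> \oo]).

Definition transition (theta : past B) (w : seq A) : aff R :=
  let theta' := concat theta w in
  xget (aff1 R) [set F | forall z, piece K (pastE theta' 0%N) z ->
    aff_fun F (limit_geometry theta' z) = limit_geometry theta (word_map w z)].

End LimitGeometry.

Section Configurations.
Context {R : realType} {eps : R} {A : finType} {B : rel A}.
Local Notation C := (Rcomplex R).
Context (K : Omega eps B) (a : A).

Definition config_extension (h : C -> C) (W : set C) (H : C -> C) : Prop :=
  [/\ open W, piece K a `<=` W, C1eps_embedding eps W H &
      forall z, piece K a z -> H z = h z].

Definition is_config (h : C -> C) : Prop :=
  exists W H, config_extension h W H.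

End Configurations.

Section StableIntersections.
Context {R : realType} {eps : R} {A A' : finType} {B : rel A} {B' : rel A'}.
Local Notation C := (Rcomplex R).
Context (K : Omega eps B) (K' : Omega eps B').

(* A configuration of the piece Gt(a) of a nearby Cantor set is compared with
   [h] on the part of Gt(a) that lies in the domain of an (arbitrary)
   extension [H] of [h] to a neighbourhood of G(a).  For Gt(a) = G(a) this is
   the C^{1+eps} topology on G(a).  If only the points of Gt(a) in G(a) itself
   were taken into account, nothing would be required of [ht] on the part of
   Kt(a) outside G(a), which may be all of Kt(a) when K(a) lies on the boundary
   of G(a). *)
Definition stable_intersections (a : A) (a' : A') (h h' : C -> C) : Prop :=
  [/\ is_config K a h, is_config K' a' h' &
  forall W H W' H', config_extension K a h W H ->
    config_extension K' a' h' W' H' ->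
  exists2 eta : R, 0 < eta &
  \forall KK \near (K, K'),
    forall ht Wt Ht ht' Wt' Ht',
    config_extension KK.1 a ht Wt Ht -> config_extension KK.2 a' ht' Wt' Ht' ->
    C1eps_close eps eta (W `&` piece KK.1 a) H Ht ->
    C1eps_close eps eta (W' `&` piece KK.2 a') H' Ht' ->
    (ht @` cantor_piece KK.1 a) `&` (ht' @` cantor_piece KK.2 a') !=set0].

(* The class [h, h'] of a pair of configurations. *)
Definition relative_config (h h' : C -> C) : set ((C -> C) * (C -> C)) :=
  [set (aff_fun T \o h, aff_fun T \o h') | T in [set: aff R]].

End StableIntersections.

Section RelativeLimitConfigurations.
Context (R : realType) {A A' : finType} (B : rel A) (B' : rel A').

Definition limit_pair : Type := ((aff R * past B) * (aff R * past B'))%type.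
HB.instance Definition _ := Topological.on limit_pair.

Definition aff_act (T : aff R) (p : limit_pair) : limit_pair :=
  ((aff_comp T p.1.1, p.1.2), (aff_comp T p.2.1, p.2.2)).

Definition aff_equiv (p q : limit_pair) : bool :=
  `[< exists T, q = aff_act T p >].

Lemma aff_equiv_class : equiv_class_of aff_equiv.
Proof.
have actM S T p : aff_act S (aff_act T p) = aff_act (aff_comp S T) p.
  by rewrite /aff_act /= !aff_compA.
have act1 p : aff_act (aff1 R) p = p.
  by case: p => [[? ?] [? ?]]; rewrite /aff_act /= !aff_comp1.
have sym p q : aff_equiv p q -> aff_equiv q p.
  move=> /asboolP[T ->]; apply/asboolP; exists (aff_inv T).
  by rewrite actM aff_compV act1.
split=> [p|p q|q p r].
- by apply/asboolP; exists (aff1 R); rewrite act1.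
- by apply/idP/idP; exact: sym.
- move=> /asboolP[S ->] /asboolP[T ->].
  by apply/asboolP; exists (aff_comp T S); rewrite actM.
Qed.

Canonical aff_equiv_rel := EquivRelPack aff_equiv_class.

Definition rel_limit_config : Type :=
  quotient_topology {eq_quot aff_equiv_rel}.
HB.instance Definition _ := Topological.on rel_limit_config.

Definition rel_class (p : limit_pair) : rel_limit_config :=
  \pi_(quotient_topology {eq_quot aff_equiv_rel}) p.

Definition rel_repr (v : rel_limit_config) : limit_pair :=
  repr (v : quotient_topology {eq_quot aff_equiv_rel}).

End RelativeLimitConfigurations.

Section Recurrent.
Context {R : realType} {eps : R} {A A' : finType} {B : rel A} {B' : rel A'}.
Local Notation C := (Rcomplex R).
Context (K : Omega eps B) (K' : Omega eps B') (c : A -> C) (c' : A' -> C).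

(* Well defined on classes: the transition maps act on the right. *)
Definition renorm (w : seq A) (w' : seq A') (v : rel_limit_config R B B') :
    rel_limit_config R B B' :=
  let: ((T, theta), (T', theta')) := rel_repr v in
  rel_class ((aff_comp T (transition K c theta w), concat theta w),
             (aff_comp T' (transition K' c' theta' w'), concat theta' w')).

Definition rel_composable (w : seq A) (w' : seq A')
    (v : rel_limit_config R B B') : bool :=
  composable (rel_repr v).1.2 w && composable (rel_repr v).2.2 w'.

Definition recurrent_sizes (P : nat -> bool)
    (L : set (rel_limit_config R B B')) : Prop :=
  compact L /\ forall v, L v -> exists w w',
    [/\ rel_composable w w' v, P (word_size w + word_size w')%N &
        interior L (renorm w w' v)].

Definition recurrent (L : set (rel_limit_config R B B')) : Prop :=
  recurrent_sizes (fun n => (0 < n)%N) L.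

Definition immediately_recurrent (L : set (rel_limit_config R B B')) : Prop :=
  recurrent_sizes (fun n => n == 1%N) L.

End Recurrent.

(* Main.v *)
From HB Require Import structures.
Require Import Defs.
From mathcomp Require Import all_boot all_order all_algebra.
From mathcomp Require Import all_classical all_reals all_analysis.
From mathcomp Require Import complex ring lra.
Import Order.TTheory GRing.Theory Num.Theory.
Import numFieldNormedType.Exports.
Local Open Scope classical_set_scope.
Local Open Scope ring_scope.
Set Implicit Arguments.
Unset Strict Implicit.
Unset Printing Implicit Defensive.

(** Every statement rests on the fact that limit geometries, and with them the
affine transition maps [F^{theta a}], depend continuously on the Cantor set,
uniformly in the past [theta].

Let [x], [y], [z] lie in a piece, [x] in the Cantor set, and let [x_n], [y_n],
[z_n] be their images under the inverse branch of the word [theta_n].  At the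
points [x_j] the differential of the map is multiplication by a complex number
[l(x_j)], so that [incr = (y_n - z_n) * l(x_1) * ... * l(x_n)] is defined.
Passing from [n] to [n + 1] changes it by a relative error of size
[|x_n - y_n|^eps + |x_n - z_n|^eps], by differentiability of class C^{1+eps},
and this decreases geometrically since the branches contract ([back_contract],
[incr_step]).  Hence the products converge, at a speed that only depends on the
hyperbolicity constants of the record [controlled]; their limit for [x] and [z]
equal to the base point is [k^theta(y)] ([limit_geometryE]).  The constants can
be kept on a neighbourhood of the Cantor set ([near_controlled]).  A truncation
at depth [n] involves finitely many iterates only, so limit geometries,
their derivatives on the Cantor set and the transition maps are close for close
data ([kfun_close], [kder_close], [transition_close]).  Base points of a nearby
Cantor set are chosen with the same itineraries as the given ones.

Persistence of recurrence follows: the words that bring a point of [L] to the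
interior of [L] also serve for the neighbouring points and the nearby Cantor
sets, and [L] is compact ([uniform_recurrence]).  For the immediately recurrent
hull, a renormalization by long words is a composition of elementary ones; a
compact neighbourhood of each intermediate point is chosen so small that the
next elementary step sends it to the interior of the next neighbourhood, and
finitely many such families of neighbourhoods cover [L] ([absorbed_exists],
[immediately_recurrent_hull]).

For stable intersections, let [h] be a configuration of a piece of a Cantor set
near [K] that is close to [S o k^theta].  Its deviation [D] from the map
[S o k~^theta] of the nearby Cantor set has a small Lipschitz constant on that
Cantor set ([config_close]): for close points both maps have almost the
same derivative, for distant points their values are close.  Restricted to the
image of a long inverse branch and rescaled by the affine map [S o F], with
[F o k~^u = k~^theta o f], the configuration is therefore a
uniformly small perturbation of [k~^u], and passing to the next word replaces
the relative configuration by its image under the renormalization operator up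
to a small translation [tau] ([next_state]).  As an immediately recurrent set
absorbs small translations, the renormalization can be continued for ever
within a compact set.  There the distance between the two normalizing
translations is bounded by a multiple of the size of the linear parts
([compact_bounded_shape]), which tends to zero.  So the images of the two
Cantor sets contain points that are arbitrarily close to each other; these
images being compact, they meet ([tracked_intersection]). *)

(** * The plane as a complete normed space *)

Section Plane.
Context {R : realType}.
Local Notation C := (Rcomplex R).
Local Notation cre := (@complex.Re R : Rcomplex R -> R).
Local Notation cim := (@complex.Im R : Rcomplex R -> R).

Lemma cnormM (x y : C) : `|x * y : C| = `|x| * `|y|.
Proof. exact: Normc.normcM. Qed.

Lemma cnorm1 : `|1 : C| = 1.
Proof. exact: Normc.normc1. Qed.

Lemma cnormV (x : C) : `|x^-1 : C| = `|x|^-1.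
Proof. exact: Normc.normcV. Qed.

Lemma cRe_le (z : C) : `|cre z| <= `|z|.
Proof.
case: z => x y; rewrite -sqrtr_sqr [leRHS]/Num.norm /=.
by rewrite ler_wsqrtr// lerDl sqr_ge0.
Qed.

Lemma cIm_le (z : C) : `|cim z| <= `|z|.
Proof.
case: z => x y; rewrite -sqrtr_sqr [leRHS]/Num.norm /=.
by rewrite ler_wsqrtr// lerDr sqr_ge0.
Qed.

Lemma cnorm_le (z : C) : `|z| <= `|cre z| + `|cim z|.
Proof.
case: z => x y; rewrite [leLHS]/Num.norm /=.
rewrite -[leRHS](@ger0_norm _ (`|x| + `|y|)) ?addr_ge0// -sqrtr_sqr.
rewrite ler_wsqrtr// sqrrD !real_normK ?num_real//.
by rewrite lerD2r lerDl mulrn_wge0// mulr_ge0.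
Qed.

Lemma mulc_scale (t : R) (x y : C) : x * (t *: y) = t *: (x * y).
Proof.
by case: x => a b; case: y => p q; apply/eqP; rewrite eq_complex /=; apply/andP;
  split; apply/eqP; ring.
Qed.

Lemma nbhs_cP (z : C) (A : set C) :
  nbhs z A <-> exists2 e : R, 0 < e & forall w : C, `|w - z| < e -> A w.
Proof.
split=> [/nbhs_ballP[e /= e0 h]|[e e0 h]].
  by exists e => // w wz; apply: h; rewrite -ball_normE /= distrC.
by apply/nbhs_ballP; exists e => //= w; rewrite -ball_normE /= distrC; exact: h.
Qed.

Lemma continuous_cP (V : normedModType R) (f : C -> V) (z : C) :
  {for z, continuous f} <->
  forall e : R, 0 < e ->
    exists2 d : R, 0 < d & forall w : C, `|w - z| < d -> `|f w - f z| < e.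
Proof.
split=> [cf e e0|h].
  have /nbhs_cP[d d0 hd] : nbhs z (f @^-1` ball (f z) e).
    exact/cf/nbhsx_ballx.
  by exists d => // w /hd; rewrite -ball_normE /= distrC.
move=> A /nbhs_ballP[e /= e0 hA]; apply/nbhs_cP.
have [d d0 hd] := h e e0; exists d => // w /hd fw.
by apply: hA; rewrite -ball_normE /= distrC.
Qed.

Lemma cRe_continuous : continuous cre.
Proof.
move=> z; apply/continuous_cP => e e0; exists e => // w wz.
have -> : cre w - cre z = cre (w - z) by case: z w {wz} => ? ? [].
exact: le_lt_trans (cRe_le _) wz.
Qed.

Lemma cIm_continuous : continuous cim.
Proof.
move=> z; apply/continuous_cP => e e0; exists e => // w wz.
have -> : cim w - cim z = cim (w - z) by case: z w {wz} => ? ? [].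
exact: le_lt_trans (cIm_le _) wz.
Qed.

Lemma cvg_complex (F : set_system C) (FF : Filter F) (x y : R) :
  cre @ F --> x -> cim @ F --> y -> F --> ((x +i* y)%C : C).
Proof.
move=> Fx Fy; apply/cvgrPdist_le => e e0.
have e20 : 0 < e / 2 by rewrite divr_gt0.
have hx : \forall w \near F, `|x - cre w| <= e / 2
  by move/cvgrPdist_le: Fx; apply.
have hy : \forall w \near F, `|y - cim w| <= e / 2
  by move/cvgrPdist_le: Fy; apply.
apply: filterS2 hx hy => -[a b] /= hx hy.
by apply: le_trans (cnorm_le _) _; rewrite [e]splitr lerD.
Qed.

Lemma Rcomplex_complete (F : set_system C) : ProperFilter F -> cauchy F -> cvg F.
Proof.
move=> FF /cauchy_ballP Fc.
have Rc : cvg (cre @ F).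
  apply/cauchy_cvgP/cauchy_ballP => e e0; rewrite !near_simpl.
  have := Fc e e0; rewrite !near_simpl; apply: filterS => -[z w] /=.
  rewrite -!ball_normE /=; apply: le_lt_trans.
  have -> : cre z - cre w = cre (z - w) by case: z w => ? ? [].
  exact: cRe_le.
have Ic : cvg (cim @ F).
  apply/cauchy_cvgP/cauchy_ballP => e e0; rewrite !near_simpl.
  have := Fc e e0; rewrite !near_simpl; apply: filterS => -[z w] /=.
  rewrite -!ball_normE /=; apply: le_lt_trans.
  have -> : cim z - cim w = cim (z - w) by case: z w => ? ? [].
  exact: cIm_le.
apply/cvg_ex; exists ((lim (cre @ F) +i* lim (cim @ F))%C : C).
exact: cvg_complex.
Qed.

HB.instance Definition _ := Uniform_isComplete.Build C Rcomplex_complete.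

End Plane.

(** * Sequences with geometrically small relative increments *)

Section Geometric.
Context {R : realType}.
Local Notation C := (Rcomplex R).

Lemma expr_lt_exists (q e : R) : 0 <= q < 1 -> 0 < e -> exists n, q ^+ n < e.
Proof.
move=> /andP[q0 q1] e0.
have /cvgrPdist_lt/(_ e e0) : GRing.exp q @ \oo --> (0 : R).
  by apply: cvg_expr; rewrite ger0_norm.
case=> n _ /(_ n (leqnn n)) /=; rewrite sub0r normrN ger0_norm ?exprn_ge0//.
by move=> h; exists n.
Qed.

Lemma geometric_sum_le (q : R) n : 0 <= q < 1 ->
  0 <= \sum_(j < n) q ^+ j <= (1 - q)^-1.
Proof.
move=> /andP[q0 q1]; apply/andP; split.
  by apply: sumr_ge0 => j _; rewrite exprn_ge0.
have q1' : 0 < 1 - q by rewrite subr_gt0.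
rewrite -[leRHS]mul1r ler_pdivlMr//.
elim: n => [|n IH]; first by rewrite big_ord0 mul0r.
have : (\sum_(j < n.+1) q ^+ j) = 1 + q * \sum_(j < n) q ^+ j.
  rewrite big_ord_recl expr0; congr (_ + _); rewrite mulr_sumr.
  by apply: eq_bigr => j _; rewrite -exprS.
move=> ->; rewrite mulrDl mul1r -mulrA -[leRHS](subrK q) lerD2l.
by rewrite -[leRHS]mulr1 ler_wpM2l.
Qed.

(** An upper bound for the product of the [1 + a * q ^+ n]. *)
Definition geo_const (a q : R) := expR (a / (1 - q)).

Lemma geo_const_gt0 a q : 0 < geo_const a q. Proof. exact: expR_gt0. Qed.

Lemma geo_const_le a b q : a <= b -> 0 <= q < 1 -> geo_const a q <= geo_const b q.
Proof.
by move=> ab /andP[_ q1]; rewrite ler_expR ler_wpM2r// invr_ge0 subr_ge0 ltW.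
Qed.

(** A discrete Gronwall inequality. *)
Lemma geo_real (r : nat -> R) (a b q : R) :
  0 <= a -> 0 <= b -> 0 <= q < 1 -> 0 <= r 0%N ->
  (forall n, r n.+1 <= (1 + a * q ^+ n) * r n + b * q ^+ n) ->
  forall n, r n <= geo_const a q * (r 0%N + b / (1 - q)).
Proof.
move=> a0 b0 q01 r0 hr n; have /andP[q0 q1] := q01.
pose S k := \sum_(j < k) q ^+ j.
have S0 k : 0 <= S k by have /andP[] := geometric_sum_le k q01.
have S1 k : S k.+1 = S k + q ^+ k by rewrite /S big_ord_recr.
suff : r n <= expR (a * S n) * (r 0%N + b * S n).
  move/le_trans; apply; have /andP[_ Sn] := geometric_sum_le n q01.
  apply: ler_pM; rewrite ?expR_ge0 ?addr_ge0 ?mulr_ge0//.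
    by rewrite ler_expR ler_wpM2l.
  by rewrite lerD2l ler_wpM2l.
elim: n => [|n IH]; first by rewrite /S big_ord0 !mulr0 expR0 mul1r addr0.
have qn : 0 <= q ^+ n by rewrite exprn_ge0.
apply: le_trans (hr n) _; rewrite S1 !mulrDr expRD.
have e1 : 1 + a * q ^+ n <= expR (a * q ^+ n) by exact: expR_ge1Dx.
have e2 : 1 <= expR (a * S n) * expR (a * q ^+ n).
  by rewrite -expRD; apply: le_trans (expR_ge1Dx _); rewrite lerDl addr_ge0 ?mulr_ge0.
rewrite addrA -mulrDr lerD//; last by rewrite ler_peMl// mulr_ge0.
apply: le_trans (_ : expR (a * q ^+ n) * (expR (a * S n) * (r 0%N + b * S n)) <= _);
  last by rewrite mulrCA mulrA.
apply: le_trans (_ : (1 + a * q ^+ n) * (expR (a * S n) * (r 0%N + b * S n)) <= _).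
  by rewrite ler_wpM2l// addr_ge0// mulr_ge0.
by rewrite ler_wpM2r// mulr_ge0 ?expR_ge0// addr_ge0// mulr_ge0.
Qed.

Lemma geo_upper (u : nat -> C) (a q : R) : 0 <= a -> 0 <= q < 1 ->
  (forall n, `|u n.+1 - u n| <= a * q ^+ n * `|u n|) ->
  forall n, `|u n| <= geo_const a q * `|u 0%N|.
Proof.
move=> a0 q01 hu n.
have := @geo_real (fun n => `|u n|) a 0 q a0 (lexx _) q01 (normr_ge0 _) _ n.
rewrite mul0r addr0; apply => k; rewrite mul0r addr0 mulrDl mul1r.
by rewrite -[u k.+1](subrK (u k)) addrC (le_trans (ler_normD _ _))// lerD2l.
Qed.

(** The bound is relative to the later term, so that the recursion can be run
    backwards from [u n] to [u 0]. *)
Lemma geo_lower (u : nat -> C) (a q : R) : 0 <= a -> 0 <= q < 1 ->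
  (forall n, `|u n.+1 - u n| <= a * q ^+ n * `|u n.+1|) ->
  forall n, `|u 0%N| <= geo_const a q * `|u n|.
Proof.
move=> a0 q01 hu n; have /andP[q0 q1] := q01.
pose v k := `|u (n - k)%N|.
pose S k := \sum_(j < k) q ^+ j.
suff h k : `|u 0%N| <= expR (a * S k) * `|u k|.
  apply: le_trans (h n) _; apply: ler_wpM2r => //.
  rewrite ler_expR ler_wpM2l//; by have /andP[] := geometric_sum_le n q01.
elim: k => [|k IH]; first by rewrite /S big_ord0 mulr0 expR0 mul1r.
apply: le_trans IH _; rewrite /S big_ord_recr/= mulrDr expRD -mulrA.
apply: ler_wpM2l; first exact: expR_ge0.
apply: le_trans (_ : (1 + a * q ^+ k) * `|u k.+1| <= _); last first.
  by apply: ler_wpM2r => //; exact: expR_ge1Dx.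
rewrite mulrDl mul1r -{1}[u k](subrK (u k.+1)) addrC.
by apply: le_trans (ler_normD _ _) _; rewrite lerD2l distrC.
Qed.

Lemma geo_dist (u : nat -> C) (b q : R) : 0 <= b -> 0 <= q < 1 ->
  (forall n, `|u n.+1 - u n| <= b * q ^+ n) ->
  forall n k, `|u (n + k)%N - u n| <= b / (1 - q) * q ^+ n.
Proof.
move=> b0 q01 hu n k; have /andP[q0 q1] := q01.
have {1}-> : b / (1 - q) * q ^+ n = b * q ^+ n * (1 - q)^-1 by rewrite mulrAC.
apply: le_trans (_ : b * q ^+ n * \sum_(j < k) q ^+ j <= _); last first.
  apply: ler_wpM2l; first by rewrite mulr_ge0 ?exprn_ge0.
  by have /andP[] := geometric_sum_le k q01.
elim: k => [|k IH]; first by rewrite addn0 subrr normr0 big_ord0 mulr0.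
rewrite big_ord_recr/= mulrDr -[b * q ^+ n * q ^+ k]mulrA -exprD addnS.
rewrite -[u _.+1](subrK (u (n + k)%N)) -addrA addrC.
by apply: le_trans (ler_normD _ _) _; rewrite lerD.
Qed.

Lemma cvg_near_le (u : nat -> C) (l x : C) (d : R) (m : nat) :
  u @ \oo --> l -> (forall n, (m <= n)%N -> `|u n - x| <= d) -> `|l - x| <= d.
Proof.
move=> /cvgrPdist_lt ul h; apply/ler_addgt0Pl => e e0.
have [N _ hN] := ul e e0.
have := hN (maxn N m) (leq_maxl _ _) => /= hl.
rewrite -[l](subrK (u (maxn N m))) -addrA.
apply: le_trans (ler_normD _ _) _; apply: lerD; first exact: ltW.
by apply: h; exact: leq_maxr.
Qed.

Lemma geo_cvg (u : nat -> C) (b q : R) : 0 <= b -> 0 <= q < 1 ->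
  (forall n, `|u n.+1 - u n| <= b * q ^+ n) ->
  exists2 l : C, u @ \oo --> l &
    forall n, `|l - u n| <= b / (1 - q) * q ^+ n.
Proof.
move=> b0 q01 hu; have hd := geo_dist b0 q01 hu.
have /andP[q0 q1] := q01.
have : cvg (u @ \oo).
  apply/cauchy_cvgP/cauchy_exP => e e0.
  have K0 : 0 < b / (1 - q) + 1 by rewrite ltr_wpDl// divr_ge0// subr_ge0 ltW.
  have [n hn] := @expr_lt_exists q (e / (b / (1 - q) + 1)) q01 (divr_gt0 e0 K0).
  exists (u n); exists n => // k /= nk; rewrite -ball_normE /= distrC.
  rewrite -(subnKC nk); apply: le_lt_trans (hd _ _) _.
  move: hn; rewrite ltr_pdivlMr// mulrC; apply: le_lt_trans.
  by rewrite ler_wpM2r ?exprn_ge0// lerDl.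
move/cvg_ex => [l ul]; exists l => // n.
by apply: (cvg_near_le (m := n) ul) => k nk; rewrite -(subnKC nk) hd.
Qed.

Lemma geo_step (u : nat -> C) (a q : R) : 0 <= a -> 0 <= q < 1 ->
  (forall n, `|u n.+1 - u n| <= a * q ^+ n * `|u n|) ->
  forall n, `|u n.+1 - u n| <= a * geo_const a q * `|u 0%N| * q ^+ n.
Proof.
move=> a0 q01 hu n; have /andP[q0 _] := q01.
apply: le_trans (hu n) _; rewrite mulrAC ler_wpM2r ?exprn_ge0// -mulrA.
by rewrite ler_wpM2l// geo_upper.
Qed.

(** If the relative increments of [u] are at most [a * q ^+ n], the distance from
    [u n] to the limit is at most [geo_rate a q * `|u 0| * q ^+ n]. *)
Definition geo_rate (a q : R) := a * geo_const a q / (1 - q).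

Lemma geo_rate_ge0 a q : 0 <= a -> 0 <= q < 1 -> 0 <= geo_rate a q.
Proof.
move=> a0 /andP[_ q1]; rewrite /geo_rate divr_ge0 ?subr_ge0 ?(ltW q1)// mulr_ge0//.
exact/ltW/geo_const_gt0.
Qed.

Lemma geo_mul_cvg (u : nat -> C) (a q : R) : 0 <= a -> 0 <= q < 1 ->
  (forall n, `|u n.+1 - u n| <= a * q ^+ n * `|u n|) ->
  exists2 l : C, u @ \oo --> l &
    forall n, `|l - u n| <= geo_rate a q * `|u 0%N| * q ^+ n.
Proof.
move=> a0 q01 hu; have b0 : 0 <= a * geo_const a q * `|u 0%N|.
  by rewrite !mulr_ge0// ltW// geo_const_gt0.
have [l ul hl] := geo_cvg b0 q01 (geo_step a0 q01 hu).
by exists l => // n; apply: le_trans (hl n) _; rewrite /geo_rate (mulrAC _ `|u 0%N|).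
Qed.

End Geometric.

(** * Uniformity on compact sets and mean value estimates *)

Section Compactness.
Context {R : realType}.
Local Notation C := (Rcomplex R).

(** The small scales form a filter, so this is compactness in near-covering form. *)
Lemma compact_uniform_top (X : topologicalType) (G : set X) (P : R -> X -> Prop) :
  compact G ->
  (forall x, G x -> exists2 N, nbhs x N & exists2 d : R, 0 < d &
     forall x' e, N x' -> 0 < e < d -> P e x') ->
  exists2 e : R, 0 < e & forall x, G x -> P e x.
Proof.
move=> /compact_near_coveringP cG h.
have : \forall e \near (0 : R)^'+, forall x, G x -> P e x.
  apply: cG => x Gx.
  have [N xN [d d0 hN]] := h x Gx.
  exists (N, [set e | 0 < e < d]) => [|[x' e] [] /= Nx' ed]; last exact: hN.
  split => //=; near=> e; apply/andP; split; near: e.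
    exact: nbhs_right_gt.
  exact: nbhs_right_lt.
move=> H; have : \forall e \near (0 : R)^'+, 0 < e /\ forall x, G x -> P e x.
  near=> e; split; near: e => //; exact: nbhs_right_gt.
by move=> /filter_ex[e [e0 He]]; exists e.
Unshelve. all: by end_near. Qed.

Lemma compact_uniform (G : set C) (P : R -> C -> Prop) :
  compact G ->
  (forall x, G x -> exists2 d : R, 0 < d &
     forall x' e, `|x' - x| < d -> 0 < e < d -> P e x') ->
  exists2 e : R, 0 < e & forall x, G x -> P e x.
Proof.
move=> cG h; apply: compact_uniform_top => // x Gx.
have [d d0 hd] := h x Gx; exists [set x' | `|x' - x| < d].
  by apply/nbhs_cP; exists d.
by exists d => // x' e; exact: hd.
Qed.

End Compactness.

Section MeanValue.
Context {R : realType}.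
Local Notation C := (Rcomplex R).
Local Notation cre := (@complex.Re R : Rcomplex R -> R).
Local Notation cim := (@complex.Im R : Rcomplex R -> R).

Lemma is_diff_line (z v : C) (t : R) :
  is_diff t (fun s : R => z + s *: v : C) (fun s : R => s *: v : C).
Proof.
have h : is_diff t (fun s : R => s *: v : C) (fun s : R => s *: v : C).
  exact: is_diff_scalel.
have := is_diffD (is_diff_cst z t) h.
move/is_diff_eq; apply.
by apply/funext => s; exact: add0r.
Qed.

Lemma mvt_linear (l : {linear C -> R}) (f : C -> C) (z v w : C) (K : R) :
  continuous l -> (forall x, `|l x| <= `|x|) ->
  (forall t : R, 0 <= t <= 1 -> differentiable f (z + t *: v)) ->
  (forall t : R, 0 <= t <= 1 -> `|'d f (z + t *: v) v - w| <= K) ->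
  `|l (f (z + v) - f z - w)| <= K.
Proof.
move=> cl l1 df dK.
pose g (t : R) := l (f (z + t *: v)).
have dg (t : R) : 0 <= t <= 1 -> is_derive t 1 g (l ('d f (z + t *: v) v)).
  move=> t01.
  pose ga (t : R) : C := z + t *: v.
  have dga : is_diff t ga (fun s : R => s *: v : C) by exact: is_diff_line.
  have dfg : is_diff (ga t) f ('d f (ga t)).
    by apply: DiffDef => //; exact: df.
  have dl : is_diff (f (ga t)) l l.
    by apply: DiffDef; [exact: linear_differentiable|exact: diff_lin].
  have h1 := is_diff_comp dga dfg.
  have h2 := is_diff_comp h1 dl.
  have dgt : differentiable g t by case: h2.
  apply: DeriveDef; first exact/derivable1_diffP.
  have E : ('d g t : R -> R) = l \o ('d f (ga t) \o (fun s : R => s *: v)).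
    exact: (@diff_val _ _ _ _ _ _ _ h2).
  rewrite deriveE// E /=.
  by rewrite scale1r.
have cg : {within `[(0 : R), 1], continuous g}.
  apply: derivable_within_continuous => t; rewrite in_itv /= => t01.
  exact: (@ex_derive _ _ _ _ _ _ _ (dg t t01)).
have dg' (t : R) : t \in `]0, 1[ -> is_derive t 1 g (l ('d f (z + t *: v) v)).
  by rewrite in_itv /= => /andP[t0 t1]; apply: dg; rewrite !ltW.
have [c] := MVT ltr01 dg' cg.
rewrite in_itv /= => /andP[c0 c1].
rewrite /g scale1r scale0r addr0 subr0 mulr1 => E.
rewrite !linearB /= E -linearB /=.
by apply: le_trans (l1 _) (dK _ _); rewrite !ltW.
Qed.

(** The mean value theorem is applied to the real and to the imaginary part, whence
    the factor 2. *)
Lemma mvt_c (f : C -> C) (z v w : C) (K : R) :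
  (forall t : R, 0 <= t <= 1 -> differentiable f (z + t *: v)) ->
  (forall t : R, 0 <= t <= 1 -> `|'d f (z + t *: v) v - w| <= K) ->
  `|f (z + v) - f z - w| <= 2 * K.
Proof.
move=> df dK; apply: le_trans (cnorm_le _) _; rewrite mulr2n mulrDl mul1r lerD//.
  exact: (mvt_linear (l := cre) cRe_continuous cRe_le df dK).
exact: (mvt_linear (l := cim) cIm_continuous cIm_le df dK).
Qed.

Lemma diff_taylor (f : C -> C) (x : C) : differentiable f x ->
  forall e : R, 0 < e -> exists2 d : R, 0 < d &
    forall h : C, `|h| < d -> `|f (x + h) - f x - 'd f x h| <= e * `|h|.
Proof.
move=> /diff_locally/eqaddoP + e e0 => /(_ e e0)/nbhs_cP[d d0 hd].
exists d => // h hh; have := hd h; rewrite subr0 => /(_ hh) /=.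
by rewrite -[X in `|X|]/(f (h + x) - (f x + 'd f x h)) opprD addrA (addrC h).
Qed.

Lemma bounded_linear_cont (L : {linear C -> C}) (M : R) :
  (forall v, `|L v| <= M * `|v|) -> continuous L.
Proof.
move=> LM; apply/linear_bounded_continuous/linear_boundedP.
exists M; split => [|r /ltW Mr v]; first exact: num_real.
by apply: le_trans (LM v) _; exact: ler_wpM2r.
Qed.

Lemma diff_bound (f : C -> C) (x : C) : differentiable f x ->
  exists2 M : R, 0 <= M & forall v, `|'d f x v| <= M * `|v|.
Proof.
move=> df; have /linear_bounded_continuous/linear_boundedP : continuous ('d f x).
  exact: diff_continuous.
by move=> /pinfty_ex_gt0 [M M0 hM]; exists M; [exact: ltW|].
Qed.

Lemma diff_build (f : C -> C) (x : C) (L : {linear C -> C}) (M : R) :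
  (forall v, `|L v| <= M * `|v|) ->
  (forall e : R, 0 < e -> exists2 d : R, 0 < d &
    forall h : C, `|h| < d -> `|f (x + h) - f x - L h| <= e * `|h|) ->
  differentiable f x /\ forall v, 'd f x v = L v.
Proof.
move=> LM h; have cL := bounded_linear_cont LM.
have E : f \o shift x = cst (f x) + L +o_ 0 id.
  apply/eqaddoP => e e0; apply/nbhs_cP; have [d d0 hd] := h e e0.
  exists d => // k; rewrite subr0 => /hd /=.
  by rewrite -[X in _ -> is_true (`|X| <= _)]/(f (k + x) - (f x + L k))
    opprD addrA (addrC k).
have D := diff_unique cL E.
split; last by rewrite D.
by apply/diff_locallyP; rewrite D; split.
Qed.

Lemma powR_small (eps e : R) : 0 < eps -> 0 < e ->
  exists2 d : R, 0 < d & forall t, 0 <= t <= d -> t `^ eps <= e.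
Proof.
move=> eps0 e0; exists (e `^ eps^-1); first exact: powR_gt0.
move=> t /andP[t0 td].
apply: le_trans (ge0_ler_powR (ltW eps0) _ _ td) _; rewrite ?nnegrE ?powR_ge0//.
by rewrite -powRrM mulVf ?gt_eqF// powRr1// ltW.
Qed.

(** A form of C^{1+eps} regularity on a ball with explicit constants: besides
    the Hoelder bound on the differential it records strict differentiability
    at each point, the estimate that compares increments with the differential
    at a third point. *)
Definition tame (eps : R) (f : C -> C) (x : C) (r M : R) : Prop :=
  [/\ forall y, `|y - x| < r -> differentiable f y,
      forall y z v, `|y - x| < r -> `|z - x| < r ->
        `|'d f y v - 'd f z v| <= M * `|y - z| `^ eps * `|v| &
      forall p y z, `|p - x| < r -> `|y - x| < r -> `|z - x| < r ->
        `|f y - f z - 'd f p (y - z)| <=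
          M * (Num.max `|y - p| `|z - p|) `^ eps * `|y - z|].

Lemma segment_norm (y z p : C) (t : R) : 0 <= t <= 1 ->
  `|z + t *: (y - z) - p| <= Num.max `|y - p| `|z - p|.
Proof.
move=> /andP[t0 t1].
have -> : z + t *: (y - z) - p = t *: (y - p) + (1 - t) *: (z - p).
  rewrite scalerBl scale1r !scalerBr; set a := t *: y; set b := t *: z; set c := t *: p.
  by rewrite [RHS]addrC -!addrA; congr (_ + _); ring.
apply: le_trans (ler_normD _ _) _.
rewrite !normrZ !ger0_norm ?subr_ge0//.
set m := Num.max _ _.
have -> : m = t * m + (1 - t) * m by ring.
by apply: lerD; apply: ler_wpM2l; rewrite ?subr_ge0// /m le_max lexx ?orbT.
Qed.

Lemma holder_tame (eps : R) (f : C -> C) (x : C) (r M : R) :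
  0 < eps -> 0 <= M ->
  (forall y, `|y - x| < r -> differentiable f y) ->
  (forall y z v, `|y - x| < r -> `|z - x| < r ->
        `|'d f y v - 'd f z v| <= M * `|y - z| `^ eps * `|v|) ->
  tame eps f x r (2 * M).
Proof.
move=> eps0 M0 df hf; split => //.
  move=> y z v hy hz; apply: le_trans (hf y z v hy hz) _.
  by rewrite -!mulrA ler_peMl ?ler1n// !mulr_ge0 ?powR_ge0.
move=> p y z hp hy hz.
set m := Num.max _ _.
have seg t : 0 <= t <= 1 -> `|z + t *: (y - z) - x| < r.
  move=> t01; apply: le_lt_trans (segment_norm y z x t01) _.
  by rewrite gt_max hy hz.
have := @mvt_c f z (y - z) ('d f p (y - z)) (M * m `^ eps * `|y - z|).
have -> : z + (y - z) = y by rewrite addrC subrK.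
rewrite !mulrA; apply => t t01; first exact/df/seg.
apply: le_trans (hf _ _ _ (seg t t01) hp) _.
apply: ler_wpM2r => //; apply: ler_wpM2l => //.
apply: ge0_ler_powR; rewrite ?nnegrE ?(ltW eps0)//; last exact: segment_norm.
by rewrite /m le_max normr_ge0.
Qed.

Lemma tame_le eps f x r M x' r' M' : 0 <= M -> M <= M' ->
  (forall y, `|y - x'| < r' -> `|y - x| < r) ->
  tame eps f x r M -> tame eps f x' r' M'.
Proof.
move=> M0 MM sub [t1 t2 t3]; split.
- by move=> y /sub; exact: t1.
- move=> y z v /sub hy /sub hz; apply: le_trans (t2 y z v hy hz) _.
  by rewrite -!mulrA ler_wpM2r// mulr_ge0 ?powR_ge0.
- move=> p y z /sub hp /sub hy /sub hz; apply: le_trans (t3 p y z hp hy hz) _.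
  by rewrite -!mulrA ler_wpM2r// mulr_ge0 ?powR_ge0.
Qed.

Lemma open_cP (U : set C) (x : C) : open U -> U x ->
  exists2 r : R, 0 < r & forall y, `|y - x| < r -> U y.
Proof. by move=> oU Ux; apply/nbhs_cP; apply: open_nbhs_nbhs. Qed.

(** A single constant serves as radius and, inverted, as bound: this form is
    stable under passing to a smaller constant, as compactness arguments need. *)
Lemma C1eps_tame eps (U : set C) (f : C -> C) (x : C) :
  0 < eps -> open U -> C1eps eps U f -> U x ->
  exists2 d : R, 0 < d & (forall y, `|y - x| < d -> U y) /\ tame eps f x d d^-1.
Proof.
move=> eps0 oU [df hf] Ux.
have [r1 r10 h1] := open_cP oU Ux.
have [M [r2 [r20 h2]]] := hf x Ux.
pose N := 2 * Num.max M 0.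
have N0 : 0 <= N by rewrite mulr_ge0// le_max lexx orbT.
pose d := Num.min (Num.min r1 r2) (N + 1)^-1.
have d0 : 0 < d by rewrite !lt_min r10 r20 invr_gt0 ltr_wpDl.
have dr1 y : `|y - x| < d -> `|y - x| < r1.
  by move/lt_le_trans; apply; rewrite /d !ge_min lexx.
have dr2 y : `|y - x| < d -> `|y - x| < r2.
  by move/lt_le_trans; apply; rewrite /d !ge_min lexx orbT.
exists d => //; split; first by move=> y /dr1/h1.
have : tame eps f x d N.
  apply: holder_tame => //; first by rewrite le_max lexx orbT.
    by move=> y /dr1/h1; exact: df.
  move=> y z v /dr2 hy /dr2 hz; apply: le_trans (h2 y z v _ _) _.
  - by rewrite -ball_normE /= distrC.
  - by rewrite -ball_normE /= distrC.
  by rewrite -!mulrA ler_wpM2r ?mulr_ge0 ?powR_ge0// le_max lexx.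
apply: tame_le => //; rewrite -[leRHS]div1r ler_pdivlMr//.
apply: le_trans (_ : (N + 1) * d <= _).
  by rewrite ler_wpM2r ?(ltW d0)// lerDl.
rewrite mulrC -ler_pdivlMr ?ltr_wpDl// div1r.
by rewrite /d ge_min lexx orbT.
Qed.

Lemma C1eps_tame_compact eps (U G : set C) (f : C -> C) :
  0 < eps -> open U -> C1eps eps U f -> compact G -> G `<=` U ->
  exists2 d : R, 0 < d & forall x, G x ->
    (forall y, `|y - x| < d -> U y) /\ tame eps f x d d^-1.
Proof.
move=> eps0 oU cf cG GU.
apply: compact_uniform => // x /GU Ux.
have [d d0 [dU dt]] := C1eps_tame eps0 oU cf Ux.
exists (d / 2); first by rewrite divr_gt0.
move=> y e yx /andP[e0 ed].
have sub z : `|z - y| < e -> `|z - x| < d.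
  move=> zy; rewrite -[z](subrK y) -addrA (splitr d).
  by apply: le_lt_trans (ler_normD _ _) _; apply: ltrD => //; exact: lt_trans ed.
split; first by move=> z /sub/dU.
apply: tame_le dt => //; first by rewrite invr_ge0 ltW.
rewrite lef_pV2 ?posrE//; apply/ltW/(lt_le_trans ed).
by rewrite ler_pdivrMr// ler_peMr ?ltW// ltr1n.
Qed.

(** Difference quotients between interior points of [G] near [x] already see every
    direction, whereas [x] itself may be the tip of a cusp of [G]. *)
Lemma diff_regular_eq eps (W G : set C) (H : C -> C) (x : C) (L : {linear C -> C}) :
  0 < eps -> open W -> C1eps eps W H -> G `<=` W -> G = closure (interior G) ->
  G x ->
  (forall e : R, 0 < e -> exists2 d : R, 0 < d & forall y z, G y -> G z ->
     `|y - x| < d -> `|z - x| < d ->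
     `|H y - H z - L (y - z)| <= e * `|y - z|) ->
  forall v, 'd H x v = L v.
Proof.
move=> eps0 oW cH GW rG Gx hL v.
have [d1 d10 [_ [_ _ t3]]] := C1eps_tame eps0 oW cH (GW _ Gx).
have [-> | v0] := eqVneq v 0; first by rewrite !linear0.
apply/eqP; rewrite -subr_eq0 -normr_eq0; apply/eqP/le_anti; rewrite normr_ge0 andbT.
apply/ler_addgt0Pl => e' e'0; rewrite addr0.
pose e := e' / (2 * `|v|).
have nv : 0 < `|v| by rewrite normr_gt0.
have e0 : 0 < e by rewrite divr_gt0// mulr_gt0.
have [d2 d20 h2] := hL e e0.
have [d3 d30 h3] := powR_small eps0 (mulr_gt0 e0 d10).
pose d := Num.min (Num.min d1 d2) d3.
have d0 : 0 < d by rewrite !lt_min d10 d20.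
have cx : closure (interior G) x by rewrite -rG.
have nx : nbhs x [set y : C | `|y - x| < d] by apply/nbhs_cP; exists d.
(* The increments start at an interior point [z]: the segment from [z] to [z + t v]
   stays in [G] for small [t], unlike the segment from [x]. *)
have [z [/= iz zx]] := cx _ nx.
have [s s0 hs] : exists2 s : R, 0 < s & forall y, `|y - z| < s -> G y.
  by apply/nbhs_cP; exact: iz.
pose t := Num.min (s / (2 * `|v|)) ((d - `|z - x|) / (2 * `|v|)).
have v2 : 0 < 2 * `|v| by rewrite mulr_gt0.
have t0 : 0 < t by rewrite lt_min !divr_gt0// subr_gt0.
have tv : `|t *: v| = t * `|v| by rewrite normrZ gtr0_norm.
have tvs : `|t *: v| < s.
  rewrite tv; apply: le_lt_trans (_ : s / 2 < _); last by rewrite ltr_pdivrMr// ltr_pMr// ltr1n.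
  apply: le_trans (_ : s / (2 * `|v|) * `|v| <= _).
    by rewrite ler_wpM2r// ge_min lexx.
  by rewrite invfM mulrA -[leLHS]mulrA mulVf ?mulr1// gt_eqF.
have tvd : `|t *: v| < d - `|z - x|.
  rewrite tv; set u := d - _.
  have u0 : 0 < u by rewrite subr_gt0.
  apply: le_lt_trans (_ : u / 2 < _); last by rewrite ltr_pdivrMr// ltr_pMr// ltr1n.
  apply: le_trans (_ : u / (2 * `|v|) * `|v| <= _).
    by rewrite ler_wpM2r// ge_min lexx orbT.
  by rewrite invfM mulrA -[leLHS]mulrA mulVf ?mulr1// gt_eqF.
pose y := z + t *: v.
have yz : y - z = t *: v by rewrite /y addrC addKr.
have Gy : G y by apply: hs; rewrite yz.
have Gz : G z by apply: hs; rewrite subrr normr0.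
have yx : `|y - x| < d.
  rewrite /y addrAC addrC; apply: le_lt_trans (ler_normD _ _) _.
  by rewrite -ltrBrDr.
have dd1 w : `|w - x| < d -> `|w - x| < d1.
  by move/lt_le_trans; apply; rewrite /d !ge_min lexx.
have dd2 w : `|w - x| < d -> `|w - x| < d2.
  by move/lt_le_trans; apply; rewrite /d !ge_min lexx orbT.
have dd3 w : `|w - x| < d -> `|w - x| <= d3.
  by move/ltW/le_trans; apply; rewrite /d !ge_min lexx !orbT.
have E1 := h2 y z Gy Gz (dd2 _ yx) (dd2 _ zx).
have := t3 x y z _ (dd1 _ yx) (dd1 _ zx); rewrite subrr normr0 => /(_ d10) E2.
have E3 : (Num.max `|y - x| `|z - x|) `^ eps <= e * d1.
  by apply: h3; rewrite le_max normr_ge0 ge_max /= !dd3.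
have E4 : `|H y - H z - 'd H x (y - z)| <= e * `|y - z|.
  apply: le_trans E2 _; apply: ler_wpM2r => //.
  by rewrite mulrC ler_pdivrMr.
have E5 : t * `|'d H x v - L v| <= t * e'.
  have -> : t * `|'d H x v - L v| = `|'d H x (y - z) - L (y - z)|.
    have A1 : 'd H x (t *: v) = t *: 'd H x v :> C by exact: linearZ_LR.
    have A2 : L (t *: v) = t *: L v :> C by exact: linearZ_LR.
    have A3 (a b : C) : t *: a - t *: b = t *: (a - b) by rewrite scalerBr.
    by rewrite yz A1 A2 A3 normrZ gtr0_norm.
  have -> : 'd H x (y - z) - L (y - z) =
     (H y - H z - L (y - z)) - (H y - H z - 'd H x (y - z)).
    by set A := 'd H x _; set B := L _; set D := H y - H z; ring.
  apply: le_trans (ler_normB _ _) _; apply: le_trans (lerD E1 E4) _.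
  rewrite -mulr2n -mulr_natr yz tv /e.
  rewrite le_eqVlt; apply/orP; left; apply/eqP; field.
  by rewrite gt_eqF.
by move: E5; rewrite ler_pM2l.
Qed.

End MeanValue.

(** * Maps and embeddings of class C^{1+eps} *)

Section Embeddings.
Context {R : realType} (eps : R).
Hypothesis eps0 : 0 < eps.
Local Notation C := (Rcomplex R).

Lemma powR_mono (a b : R) : 0 <= a -> a <= b -> a `^ eps <= b `^ eps.
Proof.
move=> a0 ab; apply: ge0_ler_powR => //; rewrite ?nnegrE ?(ltW eps0)//.
exact: le_trans ab.
Qed.

Lemma powR_max_ge0 (a b : C) : 0 <= Num.max `|a| `|b|.
Proof. by rewrite le_max normr_ge0. Qed.

Lemma linear_pack (P : C -> C) : linear P -> exists L : {linear C -> C}, P = L.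
Proof.
move=> lP; pose m := GRing.isLinear.Build R C C _ P lP.
pose L : {linear C -> C} := HB.pack P m.
by exists L.
Qed.

Lemma diff_build_linear (f : C -> C) (x : C) (P : C -> C) (M : R) :
  linear P -> (forall v, `|P v| <= M * `|v|) ->
  (forall e : R, 0 < e -> exists2 d : R, 0 < d &
    forall h : C, `|h| < d -> `|f (x + h) - f x - P h| <= e * `|h|) ->
  differentiable f x /\ forall v, 'd f x v = P v.
Proof. by move=> /linear_pack[L ->]; exact: diff_build. Qed.

Lemma tame_bounds (f : C -> C) (x : C) (r M : R) : 0 < r -> 0 <= M ->
  tame eps f x r M -> exists2 B : R, 0 <= B & forall y z, `|y - x| < r -> `|z - x| < r ->
    (forall v, `|'d f y v| <= B * `|v|) /\ `|f y - f z| <= B * `|y - z|.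
Proof.
move=> r0 M0 [t1 t2 t3].
have xr : `|x - x| < r by rewrite subrr normr0.
have [B0 B00 hB] := diff_bound (t1 x xr).
have Mr : 0 <= M * r `^ eps by rewrite mulr_ge0 ?powR_ge0.
exists (B0 + M * r `^ eps) => [|y z hy hz]; first by rewrite addr_ge0.
split.
  move=> v; rewrite -['d f y v](subrK ('d f x v)) addrC mulrDl.
  apply: le_trans (ler_normD _ _) _; apply: lerD => //.
  apply: le_trans (t2 _ _ _ hy xr) _; rewrite ler_wpM2r// ler_wpM2l//.
  by apply: powR_mono => //; exact: ltW.
rewrite -[f y - f z](subrK ('d f x (y - z))) addrC mulrDl.
apply: le_trans (ler_normD _ _) _; apply: lerD => //.
apply: le_trans (t3 _ _ _ xr hy hz) _; rewrite ler_wpM2r// ler_wpM2l//.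
apply: powR_mono; first exact: powR_max_ge0.
by rewrite ge_max !ltW.
Qed.

Lemma C1eps_comp (U V : set C) (f h : C -> C) : open U -> open V ->
  C1eps eps U f -> C1eps eps V h -> (forall x, U x -> V (f x)) ->
  C1eps eps U (h \o f).
Proof.
move=> oU oV cf ch UV; have [df _] := cf; have [dh _] := ch.
split=> [x Ux|x Ux].
  by apply: differentiable_comp; [exact: df|exact/dh/UV].
have [d1 d10 [U1 T1]] := C1eps_tame eps0 oU cf Ux.
have [d2 d20 [V2 T2]] := C1eps_tame eps0 oV ch (UV x Ux).
have i1 : 0 <= d1^-1 by rewrite invr_ge0 ltW.
have i2 : 0 <= d2^-1 by rewrite invr_ge0 ltW.
have [B1 B10 H1] := tame_bounds d10 i1 T1.
have [B2 B20 H2] := tame_bounds d20 i2 T2.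
have xx : `|x - x| < d1 by rewrite subrr normr0.
pose r := Num.min d1 (d2 / (B1 + 1)).
have r0 : 0 < r by rewrite lt_min d10 divr_gt0// ltr_wpDl.
exists (d2^-1 * B1 `^ eps * B1 + B2 * d1^-1), r; split => // y z v.
rewrite -!ball_normE /= ![`|x - _|]distrC => hy hz.
have rd1 w : `|w - x| < r -> `|w - x| < d1.
  by move/lt_le_trans; apply; rewrite ge_min lexx.
have rd2 w : `|w - x| < r -> `|f w - f x| < d2.
  move=> wr; apply: le_lt_trans (proj2 (H1 _ _ (rd1 _ wr) xx)) _.
  apply: le_lt_trans (_ : (B1 + 1) * `|w - x| < _).
    by rewrite ler_wpM2r// lerDl.
  rewrite mulrC -ltr_pdivlMr ?ltr_wpDl//.
  by apply: lt_le_trans wr _; rewrite ge_min lexx orbT.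
have E w : `|w - x| < r -> 'd (h \o f) w v = 'd h (f w) ('d f w v).
  move=> /rd1 wr; rewrite diff_comp//; first exact/df/U1.
  exact/dh/UV/U1.
rewrite (E y hy) (E z hz).
have -> : 'd h (f y) ('d f y v) - 'd h (f z) ('d f z v) =
  ('d h (f y) ('d f y v) - 'd h (f z) ('d f y v)) + 'd h (f z) ('d f y v - 'd f z v).
  by rewrite linearB /= addrA subrK.
apply: le_trans (ler_normD _ _) _; rewrite !mulrDl; apply: lerD.
  have [_ h2 _] := T2.
  apply: le_trans (h2 _ _ _ (rd2 _ hy) (rd2 _ hz)) _.
  have [b1 b2] := H1 _ _ (rd1 _ hy) (rd1 _ hz).
  apply: le_trans (_ : d2^-1 * (B1 * `|y - z|) `^ eps * (B1 * `|v|) <= _).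
    apply: ler_pM => //; first by rewrite mulr_ge0 ?powR_ge0.
    by apply: ler_wpM2l => //; apply: powR_mono.
  by rewrite powRM// le_eqVlt; apply/orP; left; apply/eqP; ring.
have [b1 _] := H2 _ _ (rd2 _ hz) (rd2 _ hz).
apply: le_trans (b1 _) _; rewrite -!mulrA; apply: ler_wpM2l => //.
have [_ h1 _] := T1.
by apply: le_trans (h1 _ _ _ (rd1 _ hy) (rd1 _ hz)) _; rewrite !mulrA.
Qed.

Lemma C1eps_sub (U V : set C) f : V `<=` U -> C1eps eps U f -> C1eps eps V f.
Proof. by move=> VU [h1 h2]; split=> x /VU; [exact: h1|exact: h2]. Qed.

Lemma C1eps_continuous (U : set C) f x : C1eps eps U f -> U x ->
  {for x, continuous f}.
Proof. by move=> [h _] /h df; exact: differentiable_continuous. Qed.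

Lemma open_preimage (U V : set C) f : open U -> open V -> C1eps eps U f ->
  open (U `&` f @^-1` V).
Proof.
move=> oU oV cf; rewrite openE => x [Ux Vx]; rewrite /interior.
apply: filterI; first exact: open_nbhs_nbhs.
by apply: (C1eps_continuous cf Ux); exact: open_nbhs_nbhs.
Qed.

Lemma embedding_comp (U V : set C) f h : open U -> open V ->
  C1eps_embedding eps U f -> C1eps_embedding eps V h ->
  C1eps_embedding eps (U `&` f @^-1` V) (h \o f).
Proof.
move=> oU oV [f' [cf of1 cf' fK]] [h' [ch oh ch' hK]].
have oW := open_preimage oU oV cf.
have E : (h \o f) @` (U `&` f @^-1` V) = (h @` V) `&` h' @^-1` (f @` U).
  apply/seteqP; split=> [_ [x [Ux Vx] <-]|w [[y Vy <-] /=]].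
    by split => /=; [exists (f x)|rewrite hK//; exists x].
  by rewrite hK// => -[x Ux fx]; exists x; [split => //; rewrite /= fx|rewrite /= fx].
have oI : open ((h \o f) @` (U `&` f @^-1` V)).
  by rewrite E; exact: open_preimage.
exists (f' \o h'); split => //.
- apply: (C1eps_comp oW oV) => //; last by move=> x [].
  by apply: C1eps_sub cf; exact: subIsetl.
- apply: (C1eps_comp oI of1) => //.
    by apply: C1eps_sub ch'; rewrite E; exact: subIsetl.
  by move=> w; rewrite E => -[].
- by move=> x [Ux Vx] /=; rewrite hK// fK.
Qed.

Lemma mulc_linear (a : C) : linear (fun z : C => a * z).
Proof. by move=> t x y; rewrite mulrDr mulc_scale. Qed.

Definition affm (a b z : C) : C := a * z + b.

Lemma aff_diff (a b : C) (x : C) :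
  differentiable (affm a b) x /\ forall v, 'd (affm a b) x v = (a * v : C).
Proof.
have := @diff_build_linear (affm a b) x _ `|a| (mulc_linear a).
apply => [v|e e0]; first by rewrite cnormM.
exists 1 => // h _; rewrite /affm mulrDr.
have -> : a * x + a * h + b - (a * x + b) - a * h = 0 :> C by ring.
by rewrite normr0 mulr_ge0// ltW.
Qed.

Lemma aff_C1eps (U : set C) (a b : C) : C1eps eps U (affm a b).
Proof.
split=> x _; first exact: (proj1 (aff_diff a b x)).
exists 0, 1; split => // y z v _ _.
rewrite (proj2 (aff_diff a b y)) (proj2 (aff_diff a b z)).
by rewrite subrr normr0 !mul0r.
Qed.

Lemma aff_embedding (T : aff R) : C1eps_embedding eps setT (aff_fun T).
Proof.
have a0 : (\val T).1 != 0 := aff_neq0 T.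
have iT : aff_fun T @` setT = setT.
  apply/seteqP; split => // w _; exists ((\val T).1^-1 * (w - (\val T).2)) => //.
  by rewrite /aff_fun mulrA divff// mul1r subrK.
exists (affm (\val T).1^-1 (- ((\val T).1^-1 * (\val T).2))); rewrite iT; split.
- exact: aff_C1eps.
- exact: openT.
- exact: aff_C1eps.
- by move=> x _; rewrite /aff_fun /affm mulrDr mulrA mulVf// mul1r addrK.
Qed.

(** The fixed point of the contraction [y |-> w + y - k y]. *)
Lemma picard (k : C -> C) (p w : C) (r : R) : 0 <= r ->
  (forall y z : C, `|y - p| <= r -> `|z - p| <= r ->
     `|k y - k z - (y - z)| <= 2^-1 * `|y - z|) ->
  `|w - k p| <= r / 2 -> exists2 y : C, `|y - p| <= r & k y = w.
Proof.
move=> r0 hk hw.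
pose T (y : C) : C := w + y - k y.
have pp : `|p - p| <= r by rewrite subrr normr0.
have TT y z : `|y - p| <= r -> `|z - p| <= r -> `|T y - T z| <= 2^-1 * `|y - z|.
  move=> hy hz; have -> : T y - T z = - (k y - k z - (y - z)).
    by rewrite /T; set a := k y; set b := k z; ring.
  by rewrite normrN; exact: hk.
have Tp y : `|y - p| <= r -> `|T y - p| <= r.
  move=> hy; have -> : T y - p = (T y - T p) + (w - k p).
    by rewrite /T; set a := k y; set b := k p; ring.
  apply: le_trans (ler_normD _ _) _; rewrite [leRHS]splitr; apply: lerD => //.
  by apply: le_trans (TT _ _ hy pp) _; rewrite mulrC ler_wpM2r ?invr_ge0.
pose u n := iter n T p.
have up n : `|u n - p| <= r by elim: n => [//|n IH]; exact: Tp.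
have q01 : is_true (0 <= (2^-1 : R) < 1).
  by apply/andP; split; lra.
have us n : `|u n.+1 - u n| <= `|u 1%N - u 0%N| * 2^-1 ^+ n.
  elim: n => [|n IH]; first by rewrite expr0 mulr1.
  apply: le_trans (TT _ _ (up n.+1) (up n)) _.
  by rewrite exprS mulrCA; apply: ler_wpM2l => //; have /andP[] := q01.
have [l ul _] := geo_cvg (normr_ge0 _) q01 us.
have lp : `|l - p| <= r by apply: (cvg_near_le (m := 0%N) ul).
exists l => //.
have Tl : `|T l - l| <= 0.
  apply/ler_addgt0Pl => e e0; rewrite addr0.
  have e20 : 0 < e / 2 by rewrite divr_gt0.
  have [N _ hN] := (iffLR (cvgrPdist_lt _ _) ul) (e / 2) e20.
  rewrite -[T l](subrK (u N.+1)) -addrA.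
  apply: le_trans (ler_normD _ _) _; rewrite [leRHS]splitr; apply: lerD.
    apply: le_trans (TT _ _ lp (up N)) _.
    apply: le_trans (_ : 1 * `|l - u N| <= _).
      by apply: ler_wpM2r => //; have /andP[_ /ltW] := q01.
    by rewrite mul1r; apply/ltW/hN => /=.
  by rewrite distrC; apply/ltW/hN => /=; exact: leqnSn.
have : T l - l = 0 by apply/eqP; rewrite -normr_eq0; apply/eqP/le_anti; rewrite Tl normr_ge0.
rewrite /T => /(congr1 (fun x => w - x)); rewrite subr0 => <-.
by set a := k l; ring.
Qed.

Lemma norm_le_sub (a b : C) : `|a| <= `|b - a| + `|b|.
Proof. by rewrite distrC; apply: le_trans (ler_normD _ _); rewrite subrK. Qed.

(** The differential is a limit of difference quotients, so it is as close to the
    identity as the map is. *)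
Lemma diff_near_id (k : C -> C) (x0 x : C) (s : R) : `|x - x0| < s ->
  differentiable k x ->
  (forall y z : C, `|y - x0| < s -> `|z - x0| < s ->
     `|k y - k z - (y - z)| <= 2^-1 * `|y - z|) ->
  forall v, `|'d k x v - v| <= 2^-1 * `|v|.
Proof.
move=> xs dk hk v; have [->|v0] := eqVneq v 0.
  by rewrite linear0 subrr normr0 mulr0.
have nv : 0 < `|v| by rewrite normr_gt0.
apply/ler_addgt0Pl => e e0.
have ev : 0 < e / `|v| by rewrite divr_gt0.
have [d d0 hd] := diff_taylor dk ev.
pose t := Num.min (d / (2 * `|v|)) ((s - `|x - x0|) / (2 * `|v|)).
have v2 : 0 < 2 * `|v| by rewrite mulr_gt0.
have t0 : 0 < t by rewrite lt_min !divr_gt0// subr_gt0.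
have tv : `|t *: v| = t * `|v| by rewrite normrZ gtr0_norm.
have half u : 0 < u -> t <= u / (2 * `|v|) -> `|t *: v| < u.
  move=> u0 tu; rewrite tv; apply: le_lt_trans (_ : u / 2 < _).
    apply: le_trans (_ : u / (2 * `|v|) * `|v| <= _); first by rewrite ler_wpM2r.
    by rewrite invfM mulrA -[leLHS]mulrA mulVf ?mulr1// gt_eqF.
  by rewrite ltr_pdivrMr// ltr_pMr// ltr1n.
have E1 : `|k (x + t *: v) - k x - 'd k x (t *: v)| <= e / `|v| * `|t *: v|.
  by apply: hd; apply: half => //; rewrite ge_min lexx.
have ys : `|x + t *: v - x0| < s.
  rewrite addrAC addrC; apply: le_lt_trans (ler_normD _ _) _; rewrite -ltrBrDr.
  by apply: half; rewrite ?subr_gt0// ge_min lexx orbT.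
have := hk _ _ ys xs; have -> : x + t *: v - x = t *: v by rewrite addrC addKr.
move=> E2.
have A1 : 'd k x (t *: v) = t *: 'd k x v :> C by exact: linearZ_LR.
have A3 (a b : C) : t *: a - t *: b = t *: (a - b) by rewrite scalerBr.
have : t * `|'d k x v - v| <= t * (e + 2^-1 * `|v|).
  have -> : t * `|'d k x v - v| = `|'d k x (t *: v) - t *: v|.
    by rewrite A1 A3 normrZ gtr0_norm.
  have -> : 'd k x (t *: v) - t *: v =
    (k (x + t *: v) - k x - t *: v) - (k (x + t *: v) - k x - 'd k x (t *: v)).
    by set a := k (x + _) - _; set b := 'd k x _; set c := t *: v; ring.
  apply: le_trans (ler_normB _ _) _; apply: le_trans (lerD E2 E1) _.
  rewrite tv le_eqVlt; apply/orP; left; apply/eqP; field.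
  by rewrite gt_eqF.
by rewrite ler_pM2l.
Qed.

(** Inverse function theorem for a perturbation of the identity: the inverse of
    [k] and the inverses of its differentials all come from the same fixed
    point argument, and they are 2-Lipschitz. *)
Lemma near_id_embedding (k : C -> C) (x0 : C) (s : R) : 0 < s ->
  C1eps eps [set x | `|x - x0| < s] k ->
  (forall y z : C, `|y - x0| < s -> `|z - x0| < s ->
     `|k y - k z - (y - z)| <= 2^-1 * `|y - z|) ->
  C1eps_embedding eps [set x | `|x - x0| < s] k.
Proof.
move=> s0; set U : set C := [set x | _] => ck hk.
have [dk hold] := ck.
have lo y z : U y -> U z -> `|y - z| <= 2 * `|k y - k z|.
  move=> Uy Uz; have := hk _ _ Uy Uz => h.
  have : `|y - z| <= 2^-1 * `|y - z| + `|k y - k z|.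
    by apply: le_trans (norm_le_sub _ (k y - k z)) _; rewrite lerD2r.
  by set a := `|y - z|; set b := `|k y - k z|; lra.
have inj y z : U y -> U z -> k y = k z -> y = z.
  move=> Uy Uz e; apply/eqP; rewrite -subr_eq0 -normr_eq0; apply/eqP/le_anti.
  by rewrite normr_ge0 andbT; apply: le_trans (lo _ _ Uy Uz) _; rewrite e subrr normr0 mulr0.
have img x : U x -> exists2 r : R, 0 < r &
    forall w, `|w - k x| < r -> exists2 y, U y & k y = w.
  move=> Ux; pose r := (s - `|x - x0|) / 2.
  have r0 : 0 < r by rewrite divr_gt0// subr_gt0.
  have sub y : `|y - x| <= r -> U y.
    move=> yx; rewrite /U /= -[y](subrK x) -addrA; apply: le_lt_trans (ler_normD _ _) _.
    rewrite -ltrBrDr; apply: le_lt_trans yx _.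
    by rewrite /r ltr_pdivrMr// ltr_pMr ?ltr1n// subr_gt0.
  exists (r / 2) => [|w wr]; first by rewrite divr_gt0.
  have [|y yx kw] := @picard k x w r (ltW r0) _ (ltW wr).
    by move=> y z /sub Uy /sub Uz; exact: hk.
  by exists y => //; exact: sub.
have oI : open (k @` U).
  rewrite openE => _ [x Ux <-]; apply/nbhs_cP.
  have [r r0 hr] := img x Ux; exists r => // w /hr[y Uy <-]; by exists y.
pose k' w := xget (0 : C) [set y | U y /\ k y = w].
have k'P w : (k @` U) w -> U (k' w) /\ k (k' w) = w.
  by move=> [y Uy ky]; have := @xgetPex _ (0 : C) [set y | U y /\ k y = w]; apply; exists y.
have k'K x : U x -> k' (k x) = x.
  by move=> Ux; have [|U1 E] := k'P (k x); [exists x|exact: inj].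
(* The inverse of the differential at [x]. *)
pose q x w := xget (0 : C) [set v | 'd k x v = w].
have dn x : U x -> forall v, `|'d k x v - v| <= 2^-1 * `|v|.
  by move=> Ux; exact: diff_near_id Ux (dk x Ux) hk.
have qP x w : U x -> 'd k x (q x w) = w.
  move=> Ux; have [|||y _ Ey] := @picard ('d k x) 0 w (2 * `|w|).
  - by rewrite mulr_ge0.
  - move=> y z _ _; have -> : 'd k x y - 'd k x z = 'd k x (y - z).
      by rewrite linearB.
    exact: dn.
  - by rewrite linear0 subr0 mulrAC divff ?mul1r// gt_eqF.
  by have := @xgetPex _ (0 : C) [set v | 'd k x v = w]; apply; exists y.
have dlo x v : U x -> `|v| <= 2 * `|'d k x v|.
  move=> Ux; have h := dn x Ux v.
  have : `|v| <= 2^-1 * `|v| + `|'d k x v|.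
    by apply: le_trans (norm_le_sub _ ('d k x v)) _; rewrite lerD2r.
  by set a := `|v|; set b := `|'d k x v|; lra.
have dinj x v w : U x -> 'd k x v = 'd k x w -> v = w.
  move=> Ux e; apply/eqP; rewrite -subr_eq0 -normr_eq0; apply/eqP/le_anti.
  rewrite normr_ge0 andbT; apply: le_trans (dlo x _ Ux) _.
  by rewrite linearB /= e subrr normr0 mulr0.
have ql x : U x -> linear (q x).
  move=> Ux t u v; apply: (dinj x) => //; rewrite linearP /= !qP//.
have qb x v : U x -> `|q x v| <= 2 * `|v|.
  by move=> Ux; apply: le_trans (dlo x _ Ux) _; rewrite qP.
have k'lip w w' : (k @` U) w -> (k @` U) w' -> `|k' w - k' w'| <= 2 * `|w - w'|.
  move=> /k'P[U1 E1] /k'P[U2 E2]; apply: le_trans (lo _ _ U1 U2) _.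
  by rewrite E1 E2.
have dk' w : (k @` U) w -> differentiable k' w /\ forall v, 'd k' w v = q (k' w) v.
  move=> Iw; have [Ux Ex] := k'P w Iw; set x := k' w.
  apply: (diff_build_linear (M := 2)); first exact: ql.
    by move=> v; exact: qb.
  move=> e e0.
  have e4 : 0 < e / 4 by rewrite divr_gt0.
  have [d d0 hd] := diff_taylor (dk x Ux) e4.
  have [r r0 hr] := open_cP oI Iw.
  exists (Num.min r (d / 2)) => [|h]; first by rewrite lt_min r0 divr_gt0.
  rewrite lt_min => /andP[h1 h2].
  have Iwh : (k @` U) (w + h) by apply: hr; rewrite addrAC subrr add0r.
  have [Uy Ey] := k'P _ Iwh; set y := k' (w + h) in Uy Ey *.
  have yx : `|y - x| <= 2 * `|h|.
    by apply: le_trans (k'lip _ _ Iwh Iw) _; rewrite addrAC subrr add0r.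
  have yxd : `|y - x| < d.
    by apply: le_lt_trans yx _; rewrite mulrC -ltr_pdivlMr.
  have := hd _ yxd; have -> : x + (y - x) = y by rewrite addrC subrK.
  have -> : k y - k x = h by rewrite Ey Ex addrAC subrr add0r.
  move=> E.
  have -> : y - x - q x h = - q x (h - 'd k x (y - x)).
    have -> : y - x = q x ('d k x (y - x)).
      by apply: (dinj x) => //; rewrite qP.
    apply: (dinj x) => //; rewrite linearN linearB /= !qP// opprB.
    by [].
  rewrite normrN; apply: le_trans (qb x _ Ux) _.
  apply: le_trans (ler_wpM2l _ E) _ => //.
  apply: le_trans (_ : 2 * (e / 4 * (2 * `|h|)) <= _).
    by rewrite ler_wpM2l// ler_wpM2l// ltW.
  by rewrite le_eqVlt; apply/orP; left; apply/eqP; field.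
exists k'; split => //.
split=> [w Iw|w Iw]; first exact: (proj1 (dk' w Iw)).
have [Ux Ex] := k'P w Iw; have [M [r [r0 hM]]] := hold _ Ux.
have [r1 r10 hr1] := open_cP oI Iw.
exists (4 * Num.max M 0 * 2 `^ eps), (Num.min r1 (r / 2)); split.
  by rewrite lt_min r10 divr_gt0.
move=> w1 w2 v; rewrite -!ball_normE /= ![`|w - _|]distrC !lt_min.
move=> /andP[a1 b1] /andP[a2 b2].
have I1 := hr1 _ a1; have I2 := hr1 _ a2.
have [U1 E1] := k'P _ I1; have [U2 E2] := k'P _ I2.
rewrite (proj2 (dk' _ I1)) (proj2 (dk' _ I2)).
set y1 := k' w1 in U1 E1 *; set y2 := k' w2 in U2 E2 *.
have -> : q y1 v - q y2 v = q y1 ('d k y2 (q y2 v) - 'd k y1 (q y2 v)).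
  apply: (dinj y1) => //; rewrite (qP y1 _ U1) (qP y2 _ U2).
  have -> : 'd k y1 (q y1 v - q y2 v) = 'd k y1 (q y1 v) - 'd k y1 (q y2 v) by exact: linearB.
  by rewrite (qP y1 _ U1).
apply: le_trans (qb _ _ U1) _.
have near i w' : (k @` U) w' -> `|w' - w| < r / 2 -> i = k' w' -> ball (k' w) r i.
  move=> Iw' wr ->; rewrite -ball_normE /= distrC.
  by apply: le_lt_trans (k'lip _ _ Iw' Iw) _; rewrite mulrC -ltr_pdivlMr.
have := hM y2 y1 (q y2 v) (near _ _ I2 b2 erefl) (near _ _ I1 b1 erefl).
move=> H; apply: le_trans (ler_wpM2l _ H) _ => //.
have M0 : 0 <= Num.max M 0 by rewrite le_max lexx orbT.
apply: le_trans (_ : 2 * (Num.max M 0 * (2 * `|w1 - w2|) `^ eps * (2 * `|v|)) <= _).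
  apply: ler_wpM2l => //.
  apply: le_trans (_ : Num.max M 0 * `|y2 - y1| `^ eps * `|q y2 v| <= _).
    by rewrite -!mulrA ler_wpM2r// ?mulr_ge0 ?powR_ge0// le_max lexx.
  apply: ler_pM => //; first by rewrite mulr_ge0 ?powR_ge0.
    apply: ler_wpM2l => //; apply: powR_mono => //.
    by rewrite distrC; exact: k'lip.
  exact: qb.
by rewrite powRM// le_eqVlt; apply/orP; left; apply/eqP; ring.
Qed.

(** The strict differentiability estimate passes to the limit and identifies the
    differentials of the limit map. *)
Lemma C1eps_limit (kn : nat -> C -> C) (k : C -> C) (P : C -> C -> C)
    (x0 : C) (s M : R) : 0 <= M ->
  (forall n y, `|y - x0| < s -> differentiable (kn n) y) ->
  (forall n y z v, `|y - x0| < s -> `|z - x0| < s ->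
    `|'d (kn n) y v - 'd (kn n) z v| <= M * `|y - z| `^ eps * `|v|) ->
  (forall y, `|y - x0| < s -> kn n y @[n --> \oo] --> k y) ->
  (forall y v, `|y - x0| < s -> ('d (kn n) y v : C) @[n --> \oo] --> P y v) ->
  (forall y, `|y - x0| < s -> exists B, forall n v, `|'d (kn n) y v| <= B * `|v|) ->
  C1eps eps [set y | `|y - x0| < s] k.
Proof.
move=> M0 dkn hkn ck cP bP.
have tkn n : tame eps (kn n) x0 s (2 * M).
  by apply: holder_tame => //; [exact: dkn|exact: hkn].
have lP y : `|y - x0| < s -> linear (P y).
  move=> ys t u v.
  have h1 := cP y (t *: u + v) ys.
  have h2 : ('d (kn n) y (t *: u + v) : C) @[n --> \oo] --> t *: P y u + P y v.
    have -> : (fun n => 'd (kn n) y (t *: u + v) : C) =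
      (fun n => t *: ('d (kn n) y u : C) + 'd (kn n) y v).
      by apply/funext => n; exact: linearP.
    apply: cvgD; last exact: cP.
    by apply: cvgZr; exact: cP.
  exact: (cvg_unique _ h1 h2).
have strict y z : `|y - x0| < s -> `|z - x0| < s ->
    `|k z - k y - P y (z - y)| <= 2 * M * `|z - y| `^ eps * `|z - y|.
  move=> ys zs.
  have h : (kn n z - kn n y - ('d (kn n) y (z - y) : C)) @[n --> \oo] -->
      k z - k y - P y (z - y).
    by apply: cvgB; [apply: cvgB; exact: ck|exact: cP].
  have := @cvg_near_le _ _ _ 0 (2 * M * `|z - y| `^ eps * `|z - y|) 0%N h.
  rewrite subr0; apply => n _; rewrite subr0.
  have [_ _ t3] := tkn n; apply: le_trans (t3 y z y ys zs ys) _.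
  rewrite subrr normr0; have -> : Num.max `|z - y| 0 = `|z - y| by apply/max_idPl.
  by [].
have D y : `|y - x0| < s -> differentiable k y /\ forall v, 'd k y v = P y v.
  move=> ys; have [B hB] := bP y ys.
  apply: (diff_build_linear (M := B)); first exact: lP.
    move=> v; have := @cvg_near_le _ _ _ 0 (B * `|v|) 0%N (cP y v ys).
    by rewrite subr0; apply => n _; rewrite subr0.
  move=> e e0.
  have M1 : 0 < 2 * M + 1 by rewrite ltr_wpDl// mulr_ge0.
  have [d d0 hd] := powR_small eps0 (divr_gt0 e0 M1).
  exists (Num.min d (s - `|y - x0|)) => [|h]; first by rewrite lt_min d0 subr_gt0.
  rewrite lt_min => /andP[h1 h2].
  have yhs : `|y + h - x0| < s.
    rewrite addrAC addrC; apply: le_lt_trans (ler_normD _ _) _.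
    by rewrite -ltrBrDr.
  have := strict _ _ ys yhs; have -> : y + h - y = h by rewrite addrAC subrr add0r.
  move/le_trans; apply; rewrite ler_wpM2r//.
  apply: le_trans (_ : (2 * M + 1) * (e / (2 * M + 1)) <= _); last first.
    by rewrite mulrC divfK// gt_eqF.
  apply: ler_pM; rewrite ?mulr_ge0 ?powR_ge0// ?lerDl//.
  by apply: hd; rewrite normr_ge0 ltW.
split=> [y ys|y ys]; first exact: (proj1 (D y ys)).
exists M, (s - `|y - x0|); split; first by rewrite subr_gt0.
move=> z w v; rewrite -!ball_normE /= [`|y - z|]distrC [`|y - w|]distrC => hz hw.
have sub u : `|u - y| < s - `|y - x0| -> `|u - x0| < s.
  move=> h; rewrite -[u](subrK y) -addrA; apply: le_lt_trans (ler_normD _ _) _.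
  by rewrite -ltrBrDr.
rewrite (proj2 (D _ (sub _ hz))) (proj2 (D _ (sub _ hw))).
have h : (('d (kn n) z v : C) - 'd (kn n) w v) @[n --> \oo] --> P z v - P w v.
  by apply: cvgB; apply: cP; exact: sub.
have := @cvg_near_le _ _ _ 0 (M * `|z - w| `^ eps * `|v|) 0%N h.
by rewrite subr0; apply => n _; rewrite subr0; apply: hkn; exact: sub.
Qed.

End Embeddings.

(** * Linearization of conformal contractions *)

Section Linearization.
Context {R : realType} (eps : R).
Hypothesis eps0 : 0 < eps.
Local Notation C := (Rcomplex R).

Lemma powRX (x : R) n : 0 <= x -> (x ^+ n) `^ eps = (x `^ eps) ^+ n.
Proof.
move=> x0; rewrite -(powR_mulrn n x0) -(powR_mulrn n (powR_ge0 x eps)).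
by rewrite -!powRrM mulrC.
Qed.

Lemma powR_lt1 (x : R) : 0 <= x < 1 -> 0 <= x `^ eps < 1.
Proof.
move=> /andP[x0 x1]; rewrite powR_ge0 /=.
have e1 : 1 `^ eps = 1 :> R by rewrite powR1.
rewrite -[ltRHS]e1.
by apply: gt0_ltr_powR; rewrite ?nnegrE.
Qed.

Fixpoint chain (phi : nat -> C -> C) (n : nat) (y : C) : C :=
  if n is n'.+1 then phi n' (chain phi n' y) else y.

(** On discs of radius [s] around the points [p n] the maps contract by
    [(1 + nu) / 2], and the rescaled compositions stay within relative distance
    1/2 of the identity. *)
Definition linearizing_radius (M m nu s0 s : R) : Prop :=
  [/\ 0 < s <= s0, M * s `^ eps <= (1 - nu) / 2 &
    let q := ((1 + nu) / 2) `^ eps in let a := M / m * s `^ eps in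
    geo_rate a q <= 2^-1].

(** Both conditions are of the form [s ^ eps] small. *)
Lemma linearizing_radius_exists (M m nu s0 : R) : 0 <= M -> 0 < m -> 0 <= nu < 1 ->
  0 < s0 -> exists s, linearizing_radius M m nu s0 s.
Proof.
move=> M0 m0 /andP[nu0 nu1] s00.
have q01 : 0 <= ((1 + nu) / 2) `^ eps < 1.
  by apply: powR_lt1; apply/andP; split; lra.
set q := _ `^ eps in q01; have /andP[q0 q1] := q01.
pose t := Num.min 1 ((1 - q) / (2 * geo_const 1 q)).
have t0 : 0 < t by rewrite lt_min ltr01 divr_gt0 ?subr_gt0// mulr_gt0// geo_const_gt0.
have M1 : 0 < M + 1 by rewrite ltr_wpDl.
have Mm : 0 < M / m + 1 by rewrite ltr_wpDl// divr_ge0// ltW.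
pose e := Num.min ((1 - nu) / 2 / (M + 1)) (t / (M / m + 1)).
have e0 : 0 < e by rewrite lt_min !divr_gt0// subr_gt0.
have [d d0 hd] := powR_small eps0 e0.
exists (Num.min s0 d).
have sd : (Num.min s0 d) `^ eps <= e.
  apply: hd; rewrite le_min (ltW s00) (ltW d0) /=.
  by rewrite ge_min lexx orbT.
split.
- by rewrite lt_min s00 d0 ge_min lexx.
- apply: le_trans (_ : (M + 1) * e <= _).
    by apply: ler_pM; rewrite ?powR_ge0// lerDl.
  by rewrite mulrC -ler_pdivlMr// ge_min lexx.
- set a := _ * _ `^ _ => /=.
  have a0 : 0 <= a by rewrite mulr_ge0 ?powR_ge0// divr_ge0// ltW.
  have at_ : a <= t.
    apply: le_trans (_ : (M / m + 1) * e <= _).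
      by apply: ler_pM; rewrite ?powR_ge0// ?lerDl// divr_ge0// ltW.
    by rewrite mulrC -ler_pdivlMr// ge_min lexx orbT.
  have a1 : a <= 1 by apply: le_trans at_ _; rewrite ge_min lexx.
  rewrite /geo_rate -/q ler_pdivrMr ?subr_gt0//.
  apply: le_trans (_ : t * geo_const 1 q <= _).
    by apply: ler_pM => //; [rewrite ltW// geo_const_gt0|apply: geo_const_le].
  rewrite -ler_pdivlMr ?geo_const_gt0//.
  apply: le_trans (_ : (1 - q) / (2 * geo_const 1 q) <= _); first by rewrite ge_min lexx orbT.
  by rewrite le_eqVlt; apply/orP; left; apply/eqP; field; rewrite gt_eqF// geo_const_gt0.
Qed.

Section Chain.
Variables (M m nu s0 s : R) (p : nat -> C) (phi : nat -> C -> C) (la : nat -> C).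
Hypotheses (M0 : 0 <= M) (m0 : 0 < m) (nu01 : 0 <= nu < 1).
Hypothesis hs : linearizing_radius M m nu s0 s.
Hypothesis phip : forall n, phi n (p n) = p n.+1.
Hypothesis phit : forall n, tame eps (phi n) (p n) s0 M.
Hypothesis phid : forall n v, 'd (phi n) (p n) v = (la n * v : C).
Hypothesis phil : forall n, m <= `|la n| <= nu.

Let nu' := (1 + nu) / 2.
Let q := nu' `^ eps.
Let a := M / m * s `^ eps.

Let nu'01 : 0 <= nu' < 1.
Proof. by move: nu01 => /andP[? ?]; rewrite /nu'; apply/andP; split; lra. Qed.
Let q01 : 0 <= q < 1. Proof. exact: powR_lt1. Qed.
Let s_gt0 : 0 < s. Proof. by case: hs => /andP[]. Qed.
Let s_le : s <= s0. Proof. by case: hs => /andP[]. Qed.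
Let a_ge0 : 0 <= a.
Proof. by rewrite mulr_ge0 ?powR_ge0// divr_ge0// ltW. Qed.
Let la_gt0 n : 0 < `|la n|.
Proof. by apply: lt_le_trans m0 _; case/andP: (phil n). Qed.
Let la_neq0 n : la n != 0. Proof. by rewrite -normr_gt0. Qed.
Let nu'_ge0 : 0 <= nu'. Proof. by case/andP: nu'01. Qed.

Let step n y z : `|y - p n| < s -> `|z - p n| < s ->
  `|phi n y - phi n z| <= nu' * `|y - z|.
Proof.
move=> ys zs; have [_ _ t3] := phit n.
have pp : `|p n - p n| < s0 by rewrite subrr normr0 (lt_le_trans s_gt0).
have h := t3 (p n) y z pp (lt_le_trans ys s_le) (lt_le_trans zs s_le).
apply: le_trans (norm_le_sub _ ('d (phi n) (p n) (y - z))) _.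
rewrite distrC; apply: le_trans (lerD h (lexx _)) _.
rewrite phid cnormM -mulrDl ler_wpM2r//.
have [_ h2 _] := hs.
have /andP[_ h3] := phil n.
have h4 : (Num.max `|y - p n| `|z - p n|) `^ eps <= s `^ eps.
  by apply: powR_mono; [done|exact: powR_max_ge0|rewrite ge_max !ltW].
have h5 : M * (Num.max `|y - p n| `|z - p n|) `^ eps <= (1 - nu) / 2.
  by apply: le_trans h2; rewrite ler_wpM2l.
by apply: le_trans (lerD h5 h3) _; rewrite /nu'; lra.
Qed.

Lemma chain_contract n y z : `|y - p 0%N| < s -> `|z - p 0%N| < s ->
  [/\ `|chain phi n y - p n| <= nu' ^+ n * s, `|chain phi n y - p n| < s &
      `|chain phi n y - chain phi n z| <= nu' ^+ n * `|y - z|].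
Proof.
move=> ys zs.
have pp k : `|p k - p k| < s by rewrite subrr normr0.
suff H k w : `|w - p 0%N| < s -> `|chain phi k w - p k| < s /\
     `|chain phi k w - p k| <= nu' ^+ k * s.
  have [h1 h2] := H n y ys; split => //.
  elim: n {h1 h2} => [|n IH]; first by rewrite expr0 mul1r.
  rewrite exprS -mulrA; apply: le_trans (step _ _) _; try exact: (proj1 (H n _ _)).
  by rewrite ler_wpM2l.
move=> ws; elim: k => [|k [IH1 IH2]].
  by rewrite expr0 mul1r; split => //; exact: ltW.
have := step IH1 (pp k); rewrite phip /= => h.
have h' : `|phi k (chain phi k w) - p k.+1| <= nu' * `|chain phi k w - p k| by [].
split.
  apply: le_lt_trans h' _; apply: le_lt_trans IH1.
  by rewrite -[leRHS]mul1r ler_wpM2r//; case/andP: nu'01 => _ /ltW.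
by apply: le_trans h' _; rewrite exprS -mulrA ler_wpM2l.
Qed.

Lemma chain_max_powR n y z : `|y - p 0%N| < s -> `|z - p 0%N| < s ->
  M / m * (Num.max `|chain phi n y - p n| `|chain phi n z - p n|) `^ eps <= a * q ^+ n.
Proof.
move=> ys zs; rewrite /a -[leRHS]mulrA; apply: ler_wpM2l; first by rewrite divr_ge0// ltW.
have [h1 _ _] := chain_contract n ys ys; have [h2 _ _] := chain_contract n zs zs.
apply: le_trans (_ : (nu' ^+ n * s) `^ eps <= _).
  by apply: powR_mono; [done|exact: powR_max_ge0|rewrite ge_max h1 h2].
by rewrite powRM ?exprn_ge0 ?(ltW s_gt0)// powRX// mulrC.
Qed.

Definition chain_mult n : C := \prod_(j < n) la j.

Lemma chain_mult_neq0 n : chain_mult n != 0.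
Proof. by apply/prodf_neq0 => j _; exact: la_neq0. Qed.

Let scale_bound n (e w : C) c : `|e| <= M * c * `|w| -> 0 <= c ->
  `|(chain_mult n.+1)^-1 * e : C| <= M / m * c * `|(chain_mult n)^-1 * w : C|.
Proof.
move=> he c0; rewrite !cnormM !cnormV /chain_mult big_ord_recr /= cnormM invfM.
set L : R := `|\prod_(j < n) la j : C|^-1.
have L0 : 0 <= L by rewrite invr_ge0.
apply: le_trans (_ : L * `|la n|^-1 * (M * c * `|w|) <= _).
  by rewrite ler_wpM2l// mulr_ge0// invr_ge0.
have -> : L * `|la n|^-1 * (M * c * `|w|) = (L * M * c * `|w|) * `|la n|^-1 by ring.
have -> : M / m * c * (L * `|w|) = (L * M * c * `|w|) * m^-1 by ring.
apply: ler_wpM2l; first by rewrite !mulr_ge0.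
by rewrite lef_pV2 ?posrE//; case/andP: (phil n).
Qed.

Definition chain_pair y z n : C :=
  (chain_mult n)^-1 * (chain phi n y - chain phi n z).

Lemma chain_pair_step n y z : `|y - p 0%N| < s -> `|z - p 0%N| < s ->
  `|chain_pair y z n.+1 - chain_pair y z n| <= a * q ^+ n * `|chain_pair y z n|.
Proof.
move=> ys zs; set Y := chain phi n y; set Z := chain phi n z.
have [_ Ys _] := chain_contract n ys ys; have [_ Zs _] := chain_contract n zs zs.
have [_ _ t3] := phit n.
have pp : `|p n - p n| < s0 by rewrite subrr normr0 (lt_le_trans s_gt0).
have h := t3 (p n) Y Z pp (lt_le_trans Ys s_le) (lt_le_trans Zs s_le).
have -> : chain_pair y z n.+1 - chain_pair y z n = (chain_mult n.+1)^-1 * (phi n Y - phi n Z - 'd (phi n) (p n) (Y - Z)).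
  rewrite /chain_pair phid /= -/Y -/Z /chain_mult big_ord_recr /=.
  by field; rewrite la_neq0 chain_mult_neq0.
apply: le_trans (scale_bound n h (powR_ge0 _ _)) _.
by apply: ler_wpM2r => //; exact: chain_max_powR.
Qed.

Let dchain n y : `|y - p 0%N| < s -> differentiable (chain phi n) y.
Proof.
move=> ys; elim: n => [|n IH]; first exact: (@ex_diff _ _ _ _ _ _ _ (is_diff_id y)).
have [_ Ys _] := chain_contract n ys ys.
have [t1 _ _] := phit n.
apply: (@differentiable_comp _ _ _ _ (chain phi n) (phi n)) => //.
by apply: t1; apply: lt_le_trans Ys s_le.
Qed.

Let dchainS n y v : `|y - p 0%N| < s ->
  'd (chain phi n.+1) y v = 'd (phi n) (chain phi n y) ('d (chain phi n) y v).
Proof.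
move=> ys; have [_ Ys _] := chain_contract n ys ys.
have [t1 _ _] := phit n.
by rewrite (@diff_comp _ _ _ _ (chain phi n) (phi n))//;
  [exact: dchain|apply: t1; apply: lt_le_trans Ys s_le].
Qed.

Let T n y v : C := (chain_mult n)^-1 * 'd (chain phi n) y v.

Let T_step n y v : `|y - p 0%N| < s ->
  `|T n.+1 y v - T n y v| <= a * q ^+ n * `|T n y v|.
Proof.
move=> ys; set w := 'd (chain phi n) y v.
have [_ Ys _] := chain_contract n ys ys; set Y := chain phi n y in Ys.
have [_ t2 _] := phit n.
have pp : `|p n - p n| < s0 by rewrite subrr normr0 (lt_le_trans s_gt0).
have h := t2 Y (p n) w (lt_le_trans Ys s_le) pp.
have -> : T n.+1 y v - T n y v = (chain_mult n.+1)^-1 * ('d (phi n) Y w - 'd (phi n) (p n) w).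
  rewrite /T dchainS// phid -/Y -/w /chain_mult big_ord_recr /=.
  by field; rewrite la_neq0 chain_mult_neq0.
apply: le_trans (scale_bound n h (powR_ge0 _ _)) _.
apply: ler_wpM2r => //.
by apply: le_trans (chain_max_powR n ys ys); rewrite maxxx.
Qed.

Let T0 y v : T 0%N y v = v.
Proof. by rewrite /T /chain_mult big_ord0 invr1 mul1r (@diff_val _ _ _ _ _ _ _ (is_diff_id y)). Qed.

Let T_bound n y v : `|y - p 0%N| < s -> `|T n y v| <= geo_const a q * `|v|.
Proof.
move=> ys; have := @geo_upper R (fun n => T n y v) a q a_ge0 q01 _ n.
by rewrite T0; apply => k; exact: T_step.
Qed.

Let Th := geo_const a q * (M / m * geo_const a q / (1 - q)).

Let Th_ge0 : 0 <= Th.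
Proof.
have /andP[_ /ltW h] := q01.
by rewrite !mulr_ge0 ?invr_ge0 ?subr_ge0// ?ltW// geo_const_gt0.
Qed.

Let T_holder n y z v : `|y - p 0%N| < s -> `|z - p 0%N| < s ->
  `|T n y v - T n z v| <= Th * `|y - z| `^ eps * `|v|.
Proof.
move=> ys zs; pose b := M / m * `|y - z| `^ eps * geo_const a q * `|v|.
have b0 : 0 <= b.
  by rewrite !mulr_ge0 ?invr_ge0 ?powR_ge0// ltW// geo_const_gt0.
have := @geo_real R (fun n => `|T n y v - T n z v|) a b q a_ge0 b0 q01.
rewrite /= !T0 subrr normr0 lexx add0r => /(_ isT) H.
have -> : Th * `|y - z| `^ eps * `|v| = geo_const a q * (b / (1 - q)) by rewrite /Th /b; ring.
apply: H => k.
set Y := chain phi k y; set Z := chain phi k z.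
have [_ Ys YZ] := chain_contract k ys zs; have [_ Zs _] := chain_contract k zs ys.
set wy := 'd (chain phi k) y v; set wz := 'd (chain phi k) z v.
have [_ t2 _] := phit k.
have pp : `|p k - p k| < s0 by rewrite subrr normr0 (lt_le_trans s_gt0).
have h1 := t2 Y Z wy (lt_le_trans Ys s_le) (lt_le_trans Zs s_le).
have h2 := t2 Z (p k) (wy - wz) (lt_le_trans Zs s_le) pp.
have -> : T k.+1 y v - T k.+1 z v =
   (T k y v - T k z v) +
   (chain_mult k.+1)^-1 * ('d (phi k) Y wy - 'd (phi k) Z wy) +
   (chain_mult k.+1)^-1 * ('d (phi k) Z (wy - wz) - 'd (phi k) (p k) (wy - wz)).
  rewrite /T !dchainS// phid -/Y -/Z -/wy -/wz (linearB ('d (phi k) Z)) /chain_mult big_ord_recr /=.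
  by field; rewrite la_neq0 chain_mult_neq0.
apply: le_trans (ler_normD _ _) _.
have e1 := scale_bound k h1 (powR_ge0 _ _).
have e2 := scale_bound k h2 (powR_ge0 _ _).
have -> : (1 + a * q ^+ k) * `|T k y v - T k z v| + b * q ^+ k =
  `|T k y v - T k z v| + b * q ^+ k + a * q ^+ k * `|T k y v - T k z v| by ring.
apply: lerD; last first.
  apply: le_trans e2 _.
  have -> : (chain_mult k)^-1 * (wy - wz) = T k y v - T k z v by rewrite /T mulrBr.
  apply: ler_wpM2r => //.
  by apply: le_trans (chain_max_powR k zs zs); rewrite maxxx.
apply: le_trans (ler_normD _ _) _; rewrite lerD2l.
apply: le_trans e1 _.
apply: le_trans (_ : M / m * (nu' ^+ k * `|y - z|) `^ eps * (geo_const a q * `|v|) <= _).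
  apply: ler_pM => //; first by rewrite !mulr_ge0 ?invr_ge0 ?powR_ge0// ltW.
    apply: ler_wpM2l; first by rewrite divr_ge0// ltW.
    by apply: powR_mono.
  exact: T_bound.
by rewrite powRM ?exprn_ge0// powRX// /b le_eqVlt; apply/orP; left; apply/eqP; rewrite /q; ring.
Qed.

Let kn n : C -> C := affm (chain_mult n)^-1 (- ((chain_mult n)^-1 * p n)) \o chain phi n.

Let knE n y : kn n y = (chain_mult n)^-1 * (chain phi n y - p n).
Proof. by rewrite /kn /affm /= mulrBr. Qed.

Let dkn n y : `|y - p 0%N| < s -> differentiable (kn n) y.
Proof.
move=> ys; apply: differentiable_comp; first exact: dchain.
exact: (proj1 (aff_diff _ _ _)).
Qed.

Let dknE n y v : `|y - p 0%N| < s -> 'd (kn n) y v = T n y v.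
Proof.
move=> ys; rewrite /kn diff_comp; [|exact: dchain|exact: (proj1 (aff_diff _ _ _))].
exact: (proj2 (aff_diff _ _ _)).
Qed.

Lemma chain_p n : chain phi n (p 0%N) = p n.
Proof. by elim: n => //= n ->; rewrite phip. Qed.

(** Koenigs linearization of the composed contractions: conjugation by the
    conformal multipliers preserves norms, so the differentials of the rescaled
    compositions form a product that converges geometrically. *)
Lemma chain_linearization : exists2 k : C -> C,
  forall y, `|y - p 0%N| < s ->
    (chain_mult n)^-1 * (chain phi n y - p n) @[n --> \oo] --> (k y : C) &
  C1eps_embedding eps [set y | `|y - p 0%N| < s] k.
Proof.
have pp : `|p 0%N - p 0%N| < s by rewrite subrr normr0.
pose k y : C := lim (kn n y @[n --> \oo]).
have ck y : `|y - p 0%N| < s -> kn n y @[n --> \oo] --> k y.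
  move=> ys; have [l ul _] := geo_mul_cvg a_ge0 q01 (fun n => chain_pair_step n ys pp).
  apply/cvg_ex; exists l.
  suff -> : (fun n => kn n y) = chain_pair y (p 0%N) by [].
  by apply/funext => n; rewrite knE /chain_pair chain_p.
exists k => [y ys|].
  have -> : (fun n => (chain_mult n)^-1 * (chain phi n y - p n) : C) = (fun n => kn n y).
    by apply/funext => n; rewrite knE.
  exact: ck.
apply: near_id_embedding => //.
  pose P y v : C := lim (T n y v @[n --> \oo]).
  apply: (@C1eps_limit R eps eps0 kn k P _ _ Th) => //.
  - by move=> n y z v ys zs; rewrite !dknE//; exact: T_holder.
  - move=> y v ys.
    have -> : (fun n => 'd (kn n) y v : C) = (fun n => T n y v).
      by apply/funext => n; rewrite dknE.
    have [l ul _] := geo_mul_cvg a_ge0 q01 (fun n => T_step n v ys).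
    by apply/cvg_ex; exists l.
  - move=> y ys; exists (geo_const a q) => n v; rewrite dknE//; exact: T_bound.
move=> y z ys zs.
have h : kn n y - kn n z @[n --> \oo] --> k y - k z by apply: cvgB; exact: ck.
have [l ul hl] := geo_mul_cvg a_ge0 q01 (fun n => chain_pair_step n ys zs).
have E : l = k y - k z.
  suff h' : chain_pair y z n @[n --> \oo] --> k y - k z by exact: (cvg_unique _ ul h').
  suff -> : chain_pair y z = (fun n => kn n y - kn n z) by [].
  by apply/funext => n; rewrite !knE /chain_pair; ring.
have := hl 0%N; rewrite /chain_pair expr0 mulr1 /chain_mult big_ord0 invr1 !mul1r /= -E.
by move/le_trans; apply; rewrite ler_wpM2r//; case: hs.
Qed.

End Chain.
End Linearization.

(** * Bounded distortion along backward orbits *)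

Section ConnectedCover.
Context {R : realType}.
Local Notation C := (Rcomplex R).

(** On a connected set the distance to the image of one point takes a whole interval
    of values, and each of the [N] sets accounts for values within [d] of each other. *)
Lemma connected_cover_diam (G : set C) (N : nat) (S : 'I_N -> set C)
    (F : C -> C) (d rho : R) :
  connected G -> (forall y, G y -> exists i, S i y) -> 0 < rho ->
  (forall y z, G y -> G z -> `|y - z| < rho -> `|F y - F z| <= `|y - z|) ->
  (forall i y z, G y -> G z -> S i y -> S i z -> `|F y - F z| <= d) ->
  forall y z, G y -> G z -> `|F y - F z| <= N%:R * d.
Proof.
move=> cG cov rho0 lip hd y0 z0 Gy Gz.
rewrite leNgt; apply/negP; set D := `|F y0 - F z0| => ND.
pose h p := `|F p - F z0|.
have ch : {within G, continuous h}.
  apply/subspace_continuousP => x Gx U /nbhs_ballP[e /= e0 hU]; apply/nbhs_cP.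
  exists (Num.min e rho) => [|w]; first by rewrite lt_min e0.
  rewrite lt_min => /andP[we wr] Gw; apply: hU; rewrite -ball_normE /= /h.
  apply: le_lt_trans we; rewrite distrC.
  apply: le_trans (ler_dist_dist _ _) _.
  have -> : F w - F z0 - (F x - F z0) = F w - F x by rewrite opprB addrA subrK.
  exact: lip.
have /connected_intervalP itv := connected_continuous_connected cG ch.
have D0 : 0 <= D by exact: normr_ge0.
have N0 : 0 < N%:R :> R by have [i _] := cov _ Gy; rewrite ltr0n; case: (N) i => // -[].
(* N + 1 equally spaced values of the distance to [F z0] fall into N sets. *)
have ex (j : 'I_N.+1) : exists ip : 'I_N * C,
    [/\ G ip.2, S ip.1 ip.2 & h ip.2 = j%:R * (D / N%:R)].
  have [p Gp hp] : (h @` G) (j%:R * (D / N%:R)).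
    apply: (itv 0 D); [by exists z0; rewrite // /h subrr normr0|by exists y0|].
    apply/andP; split; first by rewrite mulr_ge0// divr_ge0// ltW.
    rewrite mulrA ler_pdivrMr// mulrC ler_wpM2l//.
    by rewrite ler_nat -ltnS.
  by have [i Si] := cov _ Gp; exists (i, p).
have [ip hip] := choice ex.
have /injectivePn[j [j' jj' ij]] : ~~ injectiveb (fun j => (ip j).1).
  apply/negP => /injectiveP inj; have := leq_card _ inj.
  by rewrite !card_ord ltnn.
have [Gj Sj ej] := hip j; have [Gj' Sj' ej'] := hip j'.
have : `|h (ip j).2 - h (ip j').2| <= d.
  apply: le_trans (ler_dist_dist _ _) _.
  have -> : F (ip j).2 - F z0 - (F (ip j').2 - F z0) = F (ip j).2 - F (ip j').2.
    by rewrite opprB addrA subrK.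
  by apply: (hd (ip j).1) => //; rewrite ij.
rewrite ej ej' -mulrBl normrM (ger0_norm (divr_ge0 D0 (ltW N0))).
apply/negP; rewrite -ltNge; apply: (lt_le_trans (y := D / N%:R)).
  by rewrite ltr_pdivlMr// mulrC.
rewrite ler_peMl ?(divr_ge0 D0 (ltW N0))//.
have gap (m n : nat) : (m < n)%N -> 1 <= `|n%:R - m%:R : R|.
  by move=> mn; rewrite -natrB ?(ltnW mn)// ger0_norm// ler1n subn_gt0.
case: (ltngtP j j') => [jl|jl|/val_inj e].
- by rewrite distrC; exact: gap.
- exact: gap.
- by rewrite e eqxx in jj'.
Qed.

End ConnectedCover.

Section Markov.
Context {R : realType} {eps : R} {A : finType} {B : rel A}.
Local Notation C := (Rcomplex R).

Lemma pastP (theta : past B) n : B (pastE theta n.+1) (pastE theta n).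
Proof. exact: (set_mem (valP theta)). Qed.

Context (K : Omega eps B).
Local Notation G := (piece K).
Local Notation g := (cmap K).

Lemma cmap_inj a y z : G a y -> G a z -> g y = g z -> y = z.
Proof.
move=> Gy Gz e.
have [W [F [_ GW Fg [F' [_ _ _ FK]] _]]] := branch_embedding (Omega_axioms K) a.
by rewrite -(FK y (GW _ Gy)) -(FK z (GW _ Gz)) !Fg// e.
Qed.

Lemma branchP a b z : B a b -> G b z ->
  G a (branch K a z) /\ g (branch K a z) = z.
Proof.
move=> Bab Gz; have [y Gy gy] := markov_in (Omega_axioms K) Bab Gz.
have := @xgetPex _ (0 : C) [set w | G a w /\ g w = z]; apply.
by exists y.
Qed.

Lemma branch_unique a b y z : B a b -> G b z -> G a y -> g y = z ->
  branch K a z = y.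
Proof.
move=> Bab Gz Gy gy; have [G1 g1] := branchP Bab Gz.
by apply: (cmap_inj G1 Gy); rewrite g1.
Qed.

Definition back (theta : past B) (n : nat) (z : C) : C :=
  word_map K (past_word theta n) z.

Lemma past_wordS (theta : past B) n :
  past_word theta n.+1 = pastE theta n.+1 :: past_word theta n.
Proof. by rewrite /past_word /mkseq -addn1 iotaD map_cat rev_cat. Qed.

Lemma back0 theta z : back theta 0 z = z.
Proof. by []. Qed.

Lemma backS theta n z :
  back theta n.+1 z = branch K (pastE theta n.+1) (back theta n z).
Proof.
rewrite /back past_wordS; case E : (past_word theta n) => [|a w] //.
by have := size_rev (mkseq (pastE theta) n.+1); rewrite -/(past_word theta n) E size_mkseq.
Qed.

Lemma back_in theta n z : G (pastE theta 0) z -> G (pastE theta n) (back theta n z).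
Proof.
move=> Gz; elim: n => // n IH; rewrite backS.
by have [] := branchP (pastP theta n) IH.
Qed.

Lemma back_g theta n z : G (pastE theta 0) z ->
  g (back theta n.+1 z) = back theta n z.
Proof.
move=> Gz; rewrite backS.
by have [] := branchP (pastP theta n) (back_in n Gz).
Qed.

Lemma cantor_pullback a y : G a y -> cantor_set K (g y) -> cantor_set K y.
Proof.
move=> Gy Kg [|n]; first by exists a.
by have [b Gb] := Kg n; exists b; rewrite iterSr.
Qed.

Lemma back_cantor theta n z : G (pastE theta 0) z -> cantor_set K z ->
  cantor_set K (back theta n z).
Proof.
move=> Gz Kz; elim: n => // n IH.
by apply: (cantor_pullback (back_in n.+1 Gz)); rewrite back_g.
Qed.

Definition mult (x : C) : C := 'd g x (1 : C).

Lemma multE x v : cantor_set K x -> 'd g x v = (mult x * v : C).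
Proof.
move=> Kx; have [l hl] := map_conformal (Omega_axioms K) Kx.
by rewrite /mult !hl mulr1.
Qed.

End Markov.

Section Controlled.
Context {R : realType} {eps : R} {A : finType} {B : rel A}.
Hypothesis eps0 : 0 < eps.
Local Notation C := (Rcomplex R).

(** The quantitative content of hyperbolicity, with constants that can be kept
    on a whole neighbourhood in the space of Cantor sets.  All the estimates
    concern points of the pieces only: the domains of nearby maps need not
    contain a common neighbourhood of the pieces. *)
Record controlled (N : nat) (mu kap r M : R) (K : Omega eps B) : Prop := Controlled {
  ctrl_mu : 1 < mu ;
  ctrl_kap : 0 < kap ;
  ctrl_r : 0 < r ;
  ctrl_M : 0 <= M ;
  ctrl_lower : forall a y z, piece K a y -> piece K a z ->
    kap * `|y - z| <= `|cmap K y - cmap K z| ;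
  ctrl_expand : forall a y z, piece K a y -> piece K a z -> `|y - z| < r ->
    mu * `|y - z| <= `|cmap K y - cmap K z| ;
  ctrl_strict : forall a x y z, piece K a x -> piece K a y -> piece K a z ->
    `|cmap K y - cmap K z - 'd (cmap K) x (y - z)| <=
      M * (Num.max `|y - x| `|z - x|) `^ eps * `|y - z| ;
  ctrl_dmu : forall a x v, piece K a x -> mu * `|v| <= `|'d (cmap K) x v| ;
  ctrl_holder : forall a x y v, piece K a x -> piece K a y ->
    `|'d (cmap K) x v - 'd (cmap K) y v| <= M * `|x - y| `^ eps * `|v| ;
  ctrl_cover : exists S : 'I_N -> set C,
    (forall a y, piece K a y -> exists i, S i y) /\
    forall i y z, S i y -> S i z -> `|y - z| < kap * r }.

Context (N : nat) (mu kap r M : R).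

(** Constants of the estimates below: [dist_const] for the contraction of inverse
    branches, [dist_rate] for the geometric decay of distortion, [diam_const] for
    the diameters of the pieces, and [strict_const] for the relative error of one
    step of the rescaled increments. *)
Definition dist_const : R := N%:R + 1.
Definition dist_rate : R := (mu^-1) `^ eps.
Definition diam_const : R := N%:R * (kap * r).
Definition strict_const : R := (M + M / kap) * dist_const `^ eps.
Definition strict_const1 : R := strict_const * diam_const `^ eps.

Context (K : Omega eps B) (ct : controlled N mu kap r M K).
Local Notation G := (piece K).
Local Notation g := (cmap K).
Local Notation C0 := dist_const.
Local Notation q := dist_rate.

Let mu0 : 0 < mu. Proof. exact: lt_trans (ctrl_mu ct). Qed.
Let imu : 0 <= mu^-1 < 1.
Proof. by rewrite invr_ge0 (ltW mu0) invf_lt1// (ctrl_mu ct). Qed.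

Lemma dist_rate01 : 0 <= q < 1.
Proof. exact: powR_lt1. Qed.

Let q01 := dist_rate01.
Let q0 : 0 <= q. Proof. by case/andP: q01. Qed.

Let kr : 0 < kap * r.
Proof. by rewrite mulr_gt0// ?(ctrl_kap ct)// (ctrl_r ct). Qed.

Lemma dist_const_ge1 : 1 <= C0.
Proof. by rewrite lerDr. Qed.

Let C00 : 0 <= C0. Proof. exact: le_trans dist_const_ge1. Qed.

Lemma strict_const_ge0 : 0 <= strict_const.
Proof.
rewrite mulr_ge0 ?powR_ge0// addr_ge0 ?(ctrl_M ct)// divr_ge0 ?(ctrl_M ct)//.
exact/ltW/(ctrl_kap ct).
Qed.

Lemma diam_const_ge0 : 0 <= diam_const.
Proof. by rewrite mulr_ge0// ltW. Qed.

Lemma strict_const1_ge0 : 0 <= strict_const1.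
Proof. by rewrite mulr_ge0 ?powR_ge0// strict_const_ge0. Qed.

(** The expansion is only available at distances below [r]; the lower bound [kap]
    ensures that the preimages of points at distance below [kap * r] are that
    close. *)
Lemma back_near theta n y z : G (pastE theta 0) y -> G (pastE theta 0) z ->
  `|y - z| < kap * r ->
  `|back K theta n y - back K theta n z| <= mu^-1 ^+ n * `|y - z|.
Proof.
move=> Gy Gz yz.
have q1 k : mu^-1 ^+ k <= 1 by case/andP: imu => h /ltW; exact: exprn_ile1.
elim: n => [|n IH]; first by rewrite expr0 mul1r.
set Y := back _ _ _ y in IH *; set Z := back _ _ _ z in IH *.
have GY := back_in (K := K) n.+1 Gy; have GZ := back_in (K := K) n.+1 Gz.
have YZ : `|Y - Z| < kap * r.
  by apply: le_lt_trans IH (le_lt_trans _ yz); rewrite -[leRHS]mul1r ler_wpM2r.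
have h1 := ctrl_lower ct GY GZ; rewrite !back_g// -/Y -/Z in h1.
have h2 := ctrl_expand ct GY GZ; rewrite !back_g// -/Y -/Z in h2.
have {}h2 : mu * `|back K theta n.+1 y - back K theta n.+1 z| <= `|Y - Z|.
  apply: h2; have : kap * `|back K theta n.+1 y - back K theta n.+1 z| < kap * r.
    exact: le_lt_trans h1 YZ.
  by rewrite ltr_pM2l// (ctrl_kap ct).
rewrite exprS -mulrA -ler_pdivrMl ?invr_gt0// invrK.
exact: le_trans h2 IH.
Qed.

(** Close points are contracted by [back_near]; distant points of a piece are joined
    through the small sets that cover it, the piece being connected. *)
Lemma back_diam theta n y z : G (pastE theta 0) y -> G (pastE theta 0) z ->
  `|back K theta n y - back K theta n z| <= diam_const * mu^-1 ^+ n.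
Proof.
move=> Gy Gz; have [S [cov hS]] := ctrl_cover ct.
have q1 k : mu^-1 ^+ k <= 1 by case/andP: imu => h /ltW; exact: exprn_ile1.
have mun k : 0 <= mu^-1 ^+ k by rewrite exprn_ge0//; case/andP: imu.
rewrite /diam_const -mulrA.
apply: (connected_cover_diam (G := G (pastE theta 0)) (S := S) (rho := kap * r)) => //.
- exact: piece_connected (Omega_axioms K) _.
- exact: cov.
- move=> u v Gu Gv uv; apply: le_trans (back_near n Gu Gv uv) _.
  by rewrite -[leRHS]mul1r ler_wpM2r.
- move=> i u v Gu Gv Su Sv; have uv := hS i u v Su Sv.
  apply: le_trans (back_near n Gu Gv uv) _.
  by rewrite mulrC ler_wpM2r// ltW.
Qed.

Lemma back_contract theta n y z : G (pastE theta 0) y -> G (pastE theta 0) z ->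
  `|back K theta n y - back K theta n z| <= C0 * mu^-1 ^+ n * `|y - z|.
Proof.
move=> Gy Gz; have mun k : 0 <= mu^-1 ^+ k by rewrite exprn_ge0//; case/andP: imu.
have [h|h] := ltP `|y - z| (kap * r).
  apply: le_trans (back_near n Gy Gz h) _; rewrite ler_wpM2r//.
  by rewrite ler_peMl// dist_const_ge1.
apply: le_trans (back_diam n Gy Gz) _; rewrite /diam_const /dist_const mulrAC.
apply: ler_pM => //; [by rewrite mulr_ge0|exact: ltW|].
by rewrite ler_wpM2r// lerDl.
Qed.

Definition dmul (theta : past B) (x : C) (n : nat) : C :=
  \prod_(j < n) mult K (back K theta j.+1 x).

(** Increments of the inverse branches, rescaled by the multipliers along the
    backward orbit of a point [x] of the Cantor set.  Since the multipliers are
    complex numbers these are honest products, whatever the differential does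
    off the Cantor set. *)
Definition incr (theta : past B) (x y z : C) (n : nat) : C :=
  dmul theta x n * (back K theta n y - back K theta n z).

Lemma mult_ge a x : G a x -> mu <= `|mult K x|.
Proof. by move=> Gx; have := ctrl_dmu ct (1 : C) Gx; rewrite cnorm1 mulr1. Qed.

Lemma mult_neq0 a x : G a x -> mult K x != 0.
Proof. by move=> /mult_ge h; rewrite -normr_gt0 (lt_le_trans mu0). Qed.

Lemma dmul_neq0 theta x n : G (pastE theta 0) x -> dmul theta x n != 0.
Proof.
by move=> Gx; apply/prodf_neq0 => j _; apply: mult_neq0; exact: (back_in j.+1 Gx).
Qed.

Lemma back_max_powR theta n x y z : G (pastE theta 0) x -> G (pastE theta 0) y ->
  G (pastE theta 0) z ->
  (Num.max `|back K theta n y - back K theta n x| `|back K theta n z - back K theta n x|) `^ eps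
  <= C0 `^ eps * q ^+ n * (Num.max `|y - x| `|z - x|) `^ eps.
Proof.
move=> Gx Gy Gz.
have mun k : 0 <= mu^-1 ^+ k by rewrite exprn_ge0//; case/andP: imu.
have im : 0 <= mu^-1 by case/andP: imu.
set m := Num.max `|y - x| _.
have m0 : 0 <= m by exact: powR_max_ge0.
have -> : C0 `^ eps * q ^+ n * m `^ eps = (C0 * mu^-1 ^+ n * m) `^ eps.
  by rewrite !powRM ?mulr_ge0// powRX.
apply: powR_mono => //.
rewrite ge_max; apply/andP; split.
  apply: le_trans (back_contract n Gy Gx) _; rewrite ler_wpM2l ?mulr_ge0//.
  by rewrite /m le_max lexx.
apply: le_trans (back_contract n Gz Gx) _; rewrite ler_wpM2l ?mulr_ge0//.
by rewrite /m le_max lexx orbT.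
Qed.

(** The increment changes by the error of strict differentiability at a point of the
    backward orbit of [x].  It is compared with both terms: the former bound gives
    convergence and upper bounds, the latter lower bounds. *)
Lemma incr_step theta x y z n : cantor_set K x -> G (pastE theta 0) x ->
  G (pastE theta 0) y -> G (pastE theta 0) z ->
  let a := strict_const * (Num.max `|y - x| `|z - x|) `^ eps in
  (`|incr theta x y z n.+1 - incr theta x y z n| <= a * q ^+ n * `|incr theta x y z n|)
  /\ (`|incr theta x y z n.+1 - incr theta x y z n| <= a * q ^+ n * `|incr theta x y z n.+1|).
Proof.
move=> Kx Gx Gy Gz a.
set X := back K theta n.+1 x; set Y := back K theta n.+1 y; set Z := back K theta n.+1 z.
have GX : G _ X := back_in n.+1 Gx; have GY : G _ Y := back_in n.+1 Gy.
have GZ : G _ Z := back_in n.+1 Gz.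
have gY : g Y = back K theta n y by exact: back_g.
have gZ : g Z = back K theta n z by exact: back_g.
have KX : cantor_set K X by exact: back_cantor.
set m := (Num.max `|y - x| `|z - x|) `^ eps in a *.
have m0 : 0 <= m by exact: powR_ge0.
have E : incr theta x y z n.+1 - incr theta x y z n =
    - (dmul theta x n * (g Y - g Z - 'd g X (Y - Z))).
  rewrite /incr multE// -/Y -/Z gY gZ /dmul big_ord_recr /= -/X; ring.
have M0 := ctrl_M ct; have kap0 := ctrl_kap ct.
have hm : `|incr theta x y z n.+1 - incr theta x y z n| <=
    `|dmul theta x n| * (M * (C0 `^ eps * q ^+ n * m) * `|Y - Z|).
  rewrite E normrN cnormM ler_wpM2l//; apply: le_trans (ctrl_strict ct GX GY GZ) _.
  rewrite ler_wpM2r// ler_wpM2l//; apply: le_trans (back_max_powR n.+1 Gx Gy Gz) _.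
  rewrite ler_wpM2r// ler_wpM2l ?powR_ge0// exprS -[leRHS]mul1r ler_wpM2r ?exprn_ge0//.
  by case/andP: q01 => _ /ltW.
have qn : 0 <= q ^+ n by rewrite exprn_ge0.
have Ce : 0 <= C0 `^ eps by exact: powR_ge0.
split; apply: le_trans hm _.
  have h := ctrl_lower ct GY GZ; rewrite gY gZ in h.
  rewrite [incr _ _ _ _ _]/incr cnormM /a /strict_const.
  apply: le_trans (_ : `|dmul theta x n| * (M * (C0 `^ eps * q ^+ n * m) *
     (kap^-1 * `|back K theta n y - back K theta n z|)) <= _).
    rewrite ler_wpM2l// ler_wpM2l ?mulr_ge0//.
    by rewrite -ler_pdivrMl ?invr_gt0// invrK.
  rewrite -subr_ge0.
  set d := `|_|; set e := `|_|.
  rewrite (_ : _ - _ = M * C0 `^ eps * m * q ^+ n * d * e); last by ring.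
  by rewrite !mulr_ge0 ?normr_ge0.
rewrite [incr _ _ _ _ _]/incr cnormM -/Y -/Z /dmul big_ord_recr /= -/X cnormM /a /strict_const.
have hX : 1 <= `|mult K X| by apply: le_trans (mult_ge GX); apply/ltW/(ctrl_mu ct).
set d := `|_|; set e := `|Y - Z|; set l := `|mult K X| in hX *.
have -> : (M + M / kap) * C0 `^ eps * m * q ^+ n * (d * l * e) =
  d * (M * (C0 `^ eps * q ^+ n * m) * e) + d * (M * (C0 `^ eps * q ^+ n * m) * e) * (l - 1)
   + M / kap * C0 `^ eps * m * q ^+ n * (d * l * e) by ring.
have l0 : 0 <= l by exact: le_trans hX.
have ik : 0 <= kap^-1 by rewrite invr_ge0 ltW.
have d0 : 0 <= d by exact: normr_ge0.
have e0 : 0 <= e by exact: normr_ge0.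
by rewrite -addrA lerDl addr_ge0// !mulr_ge0// subr_ge0.
Qed.

End Controlled.

(** * Limit geometries as limits of rescaled increments *)

Section Products.
Context {R : realType}.
Local Notation C := (Rcomplex R).

Lemma cvg_mulc (u v : nat -> C) (l m : C) : u @ \oo --> l -> v @ \oo --> m ->
  (fun n => u n * v n : C) @ \oo --> (l * m : C).
Proof.
move=> ul vm; apply/cvgrPdist_le => e e0.
pose D := `|l| + `|m| + 1.
have D0 : 0 < D by rewrite ltr_wpDl// addr_ge0.
pose d := Num.min 1 (e / D).
have d0 : 0 < d by rewrite lt_min ltr01 divr_gt0.
have [N1 _ h1] := (iffLR (cvgrPdist_le _ _) ul) d d0.
have [N2 _ h2] := (iffLR (cvgrPdist_le _ _) vm) d d0.
exists (maxn N1 N2) => // n /=; rewrite geq_max => /andP[/h1 hu /h2 hv].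
have -> : l * m - u n * v n = (l - u n) * m + l * (m - v n) - (l - u n) * (m - v n) by ring.
apply: le_trans (ler_normB _ _) _; rewrite !cnormM.
apply: le_trans (lerD (ler_normD _ _) (lexx _)) _; rewrite !cnormM.
apply: le_trans (_ : d * `|m| + `|l| * d + d * 1 <= _).
  apply: lerD; last by apply: ler_pM => //; apply: le_trans hv _; rewrite ge_min lexx.
  by apply: lerD; [exact: ler_wpM2r|exact: ler_wpM2l].
have -> : d * `|m| + `|l| * d + d * 1 = d * D by rewrite /D; ring.
by rewrite -ler_pdivlMr// ge_min lexx orbT.
Qed.

Lemma cvgC_unique (u : nat -> C) (l m : C) : u @ \oo --> l -> u @ \oo --> m -> l = m.
Proof. by apply: cvg_unique; exact: norm_hausdorff. Qed.

End Products.

Section LimitIncrements.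
Context {R : realType} {eps : R} {A : finType} {B : rel A}.
Hypothesis eps0 : 0 < eps.
Local Notation C := (Rcomplex R).
Context (N : nat) (mu kap r M : R) (K : Omega eps B)
  (ct : controlled N mu kap r M K) (c : A -> C) (hc : base_points K c).
Local Notation G := (piece K).
Local Notation q := (dist_rate (eps := eps) mu).
Local Notation A1 := (strict_const1 (eps := eps) N kap r M).

Let q01 : 0 <= q < 1 := dist_rate01 eps0 ct.
Let A10 : 0 <= A1 := strict_const1_ge0 (eps := eps) ct.

Lemma base_cantor a : cantor_set K (c a). Proof. by have [] := hc a. Qed.
Lemma base_piece a : G a (c a). Proof. by have [] := hc a. Qed.

Lemma piece_diam (theta : past B) y z : G (pastE theta 0) y -> G (pastE theta 0) z ->
  `|y - z| <= diam_const N kap r.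
Proof.
by move=> Gy Gz; have := back_diam ct 0 Gy Gz; rewrite expr0 mulr1 !back0.
Qed.

Lemma strict_const_le (theta : past B) x y z : G (pastE theta 0) x ->
  G (pastE theta 0) y -> G (pastE theta 0) z ->
  strict_const (eps := eps) N kap M * (Num.max `|y - x| `|z - x|) `^ eps <= A1.
Proof.
move=> Gx Gy Gz; rewrite ler_wpM2l ?(strict_const_ge0 (eps := eps) ct)//.
apply: powR_mono => //; rewrite ge_max; apply/andP.
by split; exact: (piece_diam (theta := theta)).
Qed.

Lemma incr_step1 (theta : past B) x y z n : cantor_set K x ->
  G (pastE theta 0) x -> G (pastE theta 0) y -> G (pastE theta 0) z ->
  (`|incr K theta x y z n.+1 - incr K theta x y z n| <= A1 * q ^+ n * `|incr K theta x y z n|)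
  /\ (`|incr K theta x y z n.+1 - incr K theta x y z n| <= A1 * q ^+ n * `|incr K theta x y z n.+1|).
Proof.
move=> Kx Gx Gy Gz.
have [h1 h2] := incr_step eps0 ct n Kx Gx Gy Gz.
have qn : 0 <= q ^+ n by rewrite exprn_ge0//; case/andP: q01.
have le := strict_const_le Gx Gy Gz.
split; [apply: le_trans h1 _|apply: le_trans h2 _]; by rewrite ler_wpM2r// ler_wpM2r.
Qed.

Lemma incr0 (theta : past B) x y z : incr K theta x y z 0 = y - z.
Proof. by rewrite /incr /dmul big_ord0 mul1r !back0. Qed.

(** The limit geometry [k^theta], with the normalizing affine maps made explicit by
    the multipliers of the base point; see [limit_geometryE]. *)
Definition kfun (theta : past B) (z : C) : C :=
  lim (incr K theta (c (pastE theta 0)) z (c (pastE theta 0)) n @[n --> \oo]).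

Lemma kfun_cvg0 (theta : past B) z : G (pastE theta 0) z ->
  incr K theta (c (pastE theta 0)) z (c (pastE theta 0)) n @[n --> \oo] --> kfun theta z.
Proof.
move=> Gz; set a := pastE theta 0 in Gz *.
have [l ul _] := geo_mul_cvg A10 q01
  (fun n => proj1 (incr_step1 n (base_cantor a) (base_piece a) Gz (base_piece a))).
by apply/cvg_ex; exists l.
Qed.

Lemma kfun_cvg (theta : past B) y z : G (pastE theta 0) y -> G (pastE theta 0) z ->
  incr K theta (c (pastE theta 0)) y z n @[n --> \oo] --> kfun theta y - kfun theta z.
Proof.
move=> Gy Gz; set a := pastE theta 0 in Gy Gz *.
have -> : incr K theta (c a) y z =
    (fun n => incr K theta (c a) y (c a) n - incr K theta (c a) z (c a) n).
  by apply/funext => n; rewrite /incr; ring.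
by apply: cvgB; exact: kfun_cvg0.
Qed.

Lemma kfun_base (theta : past B) : kfun theta (c (pastE theta 0)) = 0.
Proof.
have := kfun_cvg0 (base_piece (pastE theta 0)).
have -> : incr K theta (c (pastE theta 0)) (c (pastE theta 0)) (c (pastE theta 0)) = (fun=> 0).
  by apply/funext => n; rewrite /incr subrr mulr0.
by move=> h; apply: (cvgC_unique h (cvg_cst _)).
Qed.

Lemma kfun_approx (theta : past B) y z n : G (pastE theta 0) y -> G (pastE theta 0) z ->
  `|kfun theta y - kfun theta z - incr K theta (c (pastE theta 0)) y z n|
     <= geo_rate A1 q * `|y - z| * q ^+ n.
Proof.
move=> Gy Gz; set a := pastE theta 0 in Gy Gz *.
have [l ul hl] := geo_mul_cvg A10 q01
  (fun n => proj1 (incr_step1 n (base_cantor a) (base_piece a) Gy Gz)).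
rewrite incr0 in hl.
by rewrite -(cvgC_unique ul (kfun_cvg Gy Gz)).
Qed.

Lemma kfun_upper (theta : past B) y z : G (pastE theta 0) y -> G (pastE theta 0) z ->
  `|kfun theta y - kfun theta z| <= geo_const A1 q * `|y - z|.
Proof.
move=> Gy Gz; set a := pastE theta 0 in Gy Gz *.
have h := geo_upper A10 q01
  (fun n => proj1 (incr_step1 n (base_cantor a) (base_piece a) Gy Gz)).
rewrite incr0 in h.
have := @cvg_near_le _ _ _ 0 (geo_const A1 q * `|y - z|) 0%N (kfun_cvg Gy Gz).
by rewrite subr0; apply => n _; rewrite subr0.
Qed.

Lemma cvg_norm_ge (u : nat -> C) (l : C) (d : R) :
  u @ \oo --> l -> (forall n, d <= `|u n|) -> d <= `|l|.
Proof.
move=> /cvgrPdist_lt ul h; apply/ler_addgt0Pr => e e0.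
have [n _ hn] := ul e e0; have /= := hn n (leqnn n) => hl.
apply: le_trans (h n) _.
apply: le_trans (norm_le_sub _ l) _; rewrite addrC lerD2l ltW//.
Qed.

(** The rescaled increments cannot shrink by more than a bounded factor, since
    their relative errors are summable. *)
Lemma kfun_lower (theta : past B) y z : G (pastE theta 0) y -> G (pastE theta 0) z ->
  `|y - z| <= geo_const A1 q * `|kfun theta y - kfun theta z|.
Proof.
move=> Gy Gz; set a := pastE theta 0 in Gy Gz *.
have h := geo_lower A10 q01
  (fun n => proj2 (incr_step1 n (base_cantor a) (base_piece a) Gy Gz)).
rewrite mulrC -ler_pdivrMr ?geo_const_gt0//.
apply: (cvg_norm_ge (kfun_cvg Gy Gz)) => n.
by rewrite ler_pdivrMr ?geo_const_gt0// mulrC -(incr0 theta (c a)).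
Qed.

Lemma kfun_inj (theta : past B) y z : G (pastE theta 0) y -> G (pastE theta 0) z ->
  kfun theta y = kfun theta z -> y = z.
Proof.
move=> Gy Gz e; apply/eqP; rewrite -subr_eq0 -normr_le0.
by apply: le_trans (kfun_lower Gy Gz) _; rewrite e subrr normr0 mulr0.
Qed.

(** The derivative of the limit geometry at a point [x] of the Cantor set is the
    limit of quotients of multipliers along two backward orbits. *)
Definition dratio (theta : past B) (x : C) (n : nat) : C :=
  dmul K theta (c (pastE theta 0)) n / dmul K theta x n.

Definition kder (theta : past B) (x : C) : C := lim (dratio theta x n @[n --> \oo]).

Lemma dratio0 (theta : past B) x : dratio theta x 0 = 1.
Proof. by rewrite /dratio /dmul !big_ord0 divr1. Qed.

Lemma dratio_step (theta : past B) x n : G (pastE theta 0) x ->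
  `|dratio theta x n.+1 - dratio theta x n| <= A1 * q ^+ n * `|dratio theta x n|.
Proof.
move=> Gx; set a := pastE theta 0 in Gx *.
have Gc := base_piece a.
set X := back K theta n.+1 x; set Y := back K theta n.+1 (c a).
have GX : G _ X := back_in n.+1 Gx; have GY : G _ Y := back_in n.+1 Gc.
have X0 : mult K X != 0 := mult_neq0 ct GX.
have dx : dmul K theta x n != 0 := dmul_neq0 ct n Gx.
have -> : dratio theta x n.+1 - dratio theta x n =
    dratio theta x n * ((mult K Y - mult K X) / mult K X).
  rewrite /dratio /dmul !big_ord_recr /= -/a -/X -/Y; field.
  by rewrite X0 dx.
rewrite cnormM mulrC ler_wpM2r// cnormM cnormV.
have h := ctrl_holder ct (1 : C) GY GX; rewrite cnorm1 mulr1 in h.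
have mX := mult_ge ct GX.
have mX1 : 1 <= `|mult K X| by apply: le_trans mX; exact/ltW/(ctrl_mu ct).
have qn : 0 <= q ^+ n by rewrite exprn_ge0//; case/andP: q01.
have M0 := ctrl_M ct.
apply: le_trans (_ : M * `|Y - X| `^ eps <= _).
  rewrite -[leRHS]mulr1; apply: ler_pM => //.
  by rewrite invf_le1// (lt_le_trans ltr01).
have := back_max_powR eps0 ct n.+1 Gx Gc Gc; rewrite -/X -/Y !maxxx => h2.
apply: le_trans (ler_wpM2l M0 h2) _.
rewrite /strict_const1 /strict_const.
have -> : (M + M / kap) * dist_const N `^ eps * diam_const N kap r `^ eps * q ^+ n =
  (M + M / kap) * (dist_const N `^ eps * q ^+ n * diam_const N kap r `^ eps) by ring.
have q0 : 0 <= q by case/andP: q01.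
apply: ler_pM => //; first by rewrite !mulr_ge0 ?powR_ge0 ?exprn_ge0.
  by rewrite lerDl divr_ge0// ltW// (ctrl_kap ct).
apply: ler_pM; rewrite ?powR_ge0//; first by rewrite mulr_ge0 ?powR_ge0 ?exprn_ge0.
  rewrite ler_wpM2l ?powR_ge0// exprS -[leRHS]mul1r ler_wpM2r//.
  by case/andP: q01 => _ /ltW.
by apply: powR_mono => //; apply: (piece_diam (theta := theta)).
Qed.

Lemma kder_cvg (theta : past B) x : G (pastE theta 0) x ->
  dratio theta x n @[n --> \oo] --> kder theta x.
Proof.
move=> Gx; have [l ul _] := geo_mul_cvg A10 q01 (fun n => dratio_step n Gx).
by apply/cvg_ex; exists l.
Qed.

Lemma kder_approx (theta : past B) x n : G (pastE theta 0) x ->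
  `|kder theta x - dratio theta x n| <= geo_rate A1 q * q ^+ n.
Proof.
move=> Gx; have [l ul hl] := geo_mul_cvg A10 q01 (fun n => dratio_step n Gx).
rewrite dratio0 cnorm1 in hl.
by have := hl n; rewrite mulr1 (cvgC_unique ul (kder_cvg Gx)).
Qed.

Lemma kder_upper (theta : past B) x : G (pastE theta 0) x ->
  `|kder theta x| <= geo_const A1 q.
Proof.
move=> Gx; have h := geo_upper A10 q01 (fun n => dratio_step n Gx).
rewrite dratio0 cnorm1 mulr1 in h.
have := @cvg_near_le _ _ _ 0 (geo_const A1 q) 0%N (kder_cvg Gx).
by rewrite subr0; apply => n _; rewrite subr0.
Qed.

Definition kstrict_const : R :=
  geo_const A1 q * (strict_const (eps := eps) N kap M * geo_const A1 q / (1 - q)).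

Lemma kstrict_const_ge0 : 0 <= kstrict_const.
Proof.
have /andP[_ /ltW q1] := q01.
have g0 : 0 <= geo_const A1 q by exact/ltW/geo_const_gt0.
have s0 := strict_const_ge0 (eps := eps) ct.
apply: mulr_ge0 => //; apply: mulr_ge0; last by rewrite invr_ge0 subr_ge0.
exact: mulr_ge0.
Qed.

(** The increments rescaled along [x] and along the base point differ by the factor
    [dratio], whose limit is [kder]. *)
Lemma kfun_strict (theta : past B) x y z : cantor_set K x ->
  G (pastE theta 0) x -> G (pastE theta 0) y -> G (pastE theta 0) z ->
  `|kfun theta y - kfun theta z - kder theta x * (y - z)| <=
    kstrict_const * (Num.max `|y - x| `|z - x|) `^ eps * `|y - z|.
Proof.
move=> Kx Gx Gy Gz; have g0 : 0 <= geo_const A1 q by exact/ltW/geo_const_gt0.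
have /andP[_ q1] := q01.
pose a := strict_const (eps := eps) N kap M * (Num.max `|y - x| `|z - x|) `^ eps.
have a0 : 0 <= a by apply: mulr_ge0 (strict_const_ge0 (eps := eps) ct) (powR_ge0 _ _).
have [l ul hl] := geo_mul_cvg a0 q01 (fun n => proj1 (incr_step eps0 ct n Kx Gx Gy Gz)).
have E n : incr K theta (c (pastE theta 0)) y z n = dratio theta x n * incr K theta x y z n.
  by rewrite /incr /dratio mulrA divfK// (dmul_neq0 ct).
have h : incr K theta (c (pastE theta 0)) y z n @[n --> \oo] --> kder theta x * l.
  have -> : incr K theta (c (pastE theta 0)) y z =
    (fun n => dratio theta x n * incr K theta x y z n) by apply/funext.
  exact: (cvg_mulc (kder_cvg Gx) ul).
have -> : kfun theta y - kfun theta z - kder theta x * (y - z) = kder theta x * (l - (y - z)).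
  by rewrite (cvgC_unique (kfun_cvg Gy Gz) h); ring.
rewrite cnormM; set m := Num.max _ _ in a a0 hl *.
have -> : kstrict_const * m `^ eps * `|y - z| = geo_const A1 q * (a * geo_const A1 q / (1 - q) * `|y - z|).
  by rewrite /kstrict_const /a; ring.
apply: ler_pM => //; first exact: kder_upper.
have := hl 0%N; rewrite expr0 mulr1 incr0 => /le_trans; apply.
rewrite ler_wpM2r// /geo_rate; apply: ler_wpM2r; first by rewrite invr_ge0 subr_ge0 ltW.
apply: ler_wpM2l => //; apply: geo_const_le => //; exact: (strict_const_le Gx Gy Gz).
Qed.

End LimitIncrements.

(** * Concatenation of words and transition maps *)

Section Concatenation.
Context {A : finType} {B : rel A}.
Implicit Types (theta : past B) (w : seq A).

Lemma concat_fun_admissible theta w : composable theta w ->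
  forall n, B (concat_fun (pastE theta) w n.+1) (concat_fun (pastE theta) w n).
Proof.
move=> /andP[sw /eqP hw] n; rewrite /concat_fun /word_size.
case: w sw hw => [|a w] sw hw; first by rewrite /= !subn0; exact: pastP.
rewrite /=; move: hw => /= hw; rewrite !ltnS.
have [nm|mn] := ltnP n (size w).
  rewrite (ltnW nm) !nth_rev ?ltnS//= ?(ltnW nm)// !subSS.
  have [i Ei] : exists i, (size w - n)%N = i.+1.
    by exists (size w - n).-1; rewrite prednK// subn_gt0.
  have Ei' : (size w - n.+1)%N = i by rewrite subnS Ei.
  rewrite Ei Ei'; apply: (sortedP _ sw) => /=.
  by rewrite ltnS -Ei leq_subr.
case: (eqVneq n (size w)) => [->|nm].
  rewrite leqnn subSnn nth_rev ?ltnS//= subnn /= hw; exact: pastP.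
have lt : (size w < n)%N by rewrite ltn_neqAle eq_sym nm.
by rewrite leqNgt lt /= subSn//; exact: pastP.
Qed.

Lemma concatE theta w : composable theta w ->
  pastE (concat theta w) = concat_fun (pastE theta) w.
Proof.
move=> cw; rewrite /pastE /concat val_insubd ifT//.
by apply: mem_set; exact: concat_fun_admissible.
Qed.

Lemma concat_shift theta w n : composable theta w ->
  pastE (concat theta w) (n + word_size w) = pastE theta n.
Proof.
move=> cw; rewrite concatE// /concat_fun /word_size.
move: cw => /andP[_]; case: w => [|a w] /= /eqP hw; first by rewrite addn0 subn0.
rewrite addnK; case: n => [|n]; last by rewrite addSn ltnS ltnNge leq_addl.
by rewrite add0n ltnSn nth_rev//= subnn /= hw.
Qed.

Lemma concat_past_word theta w : composable theta w -> w != [::] ->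
  past_word (concat theta w) (word_size w) = w.
Proof.
move=> cw w0; rewrite /past_word concatE// -[RHS]revK; congr rev.
have sw : (word_size w).+1 = size w by case: w w0 {cw}.
rewrite sw -[RHS](mkseq_nth (pastE theta 0%N)) size_rev.
by apply/eq_in_map => i; rewrite mem_iota add0n /= => isz; rewrite /concat_fun isz.
Qed.

Lemma concat0 theta w : composable theta w -> word_size w = 0%N -> concat theta w = theta.
Proof.
move=> cw sw; apply: val_inj; apply/funext => n.
by have := concat_shift n cw; rewrite sw addn0.
Qed.

Lemma composable_nil theta : composable theta [::].
Proof. by rewrite /composable /= eqxx. Qed.

Lemma composable_cons theta a b w : composable theta (a :: b :: w) ->
  composable theta [:: a; b] /\ composable (concat theta [:: a; b]) (b :: w).
Proof.
move=> /andP[/= /andP[Bab sw] ha].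
have c1 : composable theta [:: a; b] by rewrite /composable /= Bab ha.
split => //; rewrite /composable /admissible_word /= sw /=.
by rewrite concatE.
Qed.

Lemma concat_cons theta a b w : composable theta (a :: b :: w) ->
  concat theta (a :: b :: w) = concat (concat theta [:: a; b]) (b :: w).
Proof.
move=> cw; have [c1 c2] := composable_cons cw.
apply: val_inj; rewrite -!/(pastE _) !concatE//; apply/funext => n.
rewrite /concat_fun /word_size /=.
have [n1|n1] := ltnP n (size w).+1.
  rewrite (ltn_trans n1 (ltnSn _)) rev_cons nth_rcons size_rev /= n1.
  by apply: set_nth_default; rewrite size_rev.
have [n2|n2] := ltnP n (size w).+2.
  have -> : n = (size w).+1 by apply/eqP; rewrite eqn_leq n1 -ltnS n2.
  by rewrite subSnn /= nth_rev//= subnn.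
have h : (1 < n - size w)%N by rewrite ltn_subRL addn1.
by rewrite ltnNge h /= -subnDA addn1.
Qed.

End Concatenation.

Section Transition.
Context {R : realType} {eps : R} {A : finType} {B : rel A}.
Hypothesis eps0 : 0 < eps.
Local Notation C := (Rcomplex R).

Section Words.
Context (K : Omega eps B).
Local Notation G := (piece K).

Lemma back_concat (theta : past B) w n z : composable theta w ->
  G (pastE (concat theta w) 0) z ->
  back K theta n (word_map K w z) = back K (concat theta w) (n + word_size w) z.
Proof.
move=> cw Gz; elim: n => [|n IH].
  rewrite back0 add0n /back; have [->|w0] := eqVneq w [::]; first by [].
  by rewrite concat_past_word.
by rewrite addSn !backS IH -addSn concat_shift.
Qed.

Lemma word_map_in (theta : past B) w z : composable theta w ->
  G (pastE (concat theta w) 0) z -> G (pastE theta 0) (word_map K w z).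
Proof.
move=> cw Gz; have := back_concat 0 cw Gz; rewrite back0 add0n => ->.
by have := back_in (K := K) (word_size w) Gz; rewrite -[word_size w]add0n concat_shift.
Qed.

Lemma word_map_cantor (theta : past B) w z : composable theta w ->
  G (pastE (concat theta w) 0) z -> cantor_set K z -> cantor_set K (word_map K w z).
Proof.
move=> cw Gz Kz; have := back_concat 0 cw Gz; rewrite back0 add0n => ->.
exact: back_cantor.
Qed.

Lemma piece_interior a : exists2 z : C, interior (G a) z & G a z.
Proof.
have [x Gx] := piece_nonempty (Omega_axioms K) a.
have : closure (interior (G a)) x by rewrite -(piece_regular (Omega_axioms K)).
move=> /(_ setT filterT)[z [iz _]]; exists z => //; exact: interior_subset.
Qed.

Lemma piece_other a x : exists2 z, G a z & z != x.
Proof.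
have [y iy Gy] := piece_interior a.
have [yx|yx] := eqVneq y x; last by exists y.
have [e e0 he] : exists2 e : R, 0 < e & forall w, `|w - y| < e -> G a w.
  by apply/nbhs_cP; exact: iy.
have nz : (e / 2)%:C%C != 0 :> C by rewrite -normr_gt0 /Num.norm /= expr0n addr0 sqrtr_gt0 exprn_gt0// divr_gt0.
exists (y + (e / 2)%:C%C : C); last by rewrite -yx -subr_eq0 addrAC subrr add0r.
apply: he; rewrite addrAC subrr add0r /Num.norm /= expr0n addr0 sqrtr_sqr ger0_norm ?divr_ge0 ?ltW//.
by rewrite gtr_pMr// invf_lt1// ltr1n.
Qed.

End Words.

Context (N : nat) (mu kap r M : R) (K : Omega eps B)
  (ct : controlled N mu kap r M K) (c : A -> C) (hc : base_points K c).
Local Notation G := (piece K).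
Local Notation kf := (kfun K c).

(** Along [theta w] the increments of two points are, up to a common factor, the
    increments along [theta] of their images under the inverse branch of [w]. *)
Lemma kfun_proportional (theta : past B) w y z y' z' : composable theta w ->
  let theta' := concat theta w in
  G (pastE theta' 0) y -> G (pastE theta' 0) z -> G (pastE theta' 0) y' -> G (pastE theta' 0) z' ->
  (kf theta (word_map K w y) - kf theta (word_map K w z)) * (kf theta' y' - kf theta' z') =
  (kf theta (word_map K w y') - kf theta (word_map K w z')) * (kf theta' y - kf theta' z) :> C.
Proof.
move=> cw theta' Gy Gz Gy' Gz'.
have sh (u v : C) : G (pastE theta' 0) u -> G (pastE theta' 0) v ->
  incr K theta' (c (pastE theta' 0)) u v (n + word_size w)%N @[n --> \oo] --> kf theta' u - kf theta' v.
  by move=> Gu Gv; rewrite cvg_shiftn; exact: (kfun_cvg eps0 ct hc).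
have st (u v : C) : G (pastE theta' 0) u -> G (pastE theta' 0) v ->
  incr K theta (c (pastE theta 0)) (word_map K w u) (word_map K w v) n @[n --> \oo]
   --> kf theta (word_map K w u) - kf theta (word_map K w v).
  by move=> Gu Gv; apply: (kfun_cvg eps0 ct hc); exact: word_map_in.
pose X u v n := incr K theta (c (pastE theta 0)) (word_map K w u) (word_map K w v) n.
pose Y u v n := incr K theta' (c (pastE theta' 0)) u v (n + word_size w)%N.
have h1 : (fun n => X y z n * Y y' z' n : C) @ \oo --> _ :=
  cvg_mulc (st _ _ Gy Gz) (sh _ _ Gy' Gz').
have h2 : (fun n => X y' z' n * Y y z n : C) @ \oo --> _ :=
  cvg_mulc (st _ _ Gy' Gz') (sh _ _ Gy Gz).
have E : (fun n => X y' z' n * Y y z n : C) = (fun n => X y z n * Y y' z' n : C).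
  by apply/funext => n; rewrite /X /Y /incr !back_concat//; ring.
by rewrite E in h2; exact: (cvgC_unique h1 h2).
Qed.

Lemma kfun_transition (theta : past B) w : composable theta w ->
  exists F : aff R, forall z, G (pastE (concat theta w) 0) z ->
    aff_fun F (kf (concat theta w) z) = kf theta (word_map K w z).
Proof.
move=> cw; set theta' := concat theta w; set b := pastE theta' 0.
have Gc : G b (c b) by exact: (base_piece hc).
have [z1 Gz1 z1c] := piece_other K b (c b).
pose d' : C := kf theta' z1 - kf theta' (c b).
pose d : C := kf theta (word_map K w z1) - kf theta (word_map K w (c b)).
have d'0 : d' != 0.
  by apply: contra_neq z1c => /subr0_eq; exact: (kfun_inj eps0 ct hc).
have wz u : G b u -> G (pastE theta 0) (word_map K w u) by exact: word_map_in.
have d0 : d != 0.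
  apply/eqP => /subr0_eq/(kfun_inj eps0 ct hc (wz _ Gz1) (wz _ Gc)) e.
  have := back_concat 0 cw Gz1; have := back_concat 0 cw Gc.
  rewrite !back0 e => -> e'; move: z1c; apply/negP; rewrite negbK; apply/eqP.
  rewrite add0n in e'; elim: (word_size w) e' => [//|k IH] e'; apply: IH.
  by have := congr1 (cmap K) e'; rewrite !back_g.
have a0 : d / d' != 0 by rewrite mulf_neq0 ?invr_eq0.
exists (mkaff (kf theta (word_map K w (c b))) a0) => z Gz.
rewrite /aff_fun /=.
have := kfun_proportional cw Gz Gc Gz1 Gc; rewrite -/d -/d' -/theta'.
rewrite {2}/theta' (kfun_base eps0 ct hc) subr0 => e.
have -> : d / d' * kf theta' z = kf theta (word_map K w z) - kf theta (word_map K w (c b)) :> C.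
  by rewrite mulrAC -e mulfK.
by rewrite subrK.
Qed.

End Transition.

(** * Identification of the normalizing affine maps *)

Section Extensions.
Context {R : realType} {eps : R} {A : finType} {B : rel A}.
Hypothesis eps0 : 0 < eps.
Local Notation C := (Rcomplex R).

Lemma diff_id (x : C) : differentiable (@id C) x /\ forall v, 'd (@id C) x v = v.
Proof.
split; first exact: (@ex_diff _ _ _ _ _ _ _ (is_diff_id x)).
by move=> v; rewrite (@diff_val _ _ _ _ _ _ _ (is_diff_id x)).
Qed.

Lemma diff_chain (f h : C -> C) (x : C) : differentiable f x ->
  differentiable h (f x) -> forall v, 'd (h \o f) x v = 'd h (f x) ('d f x v).
Proof. by move=> df dh v; rewrite (@diff_comp _ _ _ _ f h). Qed.

Lemma id_C1eps (U : set C) : C1eps eps U (@id C).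
Proof.
split=> x _; first exact: (proj1 (diff_id x)).
exists 0, 1; split => // y z v _ _.
by rewrite (proj2 (diff_id y)) (proj2 (diff_id z)) subrr normr0 !mul0r.
Qed.

Lemma id_embedding : C1eps_embedding eps setT (@id C).
Proof.
by exists id; rewrite image_id; split => //; [exact: id_C1eps|exact: openT|exact: id_C1eps].
Qed.

Lemma diff_eq_on (G W1 W2 : set C) (H1 H2 : C -> C) (x : C) :
  G = closure (interior G) -> open W1 -> open W2 -> G `<=` W1 -> G `<=` W2 ->
  C1eps eps W1 H1 -> C1eps eps W2 H2 -> (forall y, G y -> H1 y = H2 y) -> G x ->
  forall v, 'd H1 x v = 'd H2 x v.
Proof.
move=> rG o1 o2 G1 G2 c1 c2 e Gx.
have [d d0 [_ [_ _ t3]]] := C1eps_tame eps0 o2 c2 (G2 _ Gx).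
apply: (diff_regular_eq eps0 o1 c1 G1 rG Gx) => e' e'0.
have [d' d'0 hd'] := powR_small eps0 (mulr_gt0 e'0 d0).
exists (Num.min d d') => [|y z Gy Gz]; first by rewrite lt_min d0.
rewrite !lt_min => /andP[y1 y2] /andP[z1 z2]; rewrite !e//.
have xx : `|x - x| < d by rewrite subrr normr0.
apply: le_trans (t3 x y z xx y1 z1) _; rewrite ler_wpM2r// mulrC ler_pdivrMr//.
by apply: hd'; rewrite le_max normr_ge0 /= ge_max !ltW.
Qed.

Lemma embedding_inverse (U : set C) f : open U -> C1eps_embedding eps U f ->
  exists f', [/\ open (f @` U), C1eps_embedding eps (f @` U) f' &
     forall x, U x -> f' (f x) = x].
Proof.
move=> oU [f' [cf of1 cf' fK]]; exists f'; split => //.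
have E : f' @` (f @` U) = U.
  apply/seteqP; split=> [_ [_ [x Ux <-] <-]|x Ux]; first by rewrite fK.
  by exists (f x); [exists x|rewrite fK].
by exists f; rewrite E; split => // _ [x Ux <-]; rewrite fK.
Qed.

Lemma embedding_C1eps (U : set C) f : C1eps_embedding eps U f -> C1eps eps U f.
Proof. by case=> f' []. Qed.

Context (K : Omega eps B).
Local Notation G := (piece K).
Local Notation g := (cmap K).

(** The differential at the points of the Cantor set does not depend on the chosen
    extension of the map, the pieces being closures of their interiors. *)
Lemma branch_ext a : exists O phi, [/\ open O, C1eps_embedding eps O phi,
  forall y, G a y -> O (g y) /\ phi (g y) = y &
  forall y, G a y -> cantor_set K y ->
    mult K y != 0 /\ forall v, 'd phi (g y) v = ((mult K y)^-1 * v : C)].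
Proof.
have KO := Omega_axioms K.
have [W [F [oW GW Fg eF _]]] := branch_embedding KO a.
have [phi [oI ephi FK]] := embedding_inverse oW eF.
exists (F @` W), phi; split => //.
  move=> y Gy; split; first by exists y; [exact: GW|exact: Fg].
  by rewrite -Fg// FK//; exact: GW.
move=> y Gy Ky.
have cF := embedding_C1eps eF; have cphi := embedding_C1eps ephi.
have dFg : forall v, 'd F y v = 'd g y v.
  apply: (diff_eq_on (piece_regular KO a) oW (dom_open KO) GW (piece_dom KO (a := a)) cF) => //.
  exact: map_C1eps KO.
have cc : C1eps eps W (phi \o F).
  by apply: (C1eps_comp eps0 oW oI cF cphi) => x Wx; exists x.
have dc v : 'd phi (g y) ('d F y v) = v.
  have := diff_eq_on (piece_regular KO a) oW openT GW (fun _ _ => I) cc (id_C1eps setT)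
     (fun y Gy => FK y (GW y Gy)) Gy v.
  rewrite (proj2 (diff_id y)) => e.
  have h1 : differentiable F y by case: cF => h _; exact/h/GW.
  have h2 : differentiable phi (F y).
    by case: cphi => h _; apply: h; exists y => //; exact: GW.
  by rewrite -(Fg y Gy) -[RHS]e (diff_chain h1 h2).
have dc' v : 'd phi (g y) (mult K y * v : C) = v by rewrite -multE// -dFg dc.
have m0 : mult K y != 0.
  apply/eqP => m0; have := dc' (1 : C); rewrite m0 mul0r linear0 => /esym/eqP.
  by rewrite oner_eq0.
split=> // v; rewrite -[in LHS](mulVKf m0 v) -[RHS]dc'.
by congr ('d phi _ _); rewrite mulVKf.
Qed.

Lemma cantor_mult_neq0 a y : G a y -> cantor_set K y -> mult K y != 0.
Proof. by move=> Gy Ky; have [_ [phi [_ _ _ h]]] := branch_ext a; have [] := h y Gy Ky. Qed.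

Lemma cantor_dmul_neq0 theta x n : G (pastE theta 0) x -> cantor_set K x -> dmul K theta x n != 0.
Proof.
move=> Gx Kx; apply/prodf_neq0 => j _.
by apply: cantor_mult_neq0; [exact: back_in|exact: back_cantor].
Qed.

Lemma back_ext (theta : past B) n : exists W F, [/\ open W, G (pastE theta 0) `<=` W,
  C1eps_embedding eps W F, forall z, G (pastE theta 0) z -> F z = back K theta n z &
  forall x, G (pastE theta 0) x -> cantor_set K x ->
    forall v, 'd F x v = ((dmul K theta x n)^-1 * v : C)].
Proof.
elim: n => [|n [W [F [oW GW eF FE dF]]]].
  exists setT, id; split => //; first exact: openT; first exact: id_embedding.
  by move=> x _ _ v; rewrite (proj2 (diff_id x)) /dmul big_ord0 invr1 mul1r.
have [D [phi [oO ephi Og dphi]]] := branch_ext (pastE theta n.+1).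
have cF := embedding_C1eps eF; have cphi := embedding_C1eps ephi.
have bk z : G (pastE theta 0) z -> D (F z) /\ phi (F z) = back K theta n.+1 z.
  move=> Gz; rewrite FE// -(back_g n Gz); exact/Og/back_in.
exists (W `&` F @^-1` D), (phi \o F); split.
- exact: open_preimage oW oO cF.
- by move=> z Gz; split; [exact: GW|have [] := bk z Gz].
- exact: embedding_comp.
- by move=> z /bk[].
- move=> x Gx Kx v.
  have h1 : differentiable F x by case: cF => h _; exact/h/GW.
  have h2 : differentiable phi (F x) by case: cphi => h _; apply: h; have [] := bk x Gx.
  rewrite (diff_chain h1 h2) dF// FE// -(back_g n Gx).
  have [_ ->] := dphi _ (back_in n.+1 Gx) (back_cantor n.+1 Gx Kx).
  by rewrite /dmul big_ord_recr /= invfM mulrA [X in X * v]mulrC.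
Qed.

Context (c : A -> C) (hc : base_points K c).

(** The inverse branch has derivative [(dmul K theta c n)^-1] at the base point; this
    determines the normalization. *)
Lemma PhiE (theta : past B) n (w : C) :
  aff_fun (Phi K c theta n) w =
    dmul K theta (c (pastE theta 0)) n * (w - back K theta n (c (pastE theta 0))).
Proof.
set a := pastE theta 0; set d := dmul _ _ _ _; set p := back _ _ _ _.
have Gc : G a (c a) by exact: (base_piece hc).
have Kc : cantor_set K (c a) by exact: (base_cantor hc).
have d0 : d != 0 by exact: cantor_dmul_neq0.
have [W [F [oW GW eF FE dF]]] := back_ext theta n.
have cF := embedding_C1eps eF.
pose T0 := mkaff (- (d * p)) d0.
have T0E z : aff_fun T0 z = affm d (- (d * p)) z by [].
have T0c : C1eps eps W (aff_fun T0 \o F).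
  by apply: (C1eps_comp eps0 oW openT cF) => //; exact: aff_C1eps.
have dT0 v : 'd (aff_fun T0 \o F) (c a) v = v.
  have dFc : differentiable F (c a) by case: cF => h _; exact/h/GW.
  rewrite (diff_chain dFc (proj1 (aff_diff d (- (d * p)) _))).
  by rewrite (proj2 (aff_diff d _ _)) dF// mulrA mulfV// mul1r.
have ex : exists T, aff_fun T (word_map K (past_word theta n) (c a)) = 0 /\
  exists W F, [/\ open W, G a `<=` W, C1eps eps W F,
      forall z, G a z -> F z = aff_fun T (word_map K (past_word theta n) z) &
      forall v, 'd F (c a) v = v].
  exists T0; split; first by rewrite /aff_fun /= -/(back K theta n (c a)) -/p subrr.
  by exists W, (aff_fun T0 \o F); split => // z Gz /=; rewrite FE.
have [] := xgetPex (aff1 R) ex; rewrite -/(Phi K c theta n); set T := Phi K c theta n.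
rewrite -/(back K theta n (c a)) -/p => Tp [W' [F' [oW' GW' cF' F'E dF']]].
have TE z : aff_fun T z = (\val T).1 * (z - p).
  by rewrite mulrBr; apply/eqP; rewrite -subr_eq0 -[X in _ == X]Tp /aff_fun; apply/eqP; ring.
rewrite TE; congr (_ * _).
pose s := (\val T).1 / d.
have dss v : 'd (affm s 0 \o (aff_fun T0 \o F)) (c a) v = (s * v : C).
  have h1 : differentiable (aff_fun T0 \o F) (c a) by case: T0c => h _; exact/h/GW.
  by rewrite (diff_chain h1 (proj1 (aff_diff s 0 _))) (proj2 (aff_diff s 0 _)) dT0.
have cs : C1eps eps W (affm s 0 \o (aff_fun T0 \o F)).
  have ca : C1eps eps setT (affm s 0) by exact: aff_C1eps.
  exact: (C1eps_comp eps0 oW openT T0c ca).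
have := diff_eq_on (piece_regular (Omega_axioms K) a) oW' oW GW' GW cF' cs _ Gc (1 : C).
rewrite dF' dss mulr1 => h; rewrite -[LHS](divfK d0) -/s -h ?mul1r// => z Gz.
rewrite F'E// TE /= FE// T0E /affm addr0 -/(back K theta n z) /s.
by field.
Qed.

Lemma limit_geometryE (theta : past B) z : G (pastE theta 0) z ->
  limit_geometry K c theta z = kfun K c theta z.
Proof.
move=> Gz; rewrite /limit_geometry /kfun.
suff -> : (fun n => aff_fun (Phi K c theta n) (word_map K (past_word theta n) z)) =
  incr K theta (c (pastE theta 0)) z (c (pastE theta 0)) by [].
by apply/funext => n; rewrite PhiE.
Qed.

End Extensions.

(** * Limit geometries are configurations *)

Section FiniteUniform.
Context {R : realType} {A : finType}.

Lemma fin_uniform (P : A -> R -> Prop) :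
  (forall a, exists2 d : R, 0 < d & P a d) ->
  (forall a d d', 0 < d' -> d' <= d -> P a d -> P a d') ->
  exists2 d : R, 0 < d & forall a, P a d.
Proof.
move=> ex mono.
have ex' a : exists d : R, 0 < d /\ P a d by have [d d0 Pd] := ex a; exists d.
have [d hd] := choice ex'.
exists (\big[Num.min/1]_a d a).
  by apply: lt_bigmin => // a _; have [] := hd a.
move=> a; have [da Pa] := hd a; apply: mono Pa.
  by apply: lt_bigmin => // b _; have [] := hd b.
exact: bigmin_le.
Qed.

End FiniteUniform.

Section Configurations.
Context {R : realType} {eps : R} {A : finType} {B : rel A}.
Hypothesis eps0 : 0 < eps.
Local Notation C := (Rcomplex R).

Lemma diff_bound_compact (U G : set C) (f : C -> C) : open U -> C1eps eps U f ->
  compact G -> G `<=` U ->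
  exists2 b : R, 0 < b & forall x, G x -> forall v, `|'d f x v| <= b * `|v|.
Proof.
move=> oU cf cG GU.
suff [e e0 he] : exists2 e : R, 0 < e & forall x, G x -> forall v, `|'d f x v| <= e^-1 * `|v|.
  by exists e^-1; rewrite ?invr_gt0.
apply: compact_uniform => // x Gx.
have [d d0 [_ T]] := C1eps_tame eps0 oU cf (GU _ Gx).
have di : 0 <= d^-1 by rewrite invr_ge0 ltW.
have [b b0 hb] := tame_bounds eps0 d0 di T.
exists (Num.min d (b + 1)^-1) => [|x' e]; first by rewrite lt_min d0 invr_gt0 ltr_wpDl.
rewrite lt_min => /andP[x1 _] /andP[e0]; rewrite lt_min => /andP[_ e1] v.
have [h _] := hb _ _ x1 x1; apply: le_trans (h v) _; rewrite ler_wpM2r//.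
apply: le_trans (_ : b + 1 <= _); first by rewrite lerDl.
by rewrite -[leLHS]invrK lef_pV2 ?posrE ?invr_gt0 ?ltr_wpDl// ltW.
Qed.

Lemma aff_embedding_comp (T : aff R) (U : set C) f : open U ->
  C1eps_embedding eps U f -> C1eps_embedding eps U (aff_fun T \o f).
Proof.
move=> oU ef; have := embedding_comp eps0 oU openT ef (aff_embedding eps T).
by rewrite preimage_setT setIT.
Qed.

Section Omega.
Context (K : Omega eps B).
Local Notation G := (piece K).
Local Notation g := (cmap K).

Definition pieces : set C := [set z | exists a, G a z].

Lemma pieces_compact : compact pieces.
Proof.
have -> : pieces = \big[setU/set0]_(a <- enum A) G a.
  rewrite -bigcup_seq; apply/seteqP; split=> [z [a Ga]|z [a _ Ga]]; last by exists a.
  by exists a => //=; rewrite mem_enum.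
by apply: bigsetU_compact => a _; exact: piece_compact (Omega_axioms K) a.
Qed.

Lemma pieces_dom : pieces `<=` dom K.
Proof. by move=> z [a]; exact: piece_dom (Omega_axioms K) a z. Qed.

Lemma compact_image (S U : set C) f : C1eps eps U f -> S `<=` U -> compact S ->
  compact (f @` S).
Proof.
move=> cf SU; apply: continuous_compact; apply/subspace_continuousP => x Sx.
apply: cvg_within_filter.
exact: (C1eps_continuous cf (SU _ Sx)).
Qed.

Lemma branch_ext_uniform : exists2 d : R, 0 < d & exists phi : A -> C -> C,
  (forall a y, G a y -> phi a (g y) = y) /\
  (forall a y, G a y -> tame eps (phi a) (g y) d d^-1) /\
  (forall a y, G a y -> cantor_set K y ->
     forall v, 'd (phi a) (g y) v = ((mult K y)^-1 * v : C)).
Proof.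
have ex a : exists phi : C -> C, exists Q, [/\ open Q, C1eps_embedding eps Q phi,
  forall y, G a y -> Q (g y) /\ phi (g y) = y &
  forall y, G a y -> cantor_set K y -> forall v, 'd phi (g y) v = ((mult K y)^-1 * v : C)].
  have [Q [phi [h1 h2 h3 h4]]] := branch_ext eps0 K a.
  by exists phi, Q; split => // y Gy Ky; have [] := h4 y Gy Ky.
have [phi hphi] := choice ex.
have [a|a d d' d'0 dd' h y Gy|d d0 hd] :=
    @fin_uniform R A (fun a d => forall y, G a y -> tame eps (phi a) (g y) d d^-1).
- have [Q [oQ eQ hQ _]] := hphi a.
  have cG : compact (g @` G a).
    apply: (compact_image (map_C1eps (Omega_axioms K))).
      exact: piece_dom (Omega_axioms K) a.
    exact: piece_compact (Omega_axioms K) a.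
  have gQ : g @` G a `<=` Q by move=> _ [y Gy <-]; have [] := hQ y Gy.
  have [d d0 hd] := C1eps_tame_compact eps0 oQ (embedding_C1eps eQ) cG gQ.
  by exists d => // y Gy; have [] := hd (g y) (ex_intro2 _ _ y Gy erefl).
- apply: tame_le (h y Gy); rewrite ?invr_ge0 ?(le_trans (ltW d'0) dd')//.
    by rewrite lef_pV2 ?posrE// (lt_le_trans d'0).
  by move=> z; move/lt_le_trans; apply.
exists d => //; exists phi; split=> [a y Gy|].
  by have [Q [_ _ hQ _]] := hphi a; have [] := hQ y Gy.
by split=> // a y Gy Ky; have [Q [_ _ _ hQ]] := hphi a; exact: hQ.
Qed.

Context (N : nat) (mu kap r M : R) (ct : controlled N mu kap r M K).
Context (c : A -> C) (hc : base_points K c).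

(** Far enough along the backward orbit the images of the piece lie in a small
    disc around the orbit of the base point, on which the extended inverse
    branches can be linearized; before that only finitely many embeddings are
    composed. *)
Lemma kfun_config (theta : past B) (T : aff R) :
  exists W H, config_extension K (pastE theta 0) (aff_fun T \o kfun K c theta) W H.
Proof.
set a0 := pastE theta 0.
have Gc : G a0 (c a0) by exact: (base_piece hc).
have Kc : cantor_set K (c a0) by exact: (base_cantor hc).
have [d d0 [phi [phiK [phiT phiD]]]] := branch_ext_uniform.
have [b b0 hb] := diff_bound_compact (dom_open (Omega_axioms K))
  (map_C1eps (Omega_axioms K)) pieces_compact pieces_dom.
have mu1 := ctrl_mu ct; have mu0 : 0 < mu by exact: lt_trans mu1.
have imu : 0 <= mu^-1 < 1 by rewrite invr_ge0 (ltW mu0) invf_lt1.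
have ib : 0 < b^-1 by rewrite invr_gt0.
have id0 : 0 <= d^-1 by rewrite invr_ge0 ltW.
have [s hs] := linearizing_radius_exists eps0 id0 ib imu d0.
have s0 : 0 < s by case: hs => /andP[].
have D0 : 0 <= diam_const N kap r by exact: (diam_const_ge0 ct).
(* From time [m0] on, the piece lies in the disc of linearization. *)
have [m0 hm0] : exists n, diam_const N kap r * mu^-1 ^+ n < s.
  have D1 : 0 < diam_const N kap r + 1 by rewrite ltr_wpDl.
  have [n hn] := expr_lt_exists imu (divr_gt0 s0 D1).
  exists n; apply: le_lt_trans (_ : (diam_const N kap r + 1) * mu^-1 ^+ n < _).
    by rewrite ler_wpM2r ?exprn_ge0 ?invr_ge0 ?(ltW mu0)// lerDl.
  by rewrite mulrC -ltr_pdivlMr.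
pose p j := back K theta (m0 + j) (c a0).
pose ph j := phi (pastE theta (m0 + j).+1).
pose la j : C := (mult K (p j.+1))^-1.
have Gb j y : G a0 y -> G (pastE theta (m0 + j).+1) (back K theta (m0 + j).+1 y) by exact: back_in.
have phb j y : G a0 y -> ph j (back K theta (m0 + j) y) = back K theta (m0 + j).+1 y.
  by move=> Gy; rewrite -(back_g (m0 + j) Gy) /ph phiK//; exact: Gb.
have Kb j : cantor_set K (back K theta (m0 + j).+1 (c a0)) by exact: back_cantor.
have php j : ph j (p j) = p j.+1 by rewrite /p phb// addnS.
have pht j : tame eps (ph j) (p j) d d^-1.
  by rewrite /p -(back_g (m0 + j) Gc); apply: phiT; exact: Gb.
have phd j v : 'd (ph j) (p j) v = (la j * v : C).
  rewrite /p -(back_g (m0 + j) Gc) /la /p addnS.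
  by apply: phiD; [exact: Gb|exact: Kb].
have phl j : b^-1 <= `|la j| <= mu^-1.
  have GX := Gb j _ Gc; rewrite /la /p cnormV addnS.
  have m1 := mult_ge ct GX.
  have m2 : `|mult K (back K theta (m0 + j).+1 (c a0))| <= b.
    by rewrite -[leRHS]mulr1 -[X in b * X](@cnorm1 R); apply: hb; exists (pastE theta (m0 + j).+1).
  rewrite !lef_pV2 ?posrE ?(lt_le_trans mu0 m1)//.
  by rewrite m1 m2.
have [k kc ek] := chain_linearization eps0 id0 ib imu hs php pht phd phl.
have [W [F [oW GW eF FE _]]] := back_ext eps0 K theta m0.
have cF := embedding_C1eps eF.
set Bs : set C := [set x | `|x - p 0%N| < s] in ek.
have oB : open Bs.
  rewrite openE => x xs; apply/nbhs_cP; exists (s - `|x - p 0%N|) => [|y yx]; first by rewrite subr_gt0.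
  by rewrite /Bs /= -[y](subrK x) -addrA (le_lt_trans (ler_normD _ _))// -ltrBrDr.
have inB y : G a0 y -> Bs (back K theta m0 y).
  by move=> Gy; rewrite /Bs /= /p addn0; apply: le_lt_trans hm0; exact: (back_diam ct).
have chE n y : G a0 y -> chain ph n (back K theta m0 y) = back K theta (m0 + n) y.
  by move=> Gy; elim: n => [|n IH]; rewrite ?addn0// /= IH phb// addnS.
have dm0 : dmul K theta (c a0) m0 != 0 by exact: (dmul_neq0 ct).
(* The multipliers after time [m0] are those of the whole orbit up to a constant. *)
have dmE n : (chain_mult la n)^-1 = dmul K theta (c a0) (m0 + n) / dmul K theta (c a0) m0.
  elim: n => [|n IH]; first by rewrite addn0 divff// /chain_mult big_ord0 invr1.
  rewrite /chain_mult big_ord_recr /= invfM -/(chain_mult la n) IH addnS /dmul big_ord_recr /=.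
  by rewrite /la invrK /p addnS mulrAC.
have kE y : G a0 y -> k (back K theta m0 y) = (dmul K theta (c a0) m0)^-1 * kfun K c theta y :> C.
  move=> Gy; have h1 := kc _ (inB y Gy).
  have h2 : incr K theta (c a0) y (c a0) (n + m0)%N @[n --> \oo] --> kfun K c theta y.
    by rewrite cvg_shiftn; exact: (kfun_cvg0 eps0 ct hc).
  have h3 := cvg_mulc (cvg_cst (dmul K theta (c a0) m0)^-1) h2.
  apply: (cvgC_unique h1).
  suff -> : (fun n => (chain_mult la n)^-1 * (chain ph n (back K theta m0 y) - p n) : C) =
    (fun n => (dmul K theta (c a0) m0)^-1 * incr K theta (c a0) y (c a0) (n + m0)%N : C) by exact: h3.
  by apply/funext => n; rewrite dmE chE// /p /incr addnC; ring.
pose S := mkaff 0 dm0.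
have oI : open (W `&` F @^-1` Bs) by exact: open_preimage oW oB cF.
exists (W `&` F @^-1` Bs), (aff_fun T \o (aff_fun S \o (k \o F))); split => //.
- by move=> y Gy; split; [exact: GW|rewrite /= FE//; exact: inB].
- apply: aff_embedding_comp => //; apply: aff_embedding_comp => //.
  exact: embedding_comp.
- by move=> y Gy /=; congr (aff_fun T _); rewrite FE// kE// /aff_fun /= addr0 mulVKf.
Qed.

End Omega.
End Configurations.

(** * Uniform hyperbolicity on compact pieces *)

Section UniformData.
Context {R : realType} {eps : R} {A : finType} {B : rel A}.
Hypothesis eps0 : 0 < eps.
Local Notation C := (Rcomplex R).
Context (K : Omega eps B).
Local Notation G := (piece K).
Local Notation g := (cmap K).

Lemma conorm_le (L : {linear C -> C}) (m : R) : m < conorm L ->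
  forall v, m * `|v| <= `|L v|.
Proof.
move=> mL v; have [->|v0] := eqVneq v 0; first by rewrite normr0 mulr0.
rewrite -ler_pdivlMr ?normr_gt0//; apply: le_trans (ltW mL) _.
apply: ge_inf; last by exists v.
by exists 0 => _ [w _ <-]; rewrite divr_ge0.
Qed.

Lemma dist_sub_le (y z x : C) (e f : R) : `|y - z| < e -> `|z - x| <= f -> `|y - x| < e + f.
Proof.
move=> yz zx; rewrite -[y](subrK z) -addrA.
by apply: le_lt_trans (ler_normD _ _) _; exact: ltr_leD.
Qed.

(** Hyperbolicity on the [d]-neighbourhood of a piece.  In the last item the two
    points may be close to distinct points of the piece, so that injectivity on
    the piece is included. *)
Definition uniform_data (mu : R) (a : A) (d : R) : Prop := forall x0, G a x0 ->
  [/\ forall y, `|y - x0| < d -> dom K y,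
      tame eps g x0 d d^-1,
      forall y v, `|y - x0| < d -> mu * `|v| <= `|'d g y v| <= d^-1 * `|v| &
      forall x1 y z, G a x1 -> `|y - x0| < d -> `|z - x1| < d ->
        d * `|y - z| <= `|g y - g z| <= d^-1 * `|y - z|].

Lemma uniform_data_mono mu a d d' : 0 < d' -> d' <= d ->
  uniform_data mu a d -> uniform_data mu a d'.
Proof.
move=> d'0 dd' h x0 Gx; have [h1 h2 h3 h4] := h x0 Gx.
have lt (y x : C) : `|y - x| < d' -> `|y - x| < d by move/lt_le_trans; apply.
have d0 : 0 < d by exact: lt_le_trans dd'.
have di : d^-1 <= d'^-1 by rewrite lef_pV2.
split.
- by move=> y /lt; exact: h1.
- apply: (tame_le _ di (fun y => @lt y x0) h2).
  by rewrite invr_ge0 ltW.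
- move=> y v /lt/h3 => /(_ v)/andP[-> hv] /=; apply: le_trans hv _.
  by rewrite ler_wpM2r.
- move=> x1 y z Gx1 /lt hy /lt hz; have /andP[a1 a2] := h4 x1 y z Gx1 hy hz.
  apply/andP; split; first by apply: le_trans a1; rewrite ler_wpM2r.
  by apply: le_trans a2 _; rewrite ler_wpM2r.
Qed.

Lemma compact_subset_ball (S U : set C) : compact S -> open U -> S `<=` U ->
  exists2 d : R, 0 < d & forall x, S x -> forall y, `|y - x| < d -> U y.
Proof.
move=> cS oU SU; apply: compact_uniform => // x Sx.
have [r r0 hr] := open_cP oU (SU _ Sx).
exists (r / 2) => [|x' e x'x /andP[e0 er] y yx']; first by rewrite divr_gt0.
by apply: hr; rewrite [r]splitr; apply: dist_sub_le (lt_trans yx' er) (ltW x'x).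
Qed.

Lemma cmap_cont x : dom K x -> forall e : R, 0 < e ->
  exists2 d : R, 0 < d & forall w, `|w - x| < d -> `|g w - g x| < e.
Proof.
move=> Vx; apply/continuous_cP.
exact: (C1eps_continuous (map_C1eps (Omega_axioms K)) Vx).
Qed.

(** A compactness argument on pairs of points of the piece. *)
Lemma bilipschitz_local (mu : R) a d : 1 < mu -> 0 < d ->
  (forall x0, G a x0 -> (forall y, `|y - x0| < d -> dom K y) /\ tame eps g x0 d d^-1) ->
  (forall x0 v, G a x0 -> mu * `|v| <= `|'d g x0 v|) ->
  exists2 e : R, 0 < e & forall x0 x1 y z, G a x0 -> G a x1 ->
    `|y - x0| < e -> `|z - x1| < e ->
    e * `|y - z| <= `|g y - g z| <= e^-1 * `|y - z|.
Proof.
move=> mu1 d0 ht hmu.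
pose P (e : R) (x : C * C) := forall y z : C, `|y - x.1| < e -> `|z - x.2| < e ->
    e * `|y - z| <= `|g y - g z| <= e^-1 * `|y - z|.
have cGG : compact (G a `*` G a).
  by apply: compact_setX; exact: piece_compact (Omega_axioms K) a.
have [|e e0 he] := @compact_uniform_top R _ (G a `*` G a) P cGG; last first.
  by exists e => // x0 x1 y z G0 G1; exact: (he (x0, x1)).
move=> [x0 x1] [/= G0 G1].
(* It is enough to bound the quotients on one product of balls. *)
suff [s s0 [k k0 hk]] : exists2 s : R, 0 < s & exists2 k : R, 0 < k &
    forall y z : C, `|y - x0| < s -> `|z - x1| < s ->
      k * `|y - z| <= `|g y - g z| <= k^-1 * `|y - z|.
  exists ([set y : C | `|y - x0| < s / 2] `*` [set z : C | `|z - x1| < s / 2]).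
    exists ([set y : C | `|y - x0| < s / 2], [set z : C | `|z - x1| < s / 2]) => //.
    by split; apply/nbhs_cP; exists (s / 2) => //; rewrite divr_gt0.
  exists (Num.min k (s / 2)) => [|[y0 z0] e [/= y0x z0x] /andP[e0]].
    by rewrite lt_min k0 divr_gt0.
  rewrite lt_min => /andP[ek es] y z /= yy0 zz0.
  have /andP[a1 a2] : k * `|y - z| <= `|g y - g z| <= k^-1 * `|y - z|.
    by apply: hk; rewrite [s]splitr; apply: dist_sub_le (ltW _);
      [apply: lt_trans yy0 es|done|apply: lt_trans zz0 es|done].
  apply/andP; split; first by apply: le_trans a1; rewrite ler_wpM2r// ltW.
  by apply: le_trans a2 _; rewrite ler_wpM2r// lef_pV2// ltW.
have [V0 T0] := ht x0 G0; have [V1 T1] := ht x1 G1.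
have xx (x : C) : `|x - x| < d by rewrite subrr normr0.
(* Near the diagonal the expansion gives the bounds, away from it injectivity. *)
have [e|ne] := eqVneq x0 x1.
  rewrite -e; have di : 0 <= d^-1 by rewrite invr_ge0 ltW.
  have [b b0 hb] := tame_bounds eps0 d0 di T0.
  have m1 : 0 < mu - 1 by rewrite subr_gt0.
  have [t t0 hpt] := powR_small eps0 (mulr_gt0 m1 d0).
  exists (Num.min d t); first by rewrite lt_min d0.
  have b1 : 0 < b + 1 by rewrite ltr_wpDl.
  exists (b + 1)^-1; first by rewrite invr_gt0.
  move=> y z; rewrite !lt_min => /andP[yd yt] /andP[zd zt].
  have [_ h1] := hb y z yd zd.
  apply/andP; split; last first.
    by apply: le_trans h1 _; rewrite invrK ler_wpM2r// lerDl.
  have [_ _ t3] := T0; have h2 := t3 x0 y z (xx _) yd zd.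
  have h3 : d^-1 * (Num.max `|y - x0| `|z - x0|) `^ eps <= mu - 1.
    by rewrite mulrC ler_pdivrMr//; apply: hpt; rewrite le_max normr_ge0 /= ge_max !ltW.
  have h4 := hmu x0 (y - z) G0.
  apply: le_trans (_ : `|y - z| <= _).
    by rewrite -[leRHS]mul1r ler_wpM2r// invf_le1// lerDr.
  have h5 := norm_le_sub ('d g x0 (y - z)) (g y - g z).
  have h6 : d^-1 * (Num.max `|y - x0| `|z - x0|) `^ eps * `|y - z| <= (mu - 1) * `|y - z|.
    by rewrite ler_wpM2r.
  have h7 := le_trans h2 h6.
  move: h4 h5 h7; set n := `|y - z|; set m := `|g y - g z|.
  set w := `|_ - 'd g x0 _|; lra.
have gne : g x0 != g x1 by apply: contra_neq ne; exact: (cmap_inj G0 G1).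
pose n := `|x0 - x1|; pose m := `|g x0 - g x1|.
have n0 : 0 < n by rewrite normr_gt0 subr_eq0.
have m0 : 0 < m by rewrite normr_gt0 subr_eq0.
have m4 : 0 < m / 4 by rewrite divr_gt0.
have [s0 s00 hs0] := cmap_cont (V0 _ (xx _)) m4.
have [s1 s10 hs1] := cmap_cont (V1 _ (xx _)) m4.
exists (Num.min (n / 4) (Num.min s0 s1)).
  by rewrite !lt_min s00 s10 divr_gt0.
exists (Num.min (m / (3 * n)) (n / (3 * m))).
  by rewrite lt_min !divr_gt0// mulr_gt0.
move=> y z; rewrite !lt_min => /and3P[yn /hs0 gy _] /and3P[zn _ /hs1 gz].
have tri (u v u' v' : C) t : `|u - u'| < t / 4 -> `|v - v'| < t / 4 -> `|u' - v'| = t ->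
    t / 2 <= `|u - v| <= 3 / 2 * t.
  move=> h1 h2 h3.
  have e1 : `|u - v| <= `|u - u'| + `|u' - v'| + `|v - v'|.
    have -> : u - v = (u - u') + (u' - v') - (v - v') by ring.
    by apply: le_trans (ler_normB _ _) _; rewrite lerD2r; exact: ler_normD.
  have e2 : `|u' - v'| <= `|u - v| + `|u - u'| + `|v - v'|.
    have -> : u' - v' = (u - v) - (u - u') + (v - v') by ring.
    by apply: le_trans (ler_normD _ _) _; rewrite lerD2r; exact: ler_normB.
  by rewrite h3 in e1 e2; apply/andP; split; lra.
have /andP[a1 a2] := tri _ _ _ _ n yn zn erefl.
have /andP[a3 a4] := tri _ _ _ _ m gy gz erefl.
apply/andP; split.
  apply: le_trans (_ : m / (3 * n) * (3 / 2 * n) <= _).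
    by apply: ler_pM => //; rewrite ?ge_min ?lexx// le_min !divr_ge0// ltW// mulr_gt0.
  apply: le_trans a3; rewrite le_eqVlt; apply/orP; left; apply/eqP; field.
  by rewrite gt_eqF.
apply: le_trans a4 _.
apply: le_trans (_ : (n / (3 * m))^-1 * (n / 2) <= _).
  rewrite le_eqVlt; apply/orP; left; apply/eqP; field.
  by rewrite !gt_eqF.
have k0 : 0 < Num.min (m / (3 * n)) (n / (3 * m)).
  by rewrite lt_min !divr_gt0// mulr_gt0.
apply: ler_pM => //; rewrite ?invr_ge0 ?divr_ge0 ?mulr_ge0 ?(ltW n0) ?(ltW m0)//.
by rewrite lef_pV2 ?posrE// ?ge_min ?lexx ?orbT// divr_gt0// mulr_gt0.
Qed.

Lemma uniform_data_exists : exists2 mu : R, 1 < mu & exists2 d : R, 0 < d &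
  forall a, uniform_data mu a d.
Proof.
have KO := Omega_axioms K.
have [mu mu1 hmu] := map_expanding KO; exists mu => //.
apply: fin_uniform; last by move=> a d d'; exact: uniform_data_mono.
move=> a; have [W [oW GW WV hW]] := hmu a.
have cG : compact (G a) by exact: (@piece_compact _ _ _ _ _ _ _ KO a).
have GV := piece_dom KO (a := a).
have [d1 d10 h1] := C1eps_tame_compact eps0 (dom_open KO) (map_C1eps KO) cG GV.
have [d2 d20 h2] := compact_subset_ball cG oW GW.
have hmu' x v : W x -> mu * `|v| <= `|'d g x v| by move=> /hW; move/conorm_le.
have [d3 d30 h3] := bilipschitz_local mu1 d10 h1 (fun x v Gx => hmu' x v (GW _ Gx)).
have [b b0 hb] := diff_bound_compact eps0 (dom_open KO) (map_C1eps KO) cG GV.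
pose t := Num.min d1 (Num.min d2 d3).
have t0 : 0 < t by rewrite !lt_min d10 d20.
pose b' := b + d1^-1 * t `^ eps.
have b'0 : 0 < b' by rewrite ltr_wpDr// mulr_ge0 ?powR_ge0// invr_ge0 ltW.
exists (Num.min t b'^-1) => [|x0 G0]; first by rewrite lt_min t0 invr_gt0.
set d := Num.min t _.
have d0 : 0 < d by rewrite lt_min t0 invr_gt0.
have dt : d <= t by rewrite ge_min lexx.
have dd1 : d <= d1 by apply: le_trans dt _; rewrite ge_min lexx.
have dd2 : d <= d2 by apply: le_trans dt _; rewrite !ge_min lexx orbT.
have dd3 : d <= d3 by apply: le_trans dt _; rewrite !ge_min lexx !orbT.
have [V0 T0] := h1 x0 G0.
split.
- by move=> y yd; apply: V0; exact: lt_le_trans dd1.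
- apply: tame_le T0; rewrite ?invr_ge0 ?(ltW d10)//; first by rewrite lef_pV2.
  by move=> y yd; exact: lt_le_trans dd1.
- move=> y v yd; apply/andP; split.
    by apply: hmu'; apply: h2 G0 _ _; exact: lt_le_trans dd2.
  apply: le_trans (_ : b' * `|v| <= _); last first.
    by rewrite ler_wpM2r// -[leLHS]invrK lef_pV2 ?posrE ?invr_gt0// ge_min lexx orbT.
  have [_ t2 _] := T0.
  have xx : `|x0 - x0| < d1 by rewrite subrr normr0.
  have h := t2 y x0 v (lt_le_trans yd dd1) xx.
  rewrite -['d g y v](subrK ('d g x0 v)) addrC /b' mulrDl.
  apply: le_trans (ler_normD _ _) _; apply: lerD; first exact: hb.
  apply: le_trans h _; rewrite ler_wpM2r// ler_wpM2l ?invr_ge0 ?(ltW d10)//.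
  by apply: powR_mono => //; apply: ltW; exact: lt_le_trans dt.
- move=> x1 y z G1 yd zd.
  have /andP[a1 a2] := h3 x0 x1 y z G0 G1 (lt_le_trans yd dd3) (lt_le_trans zd dd3).
  apply/andP; split; first by apply: le_trans a1; rewrite ler_wpM2r.
  by apply: le_trans a2 _; rewrite ler_wpM2r// lef_pV2.
Qed.

End UniformData.

(** * Nearby Cantor sets are uniformly hyperbolic *)

Section NearbySystems.
Context {R : realType} {eps : R} {A : finType} {B : rel A}.
Hypothesis eps0 : 0 < eps.
Local Notation C := (Rcomplex R).

Lemma compact_cover_balls (S : set C) (rho : R) : compact S -> 0 < rho ->
  exists N (p : 'I_N -> C), forall x, S x -> exists i, `|x - p i| < rho.
Proof.
move=> cS rho0; rewrite compact_cover in cS.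
have [|x Sx|D DS cov] := cS C S (fun x => [set y | `|y - x| < rho]).
- move=> x Sx; rewrite openE => y yx; apply/nbhs_cP.
  exists (rho - `|y - x|) => [|z zy]; first by rewrite subr_gt0.
  by rewrite /= -[z](subrK y) -addrA (le_lt_trans (ler_normD _ _))// -ltrBrDr.
- by exists x => //=; rewrite subrr normr0.
exists (size (finmap.enum_fset D)), (fun i => nth 0 (finmap.enum_fset D) i) => x Sx.
have [y yD xy] := cov x Sx.
have lt : (index y (finmap.enum_fset D) < size (finmap.enum_fset D))%N by rewrite index_mem.
by exists (Ordinal lt); rewrite /= nth_index.
Qed.

Context (K : Omega eps B).
Local Notation G := (piece K).
Local Notation g := (cmap K).

Lemma pieces_bounded : exists2 b : R, 0 <= b & forall x, pieces K x -> `|x| <= b.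
Proof.
have [M [_ hM]] := compact_bounded (@pieces_compact R eps A B K).
exists (`|M| + 1) => [|x Px]; first by rewrite addr_ge0.
by apply: (hM (`|M| + 1)) => //; rewrite ltr_pwDr// ler_norm.
Qed.

Section OneNearby.
Variables (mu0 d b delta : R) (Kt : Omega eps B).
Hypotheses (mu01 : 1 < mu0) (d0 : 0 < d) (b0 : 0 <= b).
Hypothesis ud : forall a, uniform_data K mu0 a d.
Hypothesis hb : forall x, pieces K x -> `|x| <= b.
Hypothesis near : Omega_nbhd K delta Kt.
Hypotheses (delta0 : 0 < delta) (delta1 : delta <= 1) (deltad : delta <= d / 4).
Local Notation Gt := (piece Kt).
Local Notation gt := (cmap Kt).

Let u (x : C) : C := g x - gt x.
Let du (x v : C) : C := 'd g x v - 'd gt x v.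

Lemma near_piece a x : Gt a x -> exists2 x0, G a x0 & `|x - x0| < delta.
Proof. by case: near => _ h _ /h. Qed.

Lemma piece_near a x : G a x -> exists2 x0, Gt a x0 & `|x0 - x| < delta.
Proof. by case: near => h _ _ /h[x0 G0 h0]; exists x0 => //; rewrite distrC. Qed.

Lemma near_in_ball a x : Gt a x -> exists2 x0, G a x0 & `|x - x0| < d / 4.
Proof. by move=> /near_piece[x0 G0 xx]; exists x0 => //; exact: lt_le_trans deltad. Qed.

Lemma near_dom a x : Gt a x -> (dom K `&` dom Kt) x.
Proof.
move=> Gx; split; last exact: piece_dom (Omega_axioms Kt) a x Gx.
have [x0 G0 xx] := near_in_ball Gx; have [h _ _ _] := ud G0; apply: h.
by apply: lt_le_trans xx _; rewrite ler_pdivrMr// ler_peMr ?(ltW d0)// ler1n.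
Qed.

Definition near_diam : R := 2 * (b + 1).
Definition near_lip : R := 1 + near_diam `^ eps.

Let near_diamP a x y : Gt a x -> Gt a y -> `|x - y| <= near_diam.
Proof.
have bd z : Gt a z -> `|z| <= b + 1.
  move=> /near_piece[z0 G0 zz]; rewrite -[z](subrK z0) addrC.
  apply: le_trans (ler_normD _ _) _; apply: lerD; first by apply: hb; exists a.
  by apply: le_trans delta1; exact: ltW.
move=> /bd hx /bd hy; apply: le_trans (ler_normB _ _) _.
by rewrite /near_diam mulr_natl mulr2n; apply: lerD.
Qed.

(** The points of the pieces of the perturbed set lie in both domains. *)
Lemma near_C1 : exists2 rho : R, 0 <= rho < delta & forall a x, Gt a x ->
  [/\ `|u x| <= rho, forall v, `|du x v| <= rho * `|v|,
    forall y v, Gt a y -> `|du x v - du y v| <= rho * `|x - y| `^ eps * `|v| &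
    forall y, Gt a y -> `|u y - u x - du x (y - x)| <= rho * `|x - y| `^ eps * `|y - x|].
Proof.
have [_ _ [rho r01 h]] := near; exists rho => // a x Gx.
have [h1 h2 h3 h4] := h x (near_dom Gx); split => //.
  by move=> y v Gy; apply: h3; exact: near_dom Gy.
move=> y Gy; have := h4 y (near_dom Gy).
have -> : `|x - y| `^ (1 + eps) = `|x - y| `^ eps * `|y - x|.
  have E0 : (eps + 1 == 0) = false by apply/gt_eqF/addr_gt0.
  by rewrite [1 + eps]addrC powRD ?E0// powRr1// [`|y - x|]distrC.
by rewrite mulrA.
Qed.

Lemma near_lipschitz a x y : Gt a x -> Gt a y ->
  `|u y - u x| <= delta * near_lip * `|y - x|.
Proof.
move=> Gx Gy; have [rho /andP[r0 rd] h] := near_C1.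
have [_ h2 _ h4] := h a x Gx; have {}h4 := h4 y Gy; have {}h2 := h2 (y - x).
apply: le_trans (norm_le_sub _ (du x (y - x))) _; rewrite distrC.
apply: le_trans (lerD h4 h2) _.
have h5 : `|x - y| `^ eps <= near_diam `^ eps by apply: powR_mono => //; exact: (near_diamP Gx Gy).
rewrite -mulrDl ler_wpM2r// /near_lip mulrDr mulr1 addrC.
have rd' := ltW rd; apply: lerD => //; apply: ler_pM => //; exact: powR_ge0.
Qed.

Lemma pow_dist_max (x y z : C) :
  `|y - z| `^ eps <= 2 `^ eps * (Num.max `|y - x| `|z - x|) `^ eps.
Proof.
rewrite -powRM//; apply: powR_mono => //.
have -> : y - z = (y - x) - (z - x) :> C by ring.
apply: le_trans (ler_normB _ _) _; rewrite mulr_natl mulr2n.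
by apply: lerD; rewrite le_max lexx ?orbT.
Qed.

Definition near_M : R := d^-1 + 2 / d / (d / 2) `^ eps + (2 `^ eps + 1).

Let nearM_ge1 : 0 <= d^-1. Proof. by rewrite invr_ge0 ltW. Qed.
Let nearM_ge2 : 0 <= 2 / d / (d / 2) `^ eps.
Proof. by rewrite divr_ge0 ?powR_ge0// divr_ge0// ltW. Qed.

(** The perturbed map is compared with the given one through the Taylor remainder of
    their difference; the pieces need not be convex, so this remainder is not
    controlled by the differentials. *)
Lemma near_strict a x y z : Gt a x -> Gt a y -> Gt a z ->
  `|gt y - gt z - 'd gt x (y - z)| <= near_M * (Num.max `|y - x| `|z - x|) `^ eps * `|y - z|.
Proof.
move=> Gx Gy Gz; have [rho /andP[r0 rd] h] := near_C1.
set m := Num.max _ _; have m0 : 0 <= m by rewrite /m le_max normr_ge0.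
(* The remainder of the difference is based at [z]; moving the base point to [x]
   costs the Hoelder bound of its differential. *)
have -> : gt y - gt z - 'd gt x (y - z) =
  (g y - g z - 'd g x (y - z)) - (u y - u z - du z (y - z)) - (du z (y - z) - du x (y - z)).
  have E (p q k l i n o s : C) :
    p - q - k = (l - i - n) - ((l - p) - (i - q) - (o - s)) - ((o - s) - (n - k)) by ring.
  exact: E.
apply: le_trans (ler_normB _ _) _.
apply: le_trans (lerD (ler_normB _ _) (lexx _)) _.
rewrite /near_M mulrDl mulrDl; set n := `|y - z|.
have r1 : rho <= 1 by apply/ltW/(lt_le_trans rd).
rewrite -addrA; apply: lerD; last first.
  have [_ _ _ h4] := h a z Gz; have [_ _ h3 _] := h a z Gz.
  apply: le_trans (lerD (h4 y Gy) (h3 x (y - z) Gx)) _.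
  rewrite -/n -mulrDl; apply: ler_wpM2r; first exact: normr_ge0.
  rewrite mulrDl mul1r; apply: lerD.
    apply: le_trans (_ : 1 * `|z - y| `^ eps <= _); first by rewrite ler_wpM2r ?powR_ge0.
    by rewrite mul1r distrC; exact: pow_dist_max.
  apply: le_trans (_ : 1 * `|z - x| `^ eps <= _); first by rewrite ler_wpM2r ?powR_ge0.
  by rewrite mul1r; apply: powR_mono => //; rewrite /m le_max lexx orbT.
have [x0 G0 xx] := near_in_ball Gx; have [_ [_ _ t3] u3 u4] := ud G0.
have d4 : d / 4 < d by rewrite gtr_pMr// invf_lt1// ltr1n.
(* If one of the points is far from [x], the maximum is bounded below and
   Lipschitz bounds suffice. *)
have [md|dm] := ltP m (d / 2).
  have md2 : d / 2 + d / 4 <= d by lra.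
  have yx : `|y - x| < d / 2 by apply: le_lt_trans md; rewrite /m le_max lexx.
  have zx : `|z - x| < d / 2 by apply: le_lt_trans md; rewrite /m le_max lexx orbT.
  apply: le_trans (t3 x y z _ _ _) _.
  - exact: lt_trans xx d4.
  - by apply: lt_le_trans md2; apply: dist_sub_le yx (ltW xx).
  - by apply: lt_le_trans md2; apply: dist_sub_le zx (ltW xx).
  rewrite -/m -/n; apply: ler_wpM2r; first exact: normr_ge0.
  by apply: ler_wpM2r; [exact: powR_ge0|rewrite lerDl nearM_ge2].
have [y0 Gy0 yy] := near_in_ball Gy; have [z0 Gz0 zz] := near_in_ball Gz.
have [_ _ _ u4'] := ud Gy0.
have /andP[_ b1] := u4' z0 y z Gz0 (lt_trans yy d4) (lt_trans zz d4).
have /andP[_ b2] := u3 x (y - z) (lt_trans xx d4).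
apply: le_trans (ler_normB _ _) _; apply: le_trans (lerD b1 b2) _.
rewrite -mulrDl -/n; apply: ler_wpM2r; first exact: normr_ge0.
apply: le_trans (_ : 2 / d / (d / 2) `^ eps * m `^ eps <= _); last first.
  by rewrite ler_wpM2r ?powR_ge0// lerDr.
have p0 : 0 < (d / 2) `^ eps by rewrite powR_gt0// divr_gt0.
have -> : d^-1 + d^-1 = 2 / d by rewrite -mulr2n mulr_natl.
rewrite mulrAC ler_pdivlMr//; apply: ler_wpM2l; first by rewrite divr_ge0// ltW.
by apply: powR_mono => //; rewrite divr_ge0// ltW.
Qed.

Lemma near_holder a x y v : Gt a x -> Gt a y ->
  `|'d gt x v - 'd gt y v| <= near_M * `|x - y| `^ eps * `|v|.
Proof.
move=> Gx Gy; have [rho /andP[r0 rd] h] := near_C1.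
have -> : 'd gt x v - 'd gt y v = ('d g x v - 'd g y v) - (du x v - du y v).
  have E (p q k l : C) : p - q = (k - l) - ((k - p) - (l - q)) by ring.
  exact: E.
apply: le_trans (ler_normB _ _) _; rewrite /near_M mulrDl mulrDl.
have r1 : rho <= 1 by apply/ltW/(lt_le_trans rd).
set n := `|x - y|; have n0 : 0 <= n `^ eps by exact: powR_ge0.
apply: lerD; last first.
  have [_ _ h3 _] := h a x Gx; apply: le_trans (h3 y v Gy) _.
  rewrite ler_wpM2r// ler_wpM2r//; apply: le_trans r1 _.
  by rewrite lerDr powR_ge0.
have [x0 G0 xx] := near_in_ball Gx; have [_ [_ t2 _] u3 _] := ud G0.
have d4 : d / 4 < d by rewrite gtr_pMr// invf_lt1// ltr1n.
have [md|dm] := ltP n (d / 2).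
  apply: le_trans (t2 x y v (lt_trans xx d4) _) _.
    apply: lt_le_trans (_ : d / 2 + d / 4 <= _); last by lra.
    by apply: dist_sub_le (ltW xx); rewrite distrC.
  by rewrite -/n ler_wpM2r// ler_wpM2r// lerDl.
have [y0 Gy0 yy] := near_in_ball Gy; have [_ _ u3' _] := ud Gy0.
have /andP[_ b1] := u3 x v (lt_trans xx d4).
have /andP[_ b2] := u3' y v (lt_trans yy d4).
apply: le_trans (ler_normB _ _) _; apply: le_trans (lerD b1 b2) _.
rewrite -mulrDl ler_wpM2r//.
apply: le_trans (_ : 2 / d / (d / 2) `^ eps * n `^ eps <= _); last first.
  by rewrite ler_wpM2r// lerDr.
have p0 : 0 < (d / 2) `^ eps by rewrite powR_gt0// divr_gt0.
have -> : d^-1 + d^-1 = 2 / d by rewrite -mulr2n mulr_natl.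
rewrite mulrAC ler_pdivlMr//; apply: ler_wpM2l; first by rewrite divr_ge0// ltW.
by apply: powR_mono => //; rewrite divr_ge0// ltW.
Qed.

Lemma near_close a x y : Gt a x -> G a y -> `|x - y| < d ->
  `|gt x - g y| <= delta + d^-1 * `|x - y| /\
  forall v, `|'d gt x v - 'd g y v| <= (delta + d^-1 * `|x - y| `^ eps) * `|v|.
Proof.
move=> Gx Gy xy; have [rho /andP[r0 rd] h] := near_C1.
have yy : `|y - y| < d by rewrite subrr normr0.
have [h1 h2 _ _] := h a x Gx; have [_ [_ t2 _] _ u4] := ud Gy.
split.
  have -> : gt x - g y = - u x + (g x - g y).
    have E (p q k : C) : p - q = - (k - p) + (k - q) by ring.
    exact: E.
  apply: le_trans (ler_normD _ _) _; rewrite normrN; apply: lerD.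
    by apply: le_trans h1 _; exact: ltW.
  by have /andP[] := u4 y x y Gy xy yy.
move=> v; have -> : 'd gt x v - 'd g y v = - du x v + ('d g x v - 'd g y v).
  have E (p q k : C) : p - q = - (k - p) + (k - q) by ring.
  exact: E.
apply: le_trans (ler_normD _ _) _; rewrite normrN mulrDl; apply: lerD.
  by apply: le_trans (h2 v) _; rewrite ler_wpM2r// ltW.
exact: t2.
Qed.

Variables (r : R) (N : nat) (p : 'I_N -> C).
Hypothesis hp : forall x, pieces K x -> exists i, `|x - p i| < d / 2 * r / 4.
Hypotheses (r0 : 0 < r) (rd4 : r <= d / 4) (hr : d^-1 * r `^ eps <= (mu0 - 1) / 4).
Hypotheses (hd1 : delta * near_lip <= d / 2) (hd2 : delta * near_lip <= (mu0 - 1) / 4)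
  (hd3 : delta <= (mu0 - 1) / 4) (hd4 : delta <= d / 2 * r / 4).

(** The lower bounds survive a perturbation that is Lipschitz small, with half of
    the margin. *)
Lemma nearby_controlled :
  controlled N (1 + (mu0 - 1) / 2) (d / 2) r near_M Kt.
Proof.
have d4 : d / 4 < d by rewrite gtr_pMr// invf_lt1// ltr1n.
split => //.
- by rewrite ltrDl divr_gt0// subr_gt0.
- by rewrite divr_gt0.
- by rewrite !addr_ge0// powR_ge0.
- move=> a y z Gy Gz.
  have [y0 Gy0 yy] := near_in_ball Gy; have [z0 Gz0 zz] := near_in_ball Gz.
  have [_ _ _ u4'] := ud Gy0.
  have /andP[b1 _] := u4' z0 y z Gz0 (lt_trans yy d4) (lt_trans zz d4).
  have b2 := near_lipschitz Gz Gy.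
  have b3 := norm_le_sub (g y - g z) (gt y - gt z).
  have b3' : gt y - gt z - (g y - g z) = - (u y - u z).
    have E (v q k l : C) : v - q - (k - l) = - ((k - v) - (l - q)) by ring.
    exact: E.
  rewrite b3' normrN in b3.
  have b4 : delta * near_lip * `|y - z| <= d / 2 * `|y - z| by rewrite ler_wpM2r.
  have b5 := le_trans b3 (lerD (le_trans b2 b4) (lexx _)).
  have b6 := le_trans b1 b5; move: b6; set n := `|y - z|; set m := `|gt y - gt z|.
  by rewrite -lerBlDl; apply: le_trans; rewrite -mulrBl; apply: ler_wpM2r; [exact: normr_ge0|lra].
- move=> a y z Gy Gz yz.
  have [y0 Gy0 yy] := near_in_ball Gy; have [_ [_ _ t3] u3 _] := ud Gy0.
  have zy0 : `|z - y0| < d.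
    apply: lt_le_trans (_ : d / 4 + d / 4 <= _); last by lra.
    by apply: dist_sub_le (ltW yy); rewrite distrC (lt_le_trans yz).
  have b1 := t3 y y z (lt_trans yy d4) (lt_trans yy d4) zy0.
  have b1' : `|g y - g z - 'd g y (y - z)| <= (mu0 - 1) / 4 * `|y - z|.
    apply: le_trans b1 _; rewrite ler_wpM2r//; apply: le_trans hr.
    rewrite ler_wpM2l//; apply: powR_mono; rewrite ?powR_max_ge0//.
    by rewrite subrr normr0 ge_max (ltW r0) distrC ltW.
  have /andP[b2 _] := u3 y (y - z) (lt_trans yy d4).
  have b3 := near_lipschitz Gz Gy.
  have b3' := le_trans b3 (ler_wpM2r (normr_ge0 (y - z)) hd2).
  have b4 := norm_le_sub ('d g y (y - z)) (gt y - gt z).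
  have b5 : `|gt y - gt z - 'd g y (y - z)| <= `|g y - g z - 'd g y (y - z)| + `|u y - u z|.
    have -> : gt y - gt z - 'd g y (y - z) = (g y - g z - 'd g y (y - z)) - (u y - u z).
      have E (v q k l o : C) : v - q - o = (k - l - o) - ((k - v) - (l - q)) by ring.
      exact: E.
    exact: ler_normB.
  have b6 := le_trans b2 (le_trans b4 (lerD (le_trans b5 (lerD b1' b3')) (lexx _))).
  move: b6; set n := `|y - z|; set m := `|gt y - gt z|.
  by rewrite -lerBlDl; apply: le_trans; rewrite -mulrDl -mulrBl; apply: ler_wpM2r; [exact: normr_ge0|lra].
- exact: near_strict.
- move=> a x v Gx; have [rho /andP[q0 rd] h] := near_C1.
  have [_ h2 _ _] := h a x Gx.
  have [x0 Gx0 xx] := near_in_ball Gx; have [_ _ u3 _] := ud Gx0.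
  have /andP[b2 _] := u3 x v (lt_trans xx d4).
  have b4 := norm_le_sub ('d g x v) ('d gt x v); rewrite distrC in b4.
  have b6 := le_trans b2 (le_trans b4 (lerD (h2 v) (lexx _))).
  move: b6; set n := `|v|; set m := `|'d gt x v|.
  rewrite -lerBlDl; apply: le_trans; rewrite -mulrBl.
  by apply: ler_wpM2r; [exact: normr_ge0|move: rd hd3 mu01; lra].
- exact: near_holder.
exists (fun i => [set x | `|x - p i| < d / 2 * r / 2]); split.
  move=> a y Gy; have [y0 Gy0 yy] := near_piece Gy.
  have [i hi] := hp (ex_intro _ a Gy0); exists i => /=.
  apply: lt_le_trans (_ : d / 2 * r / 4 + d / 2 * r / 4 <= _); last by lra.
  by apply: dist_sub_le (ltW hi); exact: lt_le_trans yy hd4.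
move=> i y z /= yp zp.
have -> : d / 2 * r = d / 2 * r / 2 + d / 2 * r / 2 by lra.
by apply: dist_sub_le yp _; rewrite distrC ltW.
Qed.

End OneNearby.

End NearbySystems.

(** * Neighbourhoods, itineraries and shadowing *)

Section Neighbourhoods.
Context {R : realType} {eps : R} {A : finType} {B : rel A}.
Hypothesis eps0 : 0 < eps.
Local Notation C := (Rcomplex R).
Implicit Types K : Omega eps B.

Lemma Omega_nbhd_le K (d d' : R) : d' <= d -> Omega_nbhd K d' `<=` Omega_nbhd K d.
Proof.
move=> dd' Kt [h1 h2 [rho /andP[r0 rd] h3]].
have th (S S' : set C) : S `<=` thickening d' S' -> S `<=` thickening d S'.
  by move=> h z /h[w Sw zw]; exists w => //; exact: lt_le_trans zw dd'.
split=> [a|a|]; [exact: th|exact: th|].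
by exists rho => //; rewrite r0 (lt_le_trans rd).
Qed.

Lemma Omega_nbhd_refl K (d : R) : 0 < d -> Omega_nbhd K d K.
Proof.
move=> d0; have th (S : set C) : S `<=` thickening d S.
  by move=> z Sz; exists z => //; rewrite subrr normr0.
split => //; exists 0; first by rewrite lexx.
move=> x _; split.
- by rewrite subrr normr0.
- by move=> v; rewrite subrr normr0 mul0r.
- by move=> y v _; rewrite !subrr normr0 !mul0r.
- by move=> y _; rewrite !subrr normr0 !mul0r.
Qed.

Lemma Omega_nbhd_nbhs K (d : R) : 0 < d -> nbhs K (Omega_nbhd K d).
Proof.
move=> d0; exists (Omega_nbhd K d); split => //; last exact: Omega_nbhd_refl.
exists [set Omega_nbhd K d]; last first.
  by rewrite predeqE => Kt; split=> [[_ ->]|h] //; exists (Omega_nbhd K d).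
move=> _ ->; apply: (@finI_from1 _ _ _ id).
by exists K, d.
Qed.

Lemma near_controlled K : exists N mu kap r M, exists2 delta : R, 0 < delta &
  forall Kt, Omega_nbhd K delta Kt -> controlled N mu kap r M Kt.
Proof.
have [mu0 mu01 [d d0 ud]] := uniform_data_exists eps0 K.
have [b b0 hb] := pieces_bounded K.
have gap : 0 < (mu0 - 1) / 4 by rewrite divr_gt0// subr_gt0.
have [r1 r10 hr1] := powR_small eps0 (mulr_gt0 gap d0).
pose r := Num.min (d / 4) r1.
have r0 : 0 < r by rewrite lt_min r10 divr_gt0.
have hr : d^-1 * r `^ eps <= (mu0 - 1) / 4.
  by rewrite mulrC ler_pdivrMr//; apply: hr1; rewrite ltW//= ge_min lexx orbT.
have dr0 : 0 < d / 2 * r / 4 by rewrite divr_gt0// mulr_gt0// divr_gt0.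
have [N [p hp]] := compact_cover_balls (@pieces_compact R eps A B K) dr0.
have l0 : 0 < near_lip (eps := eps) b by rewrite ltr_pwDl// powR_ge0.
pose delta := Num.min (Num.min 1 (d / 4)) (Num.min (d / 2 * r / 4)
  (Num.min ((mu0 - 1) / 4) (Num.min (d / 2 / near_lip (eps := eps) b)
  ((mu0 - 1) / 4 / near_lip (eps := eps) b)))).
have d20 : 0 < d / 2 by rewrite divr_gt0.
have d40 : 0 < d / 4 by rewrite divr_gt0.
have delta0 : 0 < delta by rewrite !lt_min ltr01 d40 gap dr0 (divr_gt0 d20 l0) (divr_gt0 gap l0).
exists N, (1 + (mu0 - 1) / 2), (d / 2), r, (near_M (eps := eps) d), delta => // Kt near.
apply: (nearby_controlled eps0 mu01 d0 ud hb near _ _ hp r0 _ hr).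
- by rewrite !ge_min lexx.
- by rewrite !ge_min lexx orbT.
- by rewrite ge_min lexx.
- by rewrite -ler_pdivlMr// !ge_min lexx !orbT.
- by rewrite -ler_pdivlMr// !ge_min lexx !orbT.
- by rewrite !ge_min lexx !orbT.
- by rewrite !ge_min lexx !orbT.
Qed.

Lemma near_close_eps K (e : R) : 0 < e -> exists2 delta : R, 0 < delta &
  forall Kt, Omega_nbhd K delta Kt -> forall a x y, piece Kt a x -> piece K a y ->
    `|x - y| < delta -> `|cmap Kt x - cmap K y| < e /\
      forall v, `|'d (cmap Kt) x v - 'd (cmap K) y v| <= e * `|v|.
Proof.
move=> e0.
have [mu0 mu01 [d d0 ud]] := uniform_data_exists eps0 K.
have [b b0 hb] := pieces_bounded K.
have e2 : 0 < e / 2 by rewrite divr_gt0.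
have [t t0 ht] := powR_small eps0 (mulr_gt0 e2 d0).
pose delta := Num.min (Num.min 1 (d / 4)) (Num.min t (Num.min (e / 4) (e / 4 * d))).
have e4 : 0 < e / 4 by rewrite divr_gt0.
have d40 : 0 < d / 4 by rewrite divr_gt0.
have ed4 : 0 < e / 4 * d by rewrite mulr_gt0.
have delta0 : 0 < delta by rewrite !lt_min ltr01 t0 e4 d40 ed4.
exists delta => // Kt near a x y Gx Gy xy.
have d1 : delta <= 1 by rewrite !ge_min lexx.
have d4 : delta <= d / 4 by rewrite !ge_min lexx orbT.
have xyd : `|x - y| < d.
  by apply: lt_le_trans xy (le_trans d4 _); rewrite ler_pdivrMr// ler_peMr ?(ltW d0)// ler1n.
have [h1 h2] := near_close eps0 d0 ud near d4 Gx Gy xyd.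
have de : delta <= e / 4 by rewrite !ge_min lexx !orbT.
have ded : delta <= e / 4 * d by rewrite !ge_min lexx !orbT.
split.
  apply: le_lt_trans h1 _; apply: le_lt_trans (_ : e / 4 + e / 4 < _); last by lra.
  apply: lerD => //; rewrite mulrC ler_pdivrMr//.
  by apply: le_trans (ltW xy) _.
move=> v; apply: le_trans (h2 v) _; rewrite ler_wpM2r// [leRHS]splitr.
apply: lerD; first by apply: le_trans de _; lra.
rewrite mulrC ler_pdivrMr//; apply: ht; rewrite normr_ge0 /=.
by apply: le_trans (ltW xy) _; rewrite !ge_min lexx orbT.
Qed.

End Neighbourhoods.

Section Pasts.
Context {A : finType} {B : rel A}.

Lemma cylinder_open (n : nat) (a : A) :
  open [set s : {ptws nat -> discrete_topology A} | s n = a].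
Proof.
pose f : {ptws nat -> discrete_topology A} -> discrete_topology A := fun s => s n.
have cf : continuous f by exact: (@proj_continuous nat (fun=> discrete_topology A) n).
have := @open_comp _ _ f [set a : discrete_topology A] (fun s _ => cf s).
by apply; exact: discrete_open.
Qed.

(** A future that passes through [b] at a positive time exists, by mixing. *)
Lemma mixing_pred (b : A) (t : nat -> A) : topologically_mixing B ->
  subshift B t -> t 0%N = b -> exists a', B a' b.
Proof.
move=> mix Bt tb.
have [||||n hn] := mix setT [set u | u 0%N = b].
- exact: openT.
- exact: cylinder_open.
- by exists t.
- by exists t.
have [u [Bu _ /= un]] := hn n.+1 (leqnSn n).
by exists (u n); rewrite -un addn0; exact: Bu.
Qed.

(** Beyond the word the past is continued by arbitrary predecessors. *)
Lemma past_of_word (s : nat -> A) k : (forall b, exists a, B a b) ->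
  (forall n, B (s n) (s n.+1)) -> exists theta : past B,
    forall j, (j <= k)%N -> pastE theta j = s (k - j)%N.
Proof.
move=> /choice[p hp] Bs.
pose t j := if (j <= k)%N then s (k - j)%N else iter (j - k) p (s 0%N).
have Bt n : B (t n.+1) (t n).
  rewrite /t; have [nk|kn] := ltnP n k.
    by rewrite (ltnW nk); have := Bs (k - n.+1)%N; rewrite -subSn// subSS.
  case: (eqVneq n k) => [->|nk]; first by rewrite leqnn subnn subSn// subnn /=.
  have lt : (k < n)%N by rewrite ltn_neqAle eq_sym nk.
  by rewrite leqNgt lt /= subSn ?(ltnW lt)//=.
exists (exist _ (t : {ptws nat -> discrete_topology A}) (mem_set Bt)) => j jk.
by rewrite /pastE /= /t jk.
Qed.

End Pasts.

Section Shadowing.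
Context {R : realType} {eps : R} {A : finType} {B : rel A}.
Hypothesis eps0 : 0 < eps.
Local Notation C := (Rcomplex R).

Section OneSystem.
Context (N : nat) (mu kap r M : R) (K : Omega eps B) (ct : controlled N mu kap r M K).
Hypothesis hpred : forall b, exists a, B a b.
Local Notation G := (piece K).
Local Notation g := (cmap K).

Lemma itinerary_exists x a : cantor_set K x -> G a x ->
  exists s : nat -> A, [/\ s 0%N = a, forall n, B (s n) (s n.+1) &
    forall n, G (s n) (iter n g x)].
Proof.
move=> Kx Gx; have [s hs] := choice Kx.
have s0 : s 0%N = a.
  apply/eqP/negPn/negP => ne.
  have : (G (s 0%N) `&` G a) x by split => //; exact: hs 0%N.
  by rewrite (piece_disjoint (Omega_axioms K) ne).
exists s; split => // n; apply/negPn/negP => nB.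
have : (G (s n.+1) `&` g @` G (s n)) (iter n.+1 g x).
  by split; [exact: hs|exists (iter n g x)].
by rewrite (markov_out (Omega_axioms K) nB).
Qed.

Lemma back_past (theta : past B) s k z : (forall j, (j <= k)%N -> pastE theta j = s (k - j)%N) ->
  back K theta k z = word_map K (mkseq s k.+1) z.
Proof.
move=> h; rewrite /back /past_word; congr (word_map K _ z).
apply: (@eq_from_nth _ (s 0%N)) => [|i]; rewrite size_rev !size_mkseq// => ik.
rewrite nth_rev size_mkseq// !nth_mkseq//; last by rewrite ltn_subrL.
by rewrite subSS h ?leq_subr// subKn.
Qed.

Lemma word_back_diam s k y z : (forall n, B (s n) (s n.+1)) ->
  G (s k) y -> G (s k) z ->
  `|word_map K (mkseq s k.+1) y - word_map K (mkseq s k.+1) z| <= diam_const N kap r * mu^-1 ^+ k.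
Proof.
move=> Bs Gy Gz; have [theta ht] := past_of_word k hpred Bs.
rewrite -!(back_past _ ht); apply: (back_diam ct); by rewrite ht// subn0.
Qed.

Lemma word_map_rcons w a b z :
  word_map K (rcons (rcons w a) b) z = word_map K (rcons w a) (branch K a z).
Proof.
elim: w => [//|c w IH] /=.
by case: w IH => [|d w] IH //; congr (branch K c _); exact: IH.
Qed.

Lemma itinerary_word_in s k z : (forall n, B (s n) (s n.+1)) -> G (s k) z ->
  G (s 0%N) (word_map K (mkseq s k.+1) z).
Proof.
move=> Bs Gz; have [theta ht] := past_of_word k hpred Bs.
rewrite -(back_past _ ht) -[s 0%N]/(s 0%N) -(subnn k) -ht//.
by apply: back_in; rewrite ht// subn0.
Qed.

Lemma mkseq_cons (s : nat -> A) k :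
  mkseq s k.+1 = s 0%N :: mkseq (fun n => s n.+1) k.
Proof. by rewrite /mkseq /= (iotaDl 1 0 k) -map_comp. Qed.

Lemma word_cons s k z :
  word_map K (mkseq s k.+2) z = branch K (s 0%N) (word_map K (mkseq (fun n => s n.+1) k.+1) z).
Proof. by rewrite mkseq_cons mkseq_cons. Qed.

Lemma word_orbit s k x : (forall n, B (s n) (s n.+1)) ->
  (forall n, G (s n) (iter n g x)) -> word_map K (mkseq s k.+1) (iter k g x) = x.
Proof.
move=> + hx; elim: k s x hx => [//|k IH] s x hx Bs.
have hx' n : G (s n.+1) (iter n g (g x)) by rewrite -iterSr; exact: hx.
rewrite word_cons iterSr (IH _ _ hx' (fun n => Bs n.+1)).
exact: (branch_unique (Bs 0%N) (hx' 0%N) (hx 0%N)).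
Qed.

(** The limit of the points obtained by pulling points of the pieces back along
    longer and longer prefixes of the itinerary. *)
Lemma shadow_exists s : (forall n, B (s n) (s n.+1)) ->
  exists x, forall n, G (s n) (iter n g x).
Proof.
have ex (a : A) : exists x : C, G a x by exact: piece_nonempty (Omega_axioms K) a.
have [p hp] := choice ex.
pose h (s : nat -> A) k : C := word_map K (mkseq s k.+1) (p (s k)).
pose X (s : nat -> A) : C := lim (h s k @[k --> \oo]).
have mu0 : 0 < mu by exact: lt_trans (ctrl_mu ct).
have imu : 0 <= mu^-1 < 1 by rewrite invr_ge0 (ltW mu0) invf_lt1// (ctrl_mu ct).
have Bin (s' : nat -> A) k : (forall n, B (s' n) (s' n.+1)) -> G (s' 0%N) (h s' k).
  by move=> Bs; exact: itinerary_word_in.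
have cX (s' : nat -> A) : (forall n, B (s' n) (s' n.+1)) -> h s' k @[k --> \oo] --> X s'.
  move=> Bs.
  have step k : `|h s' k.+1 - h s' k| <= diam_const N kap r * mu^-1 ^+ k.
    rewrite /h [mkseq s' k.+2]mkseqS [X in rcons X]mkseqS word_map_rcons -mkseqS.
    apply: word_back_diam => //.
    by have [] := branchP (K := K) (Bs k) (hp (s' k.+1)).
  have [l ul _] := geo_cvg (diam_const_ge0 ct) imu step.
  by apply/cvg_ex; exists l.
have GX (s' : nat -> A) : (forall n, B (s' n) (s' n.+1)) -> G (s' 0%N) (X s').
  move=> Bs; have cl : closed (G (s' 0%N)).
    apply: compact_closed; first exact: norm_hausdorff.
    exact: (@piece_compact _ _ _ _ _ _ _ (Omega_axioms K) (s' 0%N)).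
  have nr : \forall k \near \oo, G (s' 0%N) (h s' k) by apply: nearW => k; exact: Bin.
  exact: (closed_cvg _ cl nr _ (cX _ Bs)).
have gX (s' : nat -> A) : (forall n, B (s' n) (s' n.+1)) -> g (X s') = X (fun n => s' n.+1).
  move=> Bs; have Bs' n : B (s' n.+1) (s' n.+2) by exact: Bs.
  have cg : {for X s', continuous g}.
    apply: (C1eps_continuous (map_C1eps (Omega_axioms K))).
    exact: piece_dom (Omega_axioms K) _ _ (GX _ Bs).
  have h1 : h s' k.+1 @[k --> \oo] --> X s' by rewrite cvg_shiftS; exact: cX.
  have h2 : g (h s' k.+1) @[k --> \oo] --> g (X s') by exact: (continuous_cvg _ cg h1).
  apply: (cvgC_unique h2).
  suff -> : (fun k => g (h s' k.+1)) = h (fun n => s' n.+1) by exact: cX.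
  apply/funext => k; rewrite /h word_cons.
  by have [] := branchP (K := K) (Bs 0%N) (itinerary_word_in (s := fun n => s' n.+1) Bs' (hp (s' k.+1))).
move=> Bs; exists (X s) => n.
suff -> : iter n g (X s) = X (fun k => s (k + n)%N).
  by have := GX (fun k => s (k + n)%N) (fun k => Bs (k + n)%N); rewrite add0n.
elim: n => [|n IH]; first by congr X; apply/funext => k; rewrite addn0.
rewrite iterS IH gX; first by congr X; apply/funext => k; rewrite addSnnS.
by move=> k; exact: Bs.
Qed.

Lemma itinerary_cantor s x : (forall n, G (s n) (iter n g x)) -> cantor_set K x.
Proof. by move=> hx n; exists (s n). Qed.

End OneSystem.
End Shadowing.

(** * Continuity of limit geometries in the Cantor set *)

Section Closeness.
Context {R : realType} {eps : R} {A : finType} {B : rel A}.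
Hypothesis eps0 : 0 < eps.
Local Notation C := (Rcomplex R).

Lemma prod_close (b e : R) : 0 <= b -> 0 < e -> exists2 eta : R, 0 < eta &
  forall x x' y y' : C, `|x'| <= b -> `|y'| <= b -> `|x - x'| < eta -> `|y - y'| < eta ->
    `|x * y - x' * y' : C| < e.
Proof.
move=> b0 e0; have b2 : 0 < 2 * b + 2 by rewrite ltr_wpDl// mulr_ge0.
exists (Num.min 1 (e / (2 * b + 2))); first by rewrite lt_min ltr01 divr_gt0.
move=> x x' y y' hx' hy'; set eta := Num.min _ _ => hx hy.
have eta1 : eta <= 1 by rewrite ge_min lexx.
have etae : eta * (2 * b + 2) <= e by rewrite -ler_pdivlMr// ge_min lexx orbT.
have eta0 : 0 < eta by apply: le_lt_trans hx.
have -> : x * y - x' * y' = (x - x') * y' + x' * (y - y') + (x - x') * (y - y') by ring.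
apply: le_lt_trans (ler_normD _ _) _; rewrite cnormM.
apply: le_lt_trans (lerD (ler_normD _ _) (lexx _)) _; rewrite !cnormM.
apply: lt_le_trans etae.
apply: le_lt_trans (_ : eta * b + b * eta + eta * 1 < _); last first.
  by rewrite -subr_gt0 (_ : _ - _ = eta)//; ring.
apply: lerD; first by apply: lerD; apply: ler_pM => //; exact: ltW.
by apply: ler_pM => //; [exact: ltW|exact/ltW/(lt_le_trans hy)].
Qed.

Context (K : Omega eps B) (N : nat) (mu kap r M delta0 : R).
Hypotheses (delta00 : 0 < delta0)
  (hct : forall Kt, Omega_nbhd K delta0 Kt -> controlled N mu kap r M Kt).
Local Notation G := (piece K).
Local Notation g := (cmap K).
Local Notation q := (dist_rate (eps := eps) mu).
Local Notation A1 := (strict_const1 (eps := eps) N kap r M).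

Lemma ctK : controlled N mu kap r M K.
Proof. exact/hct/Omega_nbhd_refl. Qed.

Let q01 : 0 <= q < 1 := dist_rate01 eps0 ctK.

Definition agree (n : nat) (u theta : past B) : Prop :=
  forall j, (j <= n)%N -> pastE u j = pastE theta j.

Lemma agree_le n m u theta : (m <= n)%N -> agree n u theta -> agree m u theta.
Proof. by move=> mn h j jm; apply: h; exact: leq_trans mn. Qed.

(** The objects attached to a nearby system converge uniformly; since the pieces
    themselves move, points of the two systems are compared instead of functions
    on a common domain. *)
Lemma back_close n (e : R) : 0 < e -> exists2 delta : R, 0 < delta &
  forall Kt, Omega_nbhd K delta Kt -> forall u theta, agree n u theta ->
  forall x y, piece Kt (pastE u 0) x -> G (pastE theta 0) y -> `|x - y| < delta ->
    `|back Kt u n x - back K theta n y| < e.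
Proof.
elim: n e => [|n IH] e e0; first by exists e => // Kt _ u theta _ x y _ _; rewrite !back0.
have kap0 := ctrl_kap ctK.
have e10 : 0 < kap * e / 4 by rewrite divr_gt0// mulr_gt0.
set e1 := kap * e / 4 in e10.
have [d1 d10 h1] := IH e1 e10.
have [d2 d20 h2] := near_close_eps eps0 K e10.
pose d := Num.min (Num.min delta0 (e / 2)) (Num.min d1 d2).
have d0 : 0 < d by rewrite !lt_min delta00 d10 d20 divr_gt0.
have l0 : d <= delta0 by rewrite !ge_min lexx.
have l1 : d <= d1 by rewrite !ge_min lexx !orbT.
have l2 : d <= d2 by rewrite !ge_min lexx !orbT.
have le2 : d <= e / 2 by rewrite !ge_min lexx !orbT.
exists d => // Kt near u theta ag x y Gx Gy xy.
have ctt := hct (Omega_nbhd_le l0 near).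
have XY := h1 Kt (Omega_nbhd_le l1 near) u theta (agree_le (leqnSn n) ag) x y Gx Gy (lt_le_trans xy l1).
set X' := back Kt u n.+1 x; set Y' := back K theta n.+1 y.
have GX : piece Kt (pastE theta n.+1) X' by rewrite -ag//; exact: back_in.
have GY : G (pastE theta n.+1) Y' by exact: back_in.
have [Q GQ QY] := piece_near near GY.
have [gQ _] := h2 Kt (Omega_nbhd_le l2 near) _ _ _ GQ GY (lt_le_trans QY l2).
have hk := ctrl_lower ctt GX GQ.
have gX : cmap Kt X' = back Kt u n x by exact: back_g.
have gY : g Y' = back K theta n y by exact: back_g.
have h3 : `|X' - Q| < e / 2.
  have e2 : kap * `|X' - Q| < kap * (e / 2).
    apply: le_lt_trans hk _; rewrite gX.
    have -> : back Kt u n x - cmap Kt Q =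
      (back Kt u n x - back K theta n y) - (cmap Kt Q - g Y') by rewrite gY; ring.
    apply: le_lt_trans (ler_normB _ _) _; apply: lt_le_trans (ltrD XY gQ) _.
    by rewrite /e1 le_eqVlt; apply/orP; left; apply/eqP; field.
  by rewrite ltr_pM2l// in e2.
rewrite [e]splitr; apply: dist_sub_le h3 _.
by apply: le_trans (ltW QY) _.
Qed.

Lemma mult_close n (e : R) : 0 < e -> exists2 delta : R, 0 < delta &
  forall Kt, Omega_nbhd K delta Kt -> forall u theta, agree n u theta ->
  forall x y, piece Kt (pastE u 0) x -> G (pastE theta 0) y -> `|x - y| < delta ->
    `|mult Kt (back Kt u n x) - mult K (back K theta n y)| < e.
Proof.
move=> e0; have e20 : 0 < e / 2 by rewrite divr_gt0.
have [d1 d10 h1] := near_close_eps eps0 K e20.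
have [d2 d20 h2] := back_close n d10.
exists (Num.min d1 d2) => [|Kt near u theta ag x y Gx Gy]; first by rewrite lt_min d10.
rewrite lt_min => /andP[_ xy].
have l1 : Num.min d1 d2 <= d1 by rewrite ge_min lexx.
have l2 : Num.min d1 d2 <= d2 by rewrite ge_min lexx orbT.
have XY := h2 Kt (Omega_nbhd_le l2 near) u theta ag x y Gx Gy xy.
have GX : piece Kt (pastE theta n) (back Kt u n x) by rewrite -ag//; exact: back_in.
have [_ h] := h1 Kt (Omega_nbhd_le l1 near) _ _ _ GX (back_in n Gy) XY.
by apply: le_lt_trans (h (1 : C)) _; rewrite cnorm1 mulr1 gtr_pMr// invf_lt1// ltr1n.
Qed.

Lemma mult_bounded : exists2 b : R, 1 <= b & forall a x, G a x -> `|mult K x| <= b.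
Proof.
have KO := Omega_axioms K.
have [b b0 hb] := diff_bound_compact eps0 (dom_open KO) (map_C1eps KO)
  (@pieces_compact R eps A B K) (@pieces_dom R eps A B K).
exists (b + 1) => [|a x Gx]; first by rewrite lerDr ltW.
apply: le_trans (hb x (ex_intro _ a Gx) (1 : C)) _.
by rewrite cnorm1 mulr1 lerDl.
Qed.

Lemma dmul_bounded n : exists2 b : R, 0 <= b & forall theta x, G (pastE theta 0) x ->
  `|dmul K theta x n| <= b.
Proof.
have [b b1 hb] := mult_bounded; have b0 : 0 <= b by exact: le_trans b1.
exists (b ^+ n); first by rewrite exprn_ge0.
move=> theta x Gx; elim: n => [|n IH]; first by rewrite /dmul big_ord0 cnorm1.
rewrite /dmul big_ord_recr /= cnormM exprSr; apply: ler_pM => //.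
exact: (hb _ _ (back_in n.+1 Gx)).
Qed.

Lemma dmul_close n (e : R) : 0 < e -> exists2 delta : R, 0 < delta &
  forall Kt, Omega_nbhd K delta Kt -> forall u theta, agree n u theta ->
  forall x y, piece Kt (pastE u 0) x -> G (pastE theta 0) y -> `|x - y| < delta ->
    `|dmul Kt u x n - dmul K theta y n| < e.
Proof.
elim: n e => [|n IH] e e0.
  by exists 1 => // Kt _ u theta _ x y _ _ _; rewrite /dmul !big_ord0 subrr normr0.
have [b1 b10 hb1] := dmul_bounded n; have [b2 b21 hb2] := mult_bounded.
have b0 : 0 <= Num.max b1 b2 by rewrite le_max b10.
have [eta eta0 heta] := prod_close b0 e0.
have [d1 d10 h1] := IH eta eta0; have [d2 d20 h2] := mult_close n.+1 eta0.
exists (Num.min d1 d2) => [|Kt near u theta ag x y Gx Gy]; first by rewrite lt_min d10.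
rewrite lt_min => /andP[xy1 xy2].
have l1 : Num.min d1 d2 <= d1 by rewrite ge_min lexx.
have l2 : Num.min d1 d2 <= d2 by rewrite ge_min lexx orbT.
rewrite /dmul !big_ord_recr /=; apply: heta.
- by rewrite le_max hb1.
- by rewrite le_max (hb2 _ _ (back_in n.+1 Gy)) orbT.
- exact: h1 (Omega_nbhd_le l1 near) _ _ (agree_le (leqnSn n) ag) _ _ Gx Gy xy1.
- exact: h2 (Omega_nbhd_le l2 near) _ _ ag _ _ Gx Gy xy2.
Qed.

Lemma incr_close n (e : R) : 0 < e -> exists2 delta : R, 0 < delta &
  forall Kt, Omega_nbhd K delta Kt -> forall u theta, agree n u theta ->
  forall x y x1 y1 x2 y2, piece Kt (pastE u 0) x -> G (pastE theta 0) y ->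
    piece Kt (pastE u 0) x1 -> G (pastE theta 0) y1 ->
    piece Kt (pastE u 0) x2 -> G (pastE theta 0) y2 ->
    `|x - y| < delta -> `|x1 - y1| < delta -> `|x2 - y2| < delta ->
    `|incr Kt u x x1 x2 n - incr K theta y y1 y2 n| < e.
Proof.
move=> e0; have [b1 b10 hb1] := dmul_bounded n.
have [b2 b20 hb2] := pieces_bounded K.
have b0 : 0 <= Num.max b1 (b2 + b2) by rewrite le_max b10.
have [eta eta0 heta] := prod_close b0 e0.
have eta2 : 0 < eta / 2 by rewrite divr_gt0.
have [d1 d10 h1] := dmul_close n eta0; have [d2 d20 h2] := back_close n eta2.
exists (Num.min d1 d2) => [|Kt near u theta ag x y x1 y1 x2 y2 Gx Gy Gx1 Gy1 Gx2 Gy2].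
  by rewrite lt_min d10.
rewrite !lt_min => /andP[xy _] /andP[_ xy1] /andP[_ xy2].
have l1 : Num.min d1 d2 <= d1 by rewrite ge_min lexx.
have l2 : Num.min d1 d2 <= d2 by rewrite ge_min lexx orbT.
apply: heta.
- by rewrite le_max hb1.
- rewrite le_max; apply/orP; right; apply: le_trans (ler_normB _ _) _.
  by apply: lerD; apply: hb2; exists (pastE theta n); exact: back_in.
- exact: h1 (Omega_nbhd_le l1 near) _ _ ag _ _ Gx Gy xy.
- have c1 := h2 _ (Omega_nbhd_le l2 near) _ _ ag _ _ Gx1 Gy1 xy1.
  have c2 := h2 _ (Omega_nbhd_le l2 near) _ _ ag _ _ Gx2 Gy2 xy2.
  have E (p k s t : C) : p - k - (s - t) = (p - s) - (k - t) by ring.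
  rewrite E [eta]splitr; apply: le_lt_trans (ler_normB _ _) _; exact: ltrD.
Qed.

Context (c : A -> C) (hc : base_points K c).

Definition base_near (Kt : Omega eps B) (ct : A -> C) (delta : R) : Prop :=
  base_points Kt ct /\ forall a, `|ct a - c a| < delta.

(** The error of truncating at depth [n] is uniform over the controlled systems, and
    the truncations only involve [n] letters and [n] iterates. *)
Lemma kfun_close (e : R) : 0 < e -> exists n, exists2 delta : R, 0 < delta &
  forall Kt ct, Omega_nbhd K delta Kt -> base_near Kt ct delta ->
  forall u theta, agree n u theta ->
  forall x y, piece Kt (pastE u 0) x -> G (pastE theta 0) y -> `|x - y| < delta ->
    `|kfun Kt ct u x - kfun K c theta y| < e.
Proof.
move=> e0; have A10 := strict_const1_ge0 (eps := eps) ctK.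
have gK := geo_rate_ge0 A10 q01; have D0 := diam_const_ge0 ctK.
have e40 : 0 < e / 4 by rewrite divr_gt0.
have X0 : 0 < geo_rate A1 q * diam_const N kap r + 1 by rewrite ltr_wpDl// mulr_ge0.
have [n hn] := expr_lt_exists q01 (divr_gt0 e40 X0).
have [d1 d10 h1] := incr_close n e40.
exists n, (Num.min delta0 d1) => [|Kt ct near [hct' cc] u theta ag x y Gx Gy].
  by rewrite lt_min delta00.
rewrite lt_min => /andP[_ xy].
have l0 : Num.min delta0 d1 <= delta0 by rewrite ge_min lexx.
have l1 : Num.min delta0 d1 <= d1 by rewrite ge_min lexx orbT.
have ctt := hct (Omega_nbhd_le l0 near).
have Gc := base_piece hct' (pastE u 0); have Gc' := base_piece hc (pastE theta 0).
have a1 := kfun_approx eps0 ctt hct' n Gx Gc.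
have a2 := kfun_approx eps0 ctK hc n Gy Gc'.
rewrite (kfun_base eps0 ctt hct') subr0 in a1; rewrite (kfun_base eps0 ctK hc) subr0 in a2.
have u0 : pastE u 0 = pastE theta 0 by exact: ag.
have ccd : `|ct (pastE u 0) - c (pastE theta 0)| < d1.
  by rewrite u0; apply: lt_le_trans (cc _) _.
have b1 := h1 Kt (Omega_nbhd_le l1 near) u theta ag _ _ _ _ _ _ Gc Gc' Gx Gy Gc Gc' ccd xy ccd.
have q0 : 0 <= q by case/andP: q01.
have small z w (K' : Omega eps B) (v : past B) (ct' : controlled N mu kap r M K') :
   piece K' (pastE v 0) z -> piece K' (pastE v 0) w ->
   geo_rate A1 q * `|z - w| * q ^+ n <= e / 4.
  move=> Gz Gw; have Dzw := piece_diam ct' Gz Gw.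
  apply: le_trans (_ : (geo_rate A1 q * diam_const N kap r + 1) * q ^+ n <= _).
    rewrite ler_wpM2r ?exprn_ge0//; apply: le_trans (_ : geo_rate A1 q * diam_const N kap r <= _).
      by rewrite ler_wpM2l.
    by rewrite lerDl.
  by rewrite mulrC -ler_pdivlMr// ltW.
have c1 := le_trans a1 (small _ _ _ _ ctt Gx Gc).
have c2 := le_trans a2 (small _ _ _ _ ctK Gy Gc').
set k1 := kfun _ _ _ _ in c1 *; set k2 := kfun _ _ _ _ in c2 *.
set i1 := incr Kt _ _ _ _ _ in b1 c1; set i2 := incr K _ _ _ _ _ in b1 c2.
have -> : k1 - k2 = (k1 - i1) + (i1 - i2) - (k2 - i2) by ring.
apply: le_lt_trans (ler_normB _ _) _.
apply: le_lt_trans (lerD (ler_normD _ _) (lexx _)) _.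
apply: le_lt_trans (lerD (lerD c1 (ltW b1)) c2) _; lra.
Qed.

Lemma inv_close (x y : C) : 1 <= `|x| -> 1 <= `|y| -> `|x^-1 - y^-1 : C| <= `|x - y|.
Proof.
move=> x1 y1; have x0 : x != 0 by rewrite -normr_gt0 (lt_le_trans ltr01).
have y0 : y != 0 by rewrite -normr_gt0 (lt_le_trans ltr01).
have -> : x^-1 - y^-1 = (y - x) * (x * y)^-1 by field; rewrite x0 y0.
rewrite cnormM cnormV cnormM distrC ler_pdivrMr ?mulr_gt0 ?normr_gt0//.
by rewrite ler_peMr// -[1]mulr1; apply: ler_pM.
Qed.

Lemma dmul_ge1 (K' : Omega eps B) (ct' : controlled N mu kap r M K') u x n :
  piece K' (pastE u 0) x -> 1 <= `|dmul K' u x n|.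
Proof.
move=> Gx; elim: n => [|n IH]; first by rewrite /dmul big_ord0 cnorm1.
rewrite /dmul big_ord_recr /= cnormM -[1]mulr1; apply: ler_pM => //.
by apply: le_trans (mult_ge ct' (back_in n.+1 Gx)); exact/ltW/(ctrl_mu ct').
Qed.

Lemma kder_close (e : R) : 0 < e -> exists n, exists2 delta : R, 0 < delta &
  forall Kt ct, Omega_nbhd K delta Kt -> base_near Kt ct delta ->
  forall u theta, agree n u theta ->
  forall x y, piece Kt (pastE u 0) x -> G (pastE theta 0) y -> `|x - y| < delta ->
    `|kder Kt ct u x - kder K c theta y| < e.
Proof.
move=> e0; have A10 := strict_const1_ge0 (eps := eps) ctK.
have gK := geo_rate_ge0 A10 q01.
have e40 : 0 < e / 4 by rewrite divr_gt0.
have X0 : 0 < geo_rate A1 q + 1 by rewrite ltr_wpDl.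
have [n hn] := expr_lt_exists q01 (divr_gt0 e40 X0).
have [b b0 hb] := dmul_bounded n.
have b10 : 0 <= Num.max b 1 by rewrite le_max b0.
have [eta eta0 heta] := prod_close b10 e40.
have [d1 d10 h1] := dmul_close n eta0.
exists n, (Num.min delta0 d1) => [|Kt ct near [hct' cc] u theta ag x y Gx Gy].
  by rewrite lt_min delta00.
rewrite lt_min => /andP[_ xy].
have l0 : Num.min delta0 d1 <= delta0 by rewrite ge_min lexx.
have l1 : Num.min delta0 d1 <= d1 by rewrite ge_min lexx orbT.
have ctt := hct (Omega_nbhd_le l0 near).
have Gc := base_piece hct' (pastE u 0); have Gc' := base_piece hc (pastE theta 0).
have a1 := kder_approx eps0 ctt hct' n Gx.
have a2 := kder_approx eps0 ctK hc n Gy.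
have u0 : pastE u 0 = pastE theta 0 by exact: ag.
have ccd : `|ct (pastE u 0) - c (pastE theta 0)| < d1.
  by rewrite u0; apply: lt_le_trans (cc _) _.
have b1 : `|dratio Kt ct u x n - dratio K c theta y n| < e / 4.
  have y1 := dmul_ge1 ctK n Gy; have x1 := dmul_ge1 ctt n Gx.
  apply: heta.
  - by rewrite le_max hb.
  - by rewrite le_max cnormV invf_le1 ?y1 ?orbT// (lt_le_trans ltr01).
  - exact: h1 (Omega_nbhd_le l1 near) _ _ ag _ _ Gc Gc' ccd.
  - apply: le_lt_trans (inv_close x1 y1) _.
    exact: h1 (Omega_nbhd_le l1 near) _ _ ag _ _ Gx Gy xy.
have q0 : 0 <= q by case/andP: q01.
have small : geo_rate A1 q * q ^+ n <= e / 4.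
  apply: le_trans (_ : (geo_rate A1 q + 1) * q ^+ n <= _).
    by rewrite ler_wpM2r ?exprn_ge0// lerDl.
  by rewrite mulrC -ler_pdivlMr// ltW.
have c1 := le_trans a1 small; have c2 := le_trans a2 small.
set k1 := kder _ _ _ _ in c1 *; set k2 := kder _ _ _ _ in c2 *.
set i1 := dratio Kt _ _ _ _ in b1 c1; set i2 := dratio K _ _ _ _ in b1 c2.
have -> : k1 - k2 = (k1 - i1) + (i1 - i2) - (k2 - i2) by ring.
apply: le_lt_trans (ler_normB _ _) _.
apply: le_lt_trans (lerD (ler_normD _ _) (lexx _)) _.
apply: le_lt_trans (lerD (lerD c1 (ltW b1)) c2) _; lra.
Qed.

Hypothesis hpred : forall b, exists a, B a b.

(** Two points with the same itinerary are images, under long inverse branches of the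
    two systems, of points in corresponding pieces. *)
Lemma shadow_close (e : R) : 0 < e -> exists2 delta : R, 0 < delta &
  forall Kt, Omega_nbhd K delta Kt -> forall s, (forall n, B (s n) (s n.+1)) ->
  forall x y, (forall n, piece Kt (s n) (iter n (cmap Kt) x)) ->
    (forall n, G (s n) (iter n g y)) -> `|x - y| < e.
Proof.
move=> e0; have e20 : 0 < e / 2 by rewrite divr_gt0.
have mu0 : 0 < mu by exact: lt_trans (ctrl_mu ctK).
have imu : 0 <= mu^-1 < 1 by rewrite invr_ge0 (ltW mu0) invf_lt1// (ctrl_mu ctK).
have D0 := diam_const_ge0 ctK.
have X0 : 0 < diam_const N kap r + 1 by rewrite ltr_wpDl.
have [n hn] := expr_lt_exists imu (divr_gt0 e20 X0).
have [d1 d10 h1] := back_close n e20.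
exists d1 => // Kt near s Bs x y hx hy.
have [z Gz xz] := near_piece near (hx n).
have [theta ht] := past_of_word n hpred Bs.
have t0 : pastE theta 0 = s n by rewrite ht// subn0.
have E1 := word_orbit n Bs hx; rewrite -(back_past Kt _ ht) in E1.
have E2 := word_orbit n Bs hy; rewrite -(back_past K _ ht) in E2.
have Gx0 : piece Kt (pastE theta 0) (iter n (cmap Kt) x) by rewrite t0.
have Gz0 : G (pastE theta 0) z by rewrite t0.
have Gy0 : G (pastE theta 0) (iter n g y) by rewrite t0.
have c1 := h1 Kt near theta theta (fun _ _ => erefl) _ _ Gx0 Gz0 xz.
have c2 := back_diam ctK n Gz0 Gy0.
rewrite E1 in c1; rewrite E2 in c2.
rewrite [e]splitr; apply: dist_sub_le c1 _; apply: le_trans c2 _.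
apply: le_trans (_ : (diam_const N kap r + 1) * mu^-1 ^+ n <= _).
  by rewrite ler_wpM2r ?exprn_ge0 ?invr_ge0 ?(ltW mu0)// lerDl.
by rewrite mulrC -ler_pdivlMr// ltW.
Qed.

Lemma base_points_near (rho : R) : 0 < rho -> exists2 delta : R, 0 < delta &
  forall Kt, Omega_nbhd K delta Kt -> exists ct, base_near Kt ct rho.
Proof.
move=> rho0; have [d d0 h] := shadow_close rho0.
exists (Num.min delta0 d) => [|Kt near]; first by rewrite lt_min delta00.
have l0 : Num.min delta0 d <= delta0 by rewrite ge_min lexx.
have l1 : Num.min delta0 d <= d by rewrite ge_min lexx orbT.
have ctt := hct (Omega_nbhd_le l0 near).
have ex a : exists x : C, cantor_piece Kt a x /\ `|x - c a| < rho.
  have [s [s0 Bs hs]] := itinerary_exists (base_cantor hc a) (base_piece hc a).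
  have [x hx] := shadow_exists ctt hpred Bs; exists x; split.
    by split; [exact: itinerary_cantor hx|have := hx 0%N; rewrite s0].
  exact: h (Omega_nbhd_le l1 near) _ Bs _ _ hx hs.
have [ct hct'] := choice ex.
by exists ct; split=> a; have [] := hct' a.
Qed.

End Closeness.

(** * Continuity of transition maps *)

Section TransitionMaps.
Context {R : realType} {eps : R} {A : finType} {B : rel A}.
Hypothesis eps0 : 0 < eps.
Local Notation C := (Rcomplex R).

Lemma aff_eq (S T : aff R) (y z : C) : y != z -> aff_fun S y = aff_fun T y ->
  aff_fun S z = aff_fun T z -> S = T.
Proof.
move=> yz; rewrite /aff_fun => hy hz.
have E : ((\val S).1 - (\val T).1) * (y - z) = 0 :> C.
  have -> : ((\val S).1 - (\val T).1) * (y - z) =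
    ((\val S).1 * y + (\val S).2) - ((\val T).1 * y + (\val T).2)
    - (((\val S).1 * z + (\val S).2) - ((\val T).1 * z + (\val T).2)) :> C by ring.
  by rewrite hy hz !subrr.
move/eqP: E; rewrite mulf_eq0 !subr_eq0 (negbTE yz) orbF => /eqP E.
apply: val_inj; rewrite (surjective_pairing (\val S)) (surjective_pairing (\val T)).
by congr pair => //; move: hy; rewrite E => /addrI.
Qed.

Section OneSystem.
Context (N : nat) (mu kap r M : R) (K : Omega eps B)
  (ct : controlled N mu kap r M K) (c : A -> C) (hc : base_points K c).
Local Notation G := (piece K).
Local Notation kf := (kfun K c).

Lemma transitionP (theta : past B) w : composable theta w ->
  forall z, G (pastE (concat theta w) 0) z ->
  aff_fun (transition K c theta w) (kf (concat theta w) z) = kf theta (word_map K w z).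
Proof.
move=> cw; have [F hF] := kfun_transition eps0 ct hc cw.
have hk : [set F | forall z, G (pastE (concat theta w) 0) z ->
    aff_fun F (limit_geometry K c (concat theta w) z) =
    limit_geometry K c theta (word_map K w z)] F.
  move=> z Gz; rewrite !(limit_geometryE eps0 hc)//; first exact: hF.
  exact: word_map_in cw Gz.
move=> z Gz; have := xgetPex (aff1 R) (ex_intro _ F hk) z Gz.
by rewrite !(limit_geometryE eps0 hc)//; exact: word_map_in cw Gz.
Qed.

Lemma transition_unique (theta : past B) w F : composable theta w ->
  (forall z, G (pastE (concat theta w) 0) z ->
    aff_fun F (kf (concat theta w) z) = kf theta (word_map K w z)) ->
  transition K c theta w = F.
Proof.
move=> cw hF; set theta' := concat theta w in hF.
have Gc := base_piece hc (pastE theta' 0).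
have [z Gz zc] := piece_other K (pastE theta' 0) (c (pastE theta' 0)).
apply: (@aff_eq _ _ (kf theta' z) (kf theta' (c (pastE theta' 0)))).
- by apply: contra zc => /eqP /(kfun_inj eps0 ct hc Gz Gc) ->.
- by rewrite transitionP// hF.
- by rewrite transitionP// hF.
Qed.

Lemma word_map0 w z : word_size w = 0%N -> word_map K w z = z.
Proof. by case: w => [|a [|b w]]. Qed.

Lemma transition0 (theta : past B) w : composable theta w -> word_size w = 0%N ->
  transition K c theta w = aff1 R.
Proof.
move=> cw w0; apply: transition_unique => // z Gz.
by rewrite word_map0// concat0// /aff_fun /= mul1r addr0.
Qed.

Lemma aff_funM (S T : aff R) z : aff_fun (aff_comp S T) z = aff_fun S (aff_fun T z).
Proof. by rewrite /aff_fun /= mulrDr mulrA addrA. Qed.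

Lemma transition_cons (theta : past B) a b w : composable theta (a :: b :: w) ->
  transition K c theta (a :: b :: w) =
  aff_comp (transition K c theta [:: a; b]) (transition K c (concat theta [:: a; b]) (b :: w)).
Proof.
move=> cw; have [cab cbw] := composable_cons cw.
apply: transition_unique => // z; rewrite concat_cons// => Gz.
by rewrite aff_funM transitionP// transitionP//; exact: word_map_in cbw Gz.
Qed.

Lemma transition_shift (theta : past B) w : composable theta w ->
  let b := pastE (concat theta w) 0 in
  (\val (transition K c theta w)).2 = kf theta (word_map K w (c b)).
Proof.
move=> cw b; have Gc := base_piece hc b.
by rewrite -transitionP// (kfun_base eps0 ct hc) /aff_fun mulr0 add0r.
Qed.

Lemma transition_scale (theta : past B) w z : composable theta w ->
  let theta' := concat theta w in
  G (pastE theta' 0) z -> z != c (pastE theta' 0) ->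
  (\val (transition K c theta w)).1 =
    (kf theta (word_map K w z) - kf theta (word_map K w (c (pastE theta' 0)))) / kf theta' z.
Proof.
move=> cw theta' Gz zc; have Gc := base_piece hc (pastE theta' 0).
have k0 : kf theta' z != 0.
  rewrite -(kfun_base eps0 ct hc theta'); apply: contra zc => /eqP.
  by move/(kfun_inj eps0 ct hc Gz Gc) ->.
by rewrite -transition_shift// -transitionP// /aff_fun addrK mulfK.
Qed.

End OneSystem.

Context (K : Omega eps B) (N : nat) (mu kap r M delta0 : R).
Hypotheses (delta00 : 0 < delta0)
  (hct : forall Kt, Omega_nbhd K delta0 Kt -> controlled N mu kap r M Kt).
Context (c : A -> C) (hc : base_points K c).
Local Notation G := (piece K).

Lemma agree_composable (u theta : past B) w : agree 0 u theta ->
  composable theta w -> composable u w.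
Proof. by rewrite /composable => /(_ 0%N (leqnn _)) ->. Qed.

Lemma agree_concat n (u theta : past B) w : agree n u theta ->
  composable theta w -> agree n (concat u w) (concat theta w).
Proof.
move=> ag cw j jn; have cu := agree_composable (agree_le (leq0n n) ag) cw.
rewrite !concatE// /concat_fun ag//; case: ifP => // _.
by apply: ag; apply: leq_trans jn; exact: leq_subr.
Qed.

Lemma word_map_back (K' : Omega eps B) (theta : past B) w z : composable theta w ->
  piece K' (pastE (concat theta w) 0) z ->
  word_map K' w z = back K' (concat theta w) (word_size w) z.
Proof. by move=> cw Gz; rewrite -(back_concat 0 cw Gz) back0. Qed.

Lemma quotient_close (y x : C) (e : R) : y != 0 -> 0 < e -> exists2 d : R, 0 < d &
  forall x' y' : C, `|x' - x| < d -> `|y' - y| < d -> `|x' / y' - x / y : C| < e.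
Proof.
move=> y0 e0; have ny : 0 < `|y| by rewrite normr_gt0.
pose b := (`|x| + `|y| + 1) / (`|y| * (`|y| / 2)).
have sp : 0 < `|x| + `|y| + 1 by apply: ltr_wpDl => //; exact: addr_ge0.
have b0 : 0 < b by apply: divr_gt0 => //; rewrite !mulr_gt0// invr_gt0.
exists (Num.min (`|y| / 2) (e / b)) => [|x' y']; first by rewrite lt_min; apply/andP; split; apply: divr_gt0.
rewrite !lt_min => /andP[hx1 hx2] /andP[hy1 hy2].
have y'2 : `|y| / 2 < `|y'|.
  by have := norm_le_sub y y'; lra.
have y'0 : y' != 0 by rewrite -normr_gt0; apply: lt_trans y'2; rewrite divr_gt0.
have -> : x' / y' - x / y = ((x' - x) * y - x * (y' - y)) * (y * y')^-1.
  by field; rewrite y0 y'0.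
rewrite cnormM cnormV cnormM ltr_pdivrMr ?mulr_gt0 ?normr_gt0//.
apply: le_lt_trans (ler_normB _ _) _; rewrite !cnormM.
have eb : 0 < e / b by rewrite divr_gt0.
apply: le_lt_trans (_ : e / b * (`|x| + `|y|) < _).
  rewrite mulrDr addrC; apply: lerD; last by rewrite ler_wpM2r// ltW.
  by rewrite mulrC ler_wpM2r// ltW.
apply: lt_le_trans (_ : e / b * (`|x| + `|y| + 1) <= _).
  by rewrite ltr_pM2l// ltrDl.
have -> : e / b * (`|x| + `|y| + 1) = e * (`|y| * (`|y| / 2)).
  have s0 : `|x| + `|y| + 1 != 0 by rewrite gt_eqF.
  rewrite /b; field; by rewrite s0 (gt_eqF ny).
rewrite (ler_pM2l e0) (ler_pM2l ny); exact: ltW.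
Qed.

(** The coefficients of a transition map are determined by the values of limit
    geometries at the base point and at one other point. *)
Lemma transition_close (theta : past B) w (e : R) : composable theta w -> 0 < e ->
  exists n, exists2 delta : R, 0 < delta &
  forall Kt ct, Omega_nbhd K delta Kt -> base_near c Kt ct delta ->
  forall u, agree n u theta ->
    let F := \val (transition K c theta w) in
    let Ft := \val (transition Kt ct u w) in
    `|Ft.1 - F.1| < e /\ `|Ft.2 - F.2| < e.
Proof.
move=> cw e0; have ctt := ctK delta00 hct.
set theta' := concat theta w; set b := pastE theta' 0.
have Gc : G b (c b) := base_piece hc b.
have [z Gz zc] := piece_other K b (c b).
have k0 : kfun K c theta' z != 0.
  rewrite -(kfun_base eps0 ctt hc theta'); apply: contra zc => /eqP.
  by move/(kfun_inj eps0 ctt hc Gz Gc) ->.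
pose X := kfun K c theta (word_map K w z) - kfun K c theta (word_map K w (c b)).
have [d1 d10 h1] := quotient_close X k0 e0.
pose e1 := Num.min e (d1 / 2).
have e10 : 0 < e1 by rewrite lt_min e0 divr_gt0.
have e1d : e1 <= d1 / 2 by rewrite ge_min lexx orbT.
have e1e : e1 <= e by rewrite ge_min lexx.
have [n [d2 d20 h2]] := kfun_close eps0 delta00 hct hc e10.
have [d3 d30 h3] := back_close eps0 delta00 hct (word_size w) d20.
have zc0 : 0 < `|z - c b| / 2 by rewrite divr_gt0// normr_gt0 subr_eq0.
pose d := Num.min (Num.min delta0 (`|z - c b| / 2)) (Num.min d2 d3).
have d0 : 0 < d by rewrite !lt_min delta00 zc0 d20 d30.
have l0 : d <= delta0 by rewrite !ge_min lexx.
have lz : d <= `|z - c b| / 2 by rewrite !ge_min lexx !orbT.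
have l2 : d <= d2 by rewrite !ge_min lexx !orbT.
have l3 : d <= d3 by rewrite !ge_min lexx !orbT.
exists (maxn n (word_size w)), d => // Kt ct near [hct' cc] u ag.
have ag0 : agree 0 u theta by exact: agree_le ag.
have cu := agree_composable ag0 cw.
have ctu := hct (Omega_nbhd_le l0 near).
have agn : agree n u theta by apply: agree_le ag; exact: leq_maxl.
have agw : agree (word_size w) u theta by apply: agree_le ag; exact: leq_maxr.
have ag' := agree_concat agn cw; have agw' := agree_concat agw cw.
have b' : pastE (concat u w) 0 = b by exact: ag'.
have [zt Gzt zzt] := piece_near near Gz.
rewrite -b' in Gzt.
have ccb : `|ct (pastE (concat u w) 0) - c b| < d by rewrite b'; exact: cc.
have Gct := base_piece hct' (pastE (concat u w) 0).
have near2 := Omega_nbhd_le l2 near; have near3 := Omega_nbhd_le l3 near.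
have bn : base_near c Kt ct d2 by split => // a; exact: lt_le_trans (cc a) l2.
have key (x y : C) : piece Kt (pastE (concat u w) 0) x -> G b y -> `|x - y| < d ->
  `|kfun Kt ct u (word_map Kt w x) - kfun K c theta (word_map K w y)| < e1.
  move=> Gx Gy xy; apply: h2 => //; try exact: word_map_in.
  by rewrite (word_map_back cu Gx) (word_map_back cw Gy); apply: h3 => //; exact: lt_le_trans xy l3.
have kz := key _ _ Gzt Gz zzt.
have kc := key _ _ Gct Gc ccb.
have ztc : zt != ct (pastE (concat u w) 0).
  apply/eqP => E; rewrite E in zzt.
  have : `|z - c b| < d + d.
    apply: dist_sub_le (ltW ccb); by rewrite distrC.
  by lra.
have e1d1 : e1 < d1 by apply: le_lt_trans e1d _; rewrite gtr_pMr// invf_lt1// ltr1n.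
split; last first.
  rewrite (transition_shift ctu hct' cu) (transition_shift ctt hc cw).
  exact: lt_le_trans kc e1e.
rewrite (transition_scale ctu hct' cu Gzt ztc) (transition_scale ctt hc cw Gz zc).
apply: h1.
  have E (p k s t : C) : p - k - (s - t) = (p - s) - (k - t) by ring.
  rewrite E; apply: le_lt_trans (ler_normB _ _) _.
  by apply: lt_le_trans (ltrD kz kc) _; lra.
apply: lt_trans e1d1; apply: h2 => //.
exact: lt_le_trans zzt l2.
Qed.

End TransitionMaps.

(** * Topology of the space of relative limit configurations *)

Section SubtypeNbhs.
Context {X : topologicalType} {D : set X}.

Lemma set_type_nbhsP (x : set_type D) (U : set (set_type D)) :
  nbhs x U <-> exists2 W, nbhs (\val x) W & forall y, W (\val y) -> U y.
Proof.
split=> [|[W Wx WU]].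
  rewrite /nbhs /= => -[_ /= [[W oW <-] /= Wx WU]]; exists W; last by move=> y; exact: WU.
  exact: open_nbhs_nbhs.
have h := @initial_continuous _ _ (\val : set_type D -> X) x W Wx.
exact: (@filterS _ (nbhs x) (nbhs_filter x) _ _ WU h).
Qed.

End SubtypeNbhs.

Section CompactDirected.
Context {X : topologicalType}.

(** If no such [D] existed, the sets [L `\` D'] with [D'] in [E] would generate a proper
    filter on [L] without cluster point. *)
Lemma compact_directed_cover (L : set X) (E : set (set X)) : compact L ->
  E set0 -> setU_closed E -> (forall v, L v -> exists2 D, E D & nbhs v D) ->
  exists2 D, E D & L `<=` D.
Proof.
move=> cL E0 EU hE; apply: contrapT => hn.
have ne D : E D -> (L `\` D) !=set0.
  move=> ED; apply: contrapT => h; apply: hn; exists D => // v Lv.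
  by apply: contrapT => Dv; apply: h; exists v.
pose F := filter_from E (fun D => L `\` D).
have FF : ProperFilter F.
  apply: filter_from_proper => //; apply: filter_from_filter; first by exists set0.
  move=> D1 D2 ED1 ED2; exists (D1 `|` D2); first exact: EU.
  by move=> v [Lv Dv]; split; split=> // h; apply: Dv; [left|right].
have FL : F L by exists set0 => // v [].
have [v [Lv cv]] := cL F FF FL.
have [D ED Dv] := hE v Lv.
have [w [[_ nDw] Dw]] := cv (L `\` D) D (ex_intro2 _ _ D ED (fun _ h => h)) Dv.
exact: nDw.
Qed.

End CompactDirected.

Section Pasts.
Context {A : finType} {B : rel A}.

Lemma ptws_nbhsP (s : {ptws nat -> discrete_topology A}) U :
  nbhs s U <-> exists n, forall t, (forall j, (j <= n)%N -> t j = s j) -> U t.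
Proof.
pose Z n : set {ptws nat -> discrete_topology A} :=
  [set t | forall j, (j <= n)%N -> t j = s j].
pose F := filter_from setT Z.
have FF : Filter F.
  apply: filter_from_filter; first by exists 0%N.
  move=> n m _ _; exists (maxn n m) => // t ht; split=> j jn; apply: ht.
    by apply: leq_trans jn _; exact: leq_maxl.
  by apply: leq_trans jn _; exact: leq_maxr.
have nf : Filter (nbhs s) by exact: nbhs_filter.
split=> [sU|[n nU]].
  have Fs : {ptws, F --> s}.
    apply/pointwise_cvgP => j W /= Ws; exists j => // t /= /(_ j (leqnn _)) ->.
    exact: nbhs_singleton.
  by have [n _ hn] := Fs U sU; exists n => t ht; exact: hn.
apply: (filterS nU).
have cyl m : nbhs s [set t : {ptws nat -> discrete_topology A} | t m = s m].
  by apply: open_nbhs_nbhs; split=> //; exact: cylinder_open.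
elim: n {nU} => [|n IH].
  apply: (filterS _ (cyl 0%N)) => t /= ht j.
  by rewrite leqn0 => /eqP ->.
apply: (filterS _ (filterI IH (cyl n.+1))) => t [ht1 /= ht2] j.
by rewrite leq_eqVlt => /orP[/eqP -> //|]; exact: ht1.
Qed.

Lemma past_nbhsP (theta : past B) U :
  nbhs theta U <-> exists n, forall u, agree n u theta -> U u.
Proof.
split.
  move=> /set_type_nbhsP [W /ptws_nbhsP [n hn] WU]; exists n => u hu.
  exact/WU/hn.
move=> [n hn]; apply/set_type_nbhsP.
exists [set t | forall j, (j <= n)%N -> t j = pastE theta j]; last by move=> y; exact: hn.
by apply/ptws_nbhsP; exists n.
Qed.

Lemma past_compact : compact [set: past B].
Proof.
move=> F FF _.
have cA (i : nat) : compact [set: discrete_topology A].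
  have -> : [set: discrete_topology A] = [set` (fun _ : A => true)].
    by apply/seteqP; split.
  exact: finite_compact.
have cT := @tychonoff nat (fun _ => discrete_topology A) (fun _ => setT) cA.
pose G : set_system {ptws nat -> discrete_topology A} := \val @ F.
have [|s [_ cs]] := cT G _; first by apply: filterS filterT.
have near n W : F W -> exists2 u, W u & forall j, (j <= n)%N -> pastE u j = s j.
  move=> FW; have FW' : G ((\val : past B -> _) @` W).
    by apply: (@filterS _ F _ _ _ _ FW) => u Wu; exists u.
  have ns : nbhs (s : {ptws nat -> discrete_topology A})
    [set t | forall j, (j <= n)%N -> t j = s j] by apply/ptws_nbhsP; exists n.
  by have [_ [[u Wu <-] hu]] := cs _ _ FW' ns; exists u.
have Bs n : B (s n.+1) (s n).
  have [u _ hu] := near n.+1 setT filterT.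
  by rewrite -!hu//; exact: pastP.
exists (exist _ s (mem_set (Bs : [set t : {ptws nat -> discrete_topology A} | forall n, B (t n.+1) (t n)] s))).
split=> // W V FW /past_nbhsP [n hV].
have [u Wu hu] := near n W FW.
by exists u; split=> //; exact: hV.
Qed.

Lemma cylinder_compact (theta : past B) n : compact [set u | agree n u theta].
Proof.
apply: (@subclosed_compact _ _ setT) => //; last exact: past_compact.
move=> u cu j jn.
have [v [/(_ j jn) hv hu]] := cu [set v | agree n v u] (proj2 (past_nbhsP u _) (ex_intro _ n (fun _ h => h))).
by rewrite -hv -hu.
Qed.

End Pasts.

Section AffineTopology.
Context {R : realType}.
Local Notation C := (Rcomplex R).

Definition aff_near (e : R) (S T : aff R) : Prop :=
  `|(\val S).1 - (\val T).1| < e /\ `|(\val S).2 - (\val T).2| < e.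

Lemma aff_nbhsP (T : aff R) U :
  nbhs T U <-> exists2 e : R, 0 < e & forall S, aff_near e S T -> U S.
Proof.
split.
  move=> /set_type_nbhsP [W [[P Q] [/= /nbhs_cP [e e0 he] /nbhs_cP [d d0 hd]] PQW] WU].
  exists (Num.min e d) => [|S]; first by rewrite lt_min e0.
  rewrite /aff_near !lt_min => -[/andP[h1 _] /andP[_ h2]]; apply: WU; apply: PQW.
  by split; [exact: he|exact: hd].
move=> [e e0 he]; apply/set_type_nbhsP.
exists [set p : C * C | `|p.1 - (\val T).1| < e /\ `|p.2 - (\val T).2| < e]; last first.
  by move=> S hS; exact: he.
exists ([set z | `|z - (\val T).1| < e], [set z | `|z - (\val T).2| < e]) => //=.
by split; apply/nbhs_cP; exists e.
Qed.

Lemma closed_ball_compact (z : C) (e : R) : compact [set w | `|w - z| <= e].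
Proof.
pose f (p : R * R) : C := (p.1 +i* p.2)%C.
have cf : continuous f.
  by move=> p; apply: cvg_complex; [exact: cvg_fst|exact: cvg_snd].
pose D := `[complex.Re (z : R[i]) - e, complex.Re (z : R[i]) + e]%classic `*`
          `[complex.Im (z : R[i]) - e, complex.Im (z : R[i]) + e]%classic.
have cD : compact (f @` D).
  apply: continuous_compact; first exact: continuous_subspaceT.
  by apply: compact_setX; exact: segment_compact.
apply: subclosed_compact cD _ => [w cw|w /= hw].
  apply/ler_addgt0Pr => d d0.
  have /cw [v [/= hv wv]] : nbhs w [set v : C | `|v - w| < d] by apply/nbhs_cP; exists d.
  have := norm_le_sub (w - z) (v - z).
  have -> : v - z - (w - z) = v - w :> C by ring.
  lra.
exists (complex.Re (w : R[i]), complex.Im (w : R[i])); last by rewrite /f /=; case: (w : R[i]).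
have h1 := le_trans (cRe_le (w - z)) hw; have h2 := le_trans (cIm_le (w - z)) hw.
move: h1 h2; rewrite !raddfB /= !ler_norml => /andP[h1 h1'] /andP[h2 h2'].
by split; rewrite /= in_itv /=; apply/andP; split; lra.
Qed.

Lemma aff_ball_compact (T : aff R) (e : R) : e < `|(\val T).1| ->
  compact [set S : aff R | `|(\val S).1 - (\val T).1| <= e /\ `|(\val S).2 - (\val T).2| <= e].
Proof.
move=> eT F FF FD.
pose D : set (C * C) := [set w | `|w - (\val T).1| <= e] `*` [set w | `|w - (\val T).2| <= e].
have cD : compact D by apply: compact_setX; exact: closed_ball_compact.
pose H : set_system (C * C) := \val @ F.
have [p [[/= Dp1 Dp2] cp]] := cD H _ FD.
have p0 : p.1 != 0.
  apply/eqP => E; move: Dp1; rewrite E sub0r normrN leNgt => /negP; exact.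
exists (mkaff p.2 p0); split=> // W V FW /aff_nbhsP [d d0 hd].
have : nbhs p [set q : C * C | `|q.1 - p.1| < d /\ `|q.2 - p.2| < d].
  exists ([set w | `|w - p.1| < d], [set w | `|w - p.2| < d]) => //=.
  by split; apply/nbhs_cP; exists d.
have FW' : H ((\val : aff R -> _) @` W) by apply: (@filterS _ F _ _ _ _ FW) => u Wu; exists u.
move=> /(cp _ _ FW') [_ [[S WS <-] hS]].
by exists S; split=> //; exact: hd.
Qed.

End AffineTopology.

Section RelativeConfigurations.
Context {R : realType} {A A' : finType} {B : rel A} {B' : rel A'}.
Local Notation C := (Rcomplex R).
Local Notation pairs := (limit_pair R B B').
Local Notation rc := (@rel_class R A A' B B').

Definition near_pair (e : R) (n : nat) (p q : pairs) : Prop :=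
  (aff_near e p.1.1 q.1.1 /\ agree n p.1.2 q.1.2) /\
  (aff_near e p.2.1 q.2.1 /\ agree n p.2.2 q.2.2).

Lemma pair_nbhsP (p : pairs) (U : set pairs) :
  nbhs p U <-> exists n, exists2 e : R, 0 < e & forall q, near_pair e n q p -> U q.
Proof.
split.
  case=> -[P Q] /= [[[P1 P2] /= [/aff_nbhsP [e1 e10 h1] /past_nbhsP [n1 k1] hP]
     [[Q1 Q2] /= [/aff_nbhsP [e2 e20 h2] /past_nbhsP [n2 k2] hQ]]]] PQU.
  exists (maxn n1 n2), (Num.min e1 e2) => [|q]; first by rewrite lt_min e10.
  rewrite /near_pair /aff_near !lt_min.
  move=> [[[/andP[a1 _] /andP[a2 _]] ag1] [[/andP[_ b1] /andP[_ b2]] ag2]].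
  apply: PQU; split.
    apply: hP; split; first exact: h1.
    by apply: k1; apply: agree_le ag1; exact: leq_maxl.
  apply: hQ; split; first exact: h2.
  by apply: k2; apply: agree_le ag2; exact: leq_maxr.
move=> [n [e e0 h]].
exists ([set q | aff_near e q.1 p.1.1 /\ agree n q.2 p.1.2],
        [set q | aff_near e q.1 p.2.1 /\ agree n q.2 p.2.2]); last first.
  by move=> q [? ?]; exact: h.
split.
  exists ([set S | aff_near e S p.1.1], [set u | agree n u p.1.2]) => //=.
  by split; [apply/aff_nbhsP; exists e|apply/past_nbhsP; exists n].
exists ([set S | aff_near e S p.2.1], [set u | agree n u p.2.2]) => //=.
by split; [apply/aff_nbhsP; exists e|apply/past_nbhsP; exists n].
Qed.

Lemma pair_locally_compact (p : pairs) (U : set pairs) : nbhs p U ->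
  exists D, [/\ compact D, nbhs p D & D `<=` U].
Proof.
move=> /pair_nbhsP [n [e e0 h]].
have a1 : 0 < `|(\val p.1.1).1| by rewrite normr_gt0 aff_neq0.
have a2 : 0 < `|(\val p.2.1).1| by rewrite normr_gt0 aff_neq0.
pose d := Num.min (e / 2) (Num.min (`|(\val p.1.1).1| / 2) (`|(\val p.2.1).1| / 2)).
have d0 : 0 < d by rewrite !lt_min !divr_gt0.
have de : d < e by apply: le_lt_trans (_ : e / 2 < _); [rewrite ge_min lexx|lra].
have d1 : d < `|(\val p.1.1).1|.
  by apply: le_lt_trans (_ : `|(\val p.1.1).1| / 2 < _); [rewrite !ge_min lexx !orbT|lra].
have d2 : d < `|(\val p.2.1).1|.
  by apply: le_lt_trans (_ : `|(\val p.2.1).1| / 2 < _); [rewrite !ge_min lexx !orbT|lra].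
pose cb (T S : aff R) := `|(\val S).1 - (\val T).1| <= d /\ `|(\val S).2 - (\val T).2| <= d.
exists ((([set S | cb p.1.1 S] `*` [set u | agree n u p.1.2]) `*`
        ([set S | cb p.2.1 S] `*` [set u | agree n u p.2.2])) : set pairs); split.
- by apply: compact_setX; apply: compact_setX; (exact: aff_ball_compact || exact: cylinder_compact).
- apply/pair_nbhsP; exists n, d => // q [[[? ?] ?] [[? ?] ?]].
  by split; (split; [split; exact: ltW|]).
- move=> q [[[b1 b2] b3] [[b4 b5] b6]]; apply: h.
  by split; (split; [split; exact: le_lt_trans de|]).
Qed.

Lemma rel_classP (p q : pairs) : rc p = rc q <-> exists T, q = aff_act T p.
Proof.
have P := eqmodP (aff_equiv_rel R B B') p q.
by split=> [/(introT P) /asboolP //|h]; apply: (elimT P); exact/asboolP.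
Qed.

Lemma aff_act_continuous T : continuous (@aff_act R A A' B B' T).
Proof.
move=> p W /pair_nbhsP [n [e e0 h]]; apply/pair_nbhsP; exists n.
have t0 : 0 < `|(\val T).1| by rewrite normr_gt0 aff_neq0.
exists (e / `|(\val T).1|); first by rewrite divr_gt0.
move=> q [[[a1 a2] ag1] [[b1 b2] ag2]]; apply: h.
have E (x y : C) : `|x - y| < e / `|(\val T).1| -> `|(\val T).1 * x - (\val T).1 * y : C| < e.
  by rewrite ltr_pdivlMr// -mulrBr cnormM mulrC.
have E2 (x y z : C) : x + z - (y + z) = x - y by ring.
split; (split; last by []); split=> /=; rewrite ?E2; exact: E.
Qed.

Lemma rel_class_continuous : continuous rc.
Proof. exact: pi_continuous. Qed.

(** The saturation of an open set is the union of its images under the affine group,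
    which acts by homeomorphisms. *)
Lemma rel_class_open (p : pairs) U : nbhs p U -> nbhs (rc p) (rc @` U).
Proof.
rewrite nbhsE => -[V [oV Vp] VU].
apply: (@filterS _ (nbhs (rc p)) (nbhs_filter _) (rc @` V)); first by move=> _ [q /VU Uq <-]; exists q.
apply: open_nbhs_nbhs; split; last by exists p.
suff h : open (rc @^-1` (rc @` V)) by exact: h.
have -> : rc @^-1` (rc @` V) = \bigcup_(T in [set: aff R]) (@aff_act R A A' B B' T @^-1` V).
  apply/seteqP; split=> q /=.
    by move=> [p' Vp' /esym/rel_classP [T E]]; exists T => //=; rewrite -E.
  by move=> [T _ VT]; exists (aff_act T q) => //; apply/esym/rel_classP; exists T.
apply: bigcup_open => T _; apply: open_comp => // q _; exact: aff_act_continuous.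
Qed.

Lemma rel_class_surj (v : rel_limit_config R B B') : exists p, rc p = v.
Proof. by exists (rel_repr v); rewrite /rel_class /rel_repr reprK. Qed.

Lemma rel_locally_compact (v : rel_limit_config R B B') (U : set (rel_limit_config R B B')) : nbhs v U ->
  exists D, [/\ compact D, nbhs v D & D `<=` U].
Proof.
have [p <-] := rel_class_surj v => nU.
have [D [cD pD DU]] := pair_locally_compact (rel_class_continuous nU).
exists (rc @` D); split; [|exact: rel_class_open|by move=> _ [q /DU Uq <-]].
by apply: continuous_compact cD; exact/continuous_subspaceT/rel_class_continuous.
Qed.

End RelativeConfigurations.

(** * Robustness of recurrence *)

Section OneSide.
Context {R : realType} {eps : R} {A : finType} {B : rel A}.
Hypothesis eps0 : 0 < eps.
Local Notation C := (Rcomplex R).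
Context (K : Omega eps B) (c : A -> C) (hc : base_points K c).

Lemma letter_pred b : exists a, B a b.
Proof.
have [s [s0 Bs _]] := itinerary_exists (base_cantor hc b) (base_piece hc b).
exact: mixing_pred (map_mixing (Omega_axioms K)) Bs s0.
Qed.

Lemma base_near_refl (d : R) : 0 < d -> base_near c K c d.
Proof. by move=> d0; split=> // a; rewrite subrr normr0. Qed.

Lemma base_near_le (Kt : Omega eps B) ct (d d' : R) : d' <= d -> base_near c Kt ct d' -> base_near c Kt ct d.
Proof. by move=> dd [h1 h2]; split=> // a; exact: lt_le_trans (h2 a) dd. Qed.

Lemma base_points_exist (rho : R) : 0 < rho -> exists2 delta : R, 0 < delta &
  forall Kt, Omega_nbhd K delta Kt -> exists ct, base_near c Kt ct rho.
Proof.
have [N [mu [kap [r [M [d d0 hct]]]]]] := near_controlled eps0 K.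
exact: (base_points_near eps0 d0 hct hc letter_pred).
Qed.

Definition translate (tau : C) : aff R := mkaff tau (oner_neq0 C).

Lemma translate0 T : aff_comp (translate 0) T = T.
Proof. exact: aff_comp1. Qed.

(** The translation [tau], which vanishes for the renormalization operator itself,
    accounts for the deviation of a perturbed configuration from a limit
    geometry. *)
Lemma renormalized_close (theta : past B) (S : aff R) w n (e : R) :
  composable theta w -> 0 < e ->
  exists m, exists2 delta : R, 0 < delta &
  forall Kt ct, Omega_nbhd K delta Kt -> base_near c Kt ct delta ->
  forall u S', agree m u theta -> aff_near delta S' S ->
  composable u w /\ forall tau : C, `|tau| < delta ->
    aff_near e (aff_comp S' (aff_comp (translate tau) (transition Kt ct u w)))
               (aff_comp S (transition K c theta w)) /\
    agree n (concat u w) (concat theta w).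
Proof.
move=> cw e0; have [N [mu [kap [r [M [d0 d00 hct]]]]]] := near_controlled eps0 K.
set F := transition K c theta w.
pose b := Num.max `|(\val S).1| (Num.max `|(\val F).1| `|(\val F).2|).
have bS : `|(\val S).1| <= b by rewrite le_max lexx.
have bF1 : `|(\val F).1| <= b by rewrite !le_max lexx !orbT.
have bF2 : `|(\val F).2| <= b by rewrite !le_max lexx !orbT.
have e20 : 0 < e / 2 by rewrite divr_gt0.
have [eta eta0 heta] := prod_close (le_trans (normr_ge0 _) bS) e20.
have eta20 : 0 < eta / 2 by rewrite divr_gt0.
have [m [d1 d10 h1]] := transition_close eps0 d00 hct hc cw eta20.
pose d := Num.min (Num.min d1 (eta / 2)) (e / 2).
have dd : 0 < d by rewrite !lt_min d10 eta20 e20.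
have l1 : d <= d1 by rewrite !ge_min lexx.
have l2 : d <= eta / 2 by rewrite !ge_min lexx !orbT.
have l3 : d <= e / 2 by rewrite !ge_min lexx !orbT.
exists (maxn m n), d => // Kt ct near bn u S' ag [hS1 hS2].
have cu := agree_composable (agree_le (leq0n _) ag) cw; split=> // tau htau.
have [hF1 hF2] := h1 Kt ct (Omega_nbhd_le l1 near) (base_near_le l1 bn) u (agree_le (leq_maxl _ _) ag).
split; last by apply: agree_concat cw; apply: agree_le ag; exact: leq_maxr.
set Ft := transition Kt ct u w in hF1 hF2 *.
have sd : `|(\val S').1 - (\val S).1| < eta by lra.
split=> /=.
  rewrite mul1r; apply: (@lt_trans _ _ (e / 2)); last by lra.
  by apply: heta => //; lra.
rewrite mul1r.
have -> : (\val S').1 * ((\val Ft).2 + tau) + (\val S').2 - ((\val S).1 * (\val F).2 + (\val S).2)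
  = ((\val S').1 * ((\val Ft).2 + tau) - (\val S).1 * (\val F).2) + ((\val S').2 - (\val S).2) :> C by ring.
apply: le_lt_trans (ler_normD _ _) _; rewrite [e]splitr; apply: ltrD; last exact: lt_le_trans l3.
apply: heta => //.
have -> : (\val Ft).2 + tau - (\val F).2 = ((\val Ft).2 - (\val F).2) + tau :> C by ring.
by apply: le_lt_trans (ler_normD _ _) _; lra.
Qed.

End OneSide.

Section Renormalization.
Context {R : realType} {eps : R} {A A' : finType} {B : rel A} {B' : rel A'}.
Hypothesis eps0 : 0 < eps.
Local Notation C := (Rcomplex R).
Local Notation pairs := (limit_pair R B B').
Local Notation rc := (@rel_class R A A' B B').

Definition renorm_pair (K : Omega eps B) (K' : Omega eps B') (c : A -> C) (c' : A' -> C)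
    (tau tau' : C) w w' (p : pairs) : pairs :=
  ((aff_comp p.1.1 (aff_comp (translate tau) (transition K c p.1.2 w)), concat p.1.2 w),
   (aff_comp p.2.1 (aff_comp (translate tau') (transition K' c' p.2.2 w')), concat p.2.2 w')).

Lemma renorm_pair_act K K' c c' tau tau' w w' T p :
  renorm_pair K K' c c' tau tau' w w' (aff_act T p) =
  aff_act T (renorm_pair K K' c c' tau tau' w w' p).
Proof. by rewrite /renorm_pair /aff_act /= !aff_compA. Qed.

Lemma rel_repr_class (p : pairs) : exists T, rel_repr (rc p) = aff_act T p.
Proof. by apply/rel_classP; rewrite /rel_repr [RHS]reprK. Qed.

Lemma renorm_class K K' c c' w w' (p : pairs) :
  renorm K K' c c' w w' (rc p) = rc (renorm_pair K K' c c' 0 0 w w' p).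
Proof.
have [T hT] := rel_repr_class p.
rewrite /renorm hT; case: p {hT} => [[S theta] [S' theta']] /=.
apply/esym/rel_classP; exists T.
by rewrite /renorm_pair /aff_act /= !translate0 !aff_compA.
Qed.

Lemma rel_composable_class w w' (p : pairs) :
  rel_composable w w' (rc p) = composable p.1.2 w && composable p.2.2 w'.
Proof. by have [T hT] := rel_repr_class p; rewrite /rel_composable hT. Qed.

Context (K : Omega eps B) (K' : Omega eps B') (c : A -> C) (c' : A' -> C)
  (hc : base_points K c) (hc' : base_points K' c').

Lemma renorm_pair_near (p0 : pairs) w w' (U : set pairs) :
  composable p0.1.2 w -> composable p0.2.2 w' ->
  nbhs (renorm_pair K K' c c' 0 0 w w' p0) U ->
  exists2 V, nbhs p0 V & exists2 e : R, 0 < e & forall Kt Kt' ct ct' p,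
    Omega_nbhd K e Kt -> Omega_nbhd K' e Kt' ->
    base_near c Kt ct e -> base_near c' Kt' ct' e -> V p ->
    [/\ composable p.1.2 w, composable p.2.2 w' &
      forall tau tau' : C, `|tau| < e -> `|tau'| < e ->
        U (renorm_pair Kt Kt' ct ct' tau tau' w w' p)].
Proof.
move=> cw cw' /pair_nbhsP [n [e e0 hU]].
have [m [d d0 h]] := renormalized_close eps0 hc p0.1.1 n cw e0.
have [m' [d' d'0 h']] := renormalized_close eps0 hc' p0.2.1 n cw' e0.
pose V := [set p | (aff_near d p.1.1 p0.1.1 /\ agree m p.1.2 p0.1.2) /\
                   (aff_near d' p.2.1 p0.2.1 /\ agree m' p.2.2 p0.2.2)] : set pairs.
exists V.
  exists ([set q | aff_near d q.1 p0.1.1 /\ agree m q.2 p0.1.2],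
          [set q | aff_near d' q.1 p0.2.1 /\ agree m' q.2 p0.2.2]) => //.
  split => /=.
    exists ([set S | aff_near d S p0.1.1], [set u | agree m u p0.1.2]) => //=.
    by split; [apply/aff_nbhsP; exists d|apply/past_nbhsP; exists m].
  exists ([set S | aff_near d' S p0.2.1], [set u | agree m' u p0.2.2]) => //=.
  by split; [apply/aff_nbhsP; exists d'|apply/past_nbhsP; exists m'].
have l : Num.min d d' <= d by rewrite ge_min lexx.
have l' : Num.min d d' <= d' by rewrite ge_min lexx orbT.
exists (Num.min d d') => [|Kt Kt' ct ct' p near near' bn bn' [[hp1 hp2] [hp3 hp4]]].
  by rewrite lt_min d0.
have [cu k] := h Kt ct (Omega_nbhd_le l near) (base_near_le l bn) _ _ hp2 hp1.
have [cu' k'] := h' Kt' ct' (Omega_nbhd_le l' near') (base_near_le l' bn') _ _ hp4 hp3.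
split=> // tau tau' ht ht'; apply: hU.
by rewrite /near_pair /renorm_pair /= !translate0; split;
  [apply: k; exact: lt_le_trans l|apply: k'; exact: lt_le_trans l'].
Qed.

(** Since [L] is compact, finitely many words suffice, and the renormalization
    operators vary continuously with the Cantor sets and with additional
    translations. *)
Lemma uniform_recurrence P (L : set (rel_limit_config R B B')) :
  recurrent_sizes K K' c c' P L ->
  exists2 e : R, 0 < e & forall Kt Kt' ct ct' p,
    Omega_nbhd K e Kt -> Omega_nbhd K' e Kt' ->
    base_near c Kt ct e -> base_near c' Kt' ct' e -> L (rc p) ->
    exists w w', [/\ composable p.1.2 w, composable p.2.2 w',
      P (word_size w + word_size w')%N &
      forall tau tau' : C, `|tau| < e -> `|tau'| < e ->
        interior L (rc (renorm_pair Kt Kt' ct ct' tau tau' w w' p))].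
Proof.
move=> [cL hL].
pose Q (e : R) v := forall Kt Kt' ct ct' p,
    Omega_nbhd K e Kt -> Omega_nbhd K' e Kt' ->
    base_near c Kt ct e -> base_near c' Kt' ct' e -> rc p = v ->
    exists w w', [/\ composable p.1.2 w, composable p.2.2 w',
      P (word_size w + word_size w')%N &
      forall tau tau' : C, `|tau| < e -> `|tau'| < e ->
        interior L (rc (renorm_pair Kt Kt' ct ct' tau tau' w w' p))].
have [|e e0 he] := @compact_uniform_top R _ L Q cL; last first.
  by exists e => // Kt Kt' ct ct' p h1 h2 h3 h4 Lp; exact: (he _ Lp).
move=> v Lv; have [w [w' [cww Pww Lww]]] := hL v Lv.
have [p0 Ep0] := rel_class_surj v; subst v.
rewrite rel_composable_class in cww; case/andP: cww => cw cw'.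
rewrite renorm_class in Lww.
have [V nV [e e0 h]] := renorm_pair_near cw cw' (rel_class_continuous (nbhs_interior Lww)).
exists (rc @` V); first exact: rel_class_open.
exists e => // v d [q Vq <-] /andP[d0 de] Kt Kt' ct ct' p h1 h2 h3 h4 /rel_classP [T Eq].
have l := ltW de.
have [cq cq' hq] := h Kt Kt' ct ct' q (Omega_nbhd_le l h1) (Omega_nbhd_le l h2)
  (base_near_le l h3) (base_near_le l h4) Vq.
rewrite Eq in cq cq'.
exists w, w'; split=> // tau tau' ht ht'.
have := hq tau tau' (lt_trans ht de) (lt_trans ht' de).
rewrite Eq renorm_pair_act /=.
suff -> : rc (aff_act T (renorm_pair Kt Kt' ct ct' tau tau' w w' p)) =
  rc (renorm_pair Kt Kt' ct ct' tau tau' w w' p) by [].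
by apply/esym/rel_classP; exists T.
Qed.

Lemma recurrence_persists P (L : set (rel_limit_config R B B')) (rho : R) :
  recurrent_sizes K K' c c' P L -> 0 < rho ->
  \forall KK \near (K, K'), exists (ct : A -> C) (ct' : A' -> C),
    [/\ base_points KK.1 ct, base_points KK.2 ct',
        forall a, `|ct a - c a| < rho, forall a', `|ct' a' - c' a'| < rho &
        recurrent_sizes KK.1 KK.2 ct ct' P L].
Proof.
move=> hL rho0; have [e e0 he] := uniform_recurrence hL.
have r0 : 0 < Num.min e rho by rewrite lt_min e0.
have [d d0 hd] := base_points_exist eps0 hc r0.
have [d' d'0 hd'] := base_points_exist eps0 hc' r0.
exists (Omega_nbhd K (Num.min e d), Omega_nbhd K' (Num.min e d')).
  by split; apply: Omega_nbhd_nbhs => //; rewrite lt_min e0.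
move=> [Kt Kt'] /= [near near'].
have le : Num.min e d <= e by rewrite ge_min lexx.
have le' : Num.min e d' <= e by rewrite ge_min lexx.
have ld : Num.min e d <= d by rewrite ge_min lexx orbT.
have ld' : Num.min e d' <= d' by rewrite ge_min lexx orbT.
have lr : Num.min e rho <= e by rewrite ge_min lexx.
have lr' : Num.min e rho <= rho by rewrite ge_min lexx orbT.
have [ct bn] := hd Kt (Omega_nbhd_le ld near).
have [ct' bn'] := hd' Kt' (Omega_nbhd_le ld' near').
exists ct, ct'; split; try by case: bn bn' => ? ? [].
- by move=> a; case: bn => _ /(_ a) h; exact: lt_le_trans h lr'.
- by move=> a; case: bn' => _ /(_ a) h; exact: lt_le_trans h lr'.
split=> [|v Lv]; first by case: hL.
have [p Ep] := rel_class_surj v; subst v.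
have [w [w' [cw cw' Pw h]]] := he Kt Kt' ct ct' p (Omega_nbhd_le le near)
  (Omega_nbhd_le le' near') (base_near_le lr bn) (base_near_le lr bn') Lv.
exists w, w'; split=> //; first by rewrite rel_composable_class cw.
by rewrite renorm_class; apply: h; rewrite normr0.
Qed.

End Renormalization.

(** * Immediately recurrent hulls *)

Section OneSide.
Context {R : realType} {eps : R} {A : finType} {B : rel A}.
Hypothesis eps0 : 0 < eps.
Local Notation C := (Rcomplex R).

Lemma aff_comp1r (T : aff R) : aff_comp T (aff1 R) = T.
Proof. by apply: val_inj; rewrite /= mulr1 mulr0 add0r; case: (\val T). Qed.

Lemma transition_nil (K1 : Omega eps B) (c1 : A -> C) (theta : past B) w :
  base_points K1 c1 -> composable theta w ->
  word_size w = 0%N -> transition K1 c1 theta w = aff1 R.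
Proof.
move=> h1 cw w0; have [N [mu [kap [r [M [d d0 hct]]]]]] := near_controlled eps0 K1.
exact: (transition0 eps0 (hct _ (Omega_nbhd_refl _ d0)) h1).
Qed.

Lemma transition_split (K1 : Omega eps B) (c1 : A -> C) (theta : past B) a b w :
  base_points K1 c1 -> composable theta (a :: b :: w) ->
  transition K1 c1 theta (a :: b :: w) =
  aff_comp (transition K1 c1 theta [:: a; b]) (transition K1 c1 (concat theta [:: a; b]) (b :: w)).
Proof.
move=> h1 cw; have [N [mu [kap [r [M [d d0 hct]]]]]] := near_controlled eps0 K1.
exact: (transition_cons eps0 (hct _ (Omega_nbhd_refl _ d0)) h1).
Qed.

End OneSide.

Section ImmediateRecurrence.
Context {R : realType} {eps : R} {A A' : finType} {B : rel A} {B' : rel A'}.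
Hypothesis eps0 : 0 < eps.
Local Notation C := (Rcomplex R).
Local Notation pairs := (limit_pair R B B').
Local Notation rc := (@rel_class R A A' B B').
Context (K : Omega eps B) (K' : Omega eps B') (c : A -> C) (c' : A' -> C)
  (hc : base_points K c) (hc' : base_points K' c').
Local Notation rn := (renorm_pair K K' c c' 0 0).

Lemma rel_nbhsS (v : rel_limit_config R B B') U V : U `<=` V -> nbhs v U -> nbhs v V.
Proof. exact: (@filterS _ (nbhs v) (nbhs_filter v)). Qed.

Lemma renorm_pair_splitl (p : pairs) a b w w' : composable p.1.2 (a :: b :: w) ->
  composable p.2.2 w' ->
  rn (a :: b :: w) w' p = rn (b :: w) w' (rn [:: a; b] [::] p).
Proof.
move=> cw cw'; rewrite /renorm_pair /= !translate0 (transition_split eps0 hc cw) (concat_cons cw).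
have cn := composable_nil p.2.2.
by rewrite (transition_nil eps0 hc' cn)// (concat0 cn)// aff_comp1r aff_compA.
Qed.

Lemma renorm_pair_splitr (p : pairs) a b w w' : composable p.1.2 w ->
  composable p.2.2 (a :: b :: w') ->
  rn w (a :: b :: w') p = rn w (b :: w') (rn [::] [:: a; b] p).
Proof.
move=> cw cw'; rewrite /renorm_pair /= !translate0 (transition_split eps0 hc' cw') (concat_cons cw').
have cn := composable_nil p.1.2.
by rewrite (transition_nil eps0 hc cn)// (concat0 cn)// aff_comp1r aff_compA.
Qed.

Lemma renorm_absorb1 (p : pairs) w w' (U : set (rel_limit_config R B B')) :
  composable p.1.2 w -> composable p.2.2 w' -> nbhs (rc (rn w w' p)) U ->
  exists E, [/\ compact E, nbhs (rc p) E & forall v, E v ->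
    rel_composable w w' v /\ nbhs (renorm K K' c c' w w' v) U].
Proof.
move=> cw cw' nU.
have [V nV [e e0 h]] := renorm_pair_near eps0 hc hc' cw cw' (rel_class_continuous (nbhs_interior nU)).
have [E [cE pE EV]] := rel_locally_compact (rel_class_open nV).
exists E; split=> // v /EV [q Vq <-].
have [cq cq' hq] := h K K' c c' q (Omega_nbhd_refl _ e0) (Omega_nbhd_refl _ e0)
  (base_near_refl hc e0) (base_near_refl hc' e0) Vq.
rewrite rel_composable_class cq cq' renorm_class; split=> //.
by apply: hq; rewrite normr0.
Qed.

(** The points of [E] are sent by elementary renormalizations into the interior of
    [L `|` E], and not only of [E]: this makes the condition stable under unions
    and under adding, one by one, the neighbourhoods along an orbit that ends in
    [L]. *)
Definition absorbed (L E : set (rel_limit_config R B B')) : Prop :=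
  compact E /\ forall v, E v -> exists w w',
    [/\ rel_composable w w' v, (word_size w + word_size w')%N == 1%N &
        nbhs (renorm K K' c c' w w' v) (L `|` E)].

Lemma absorbed_step (p : pairs) w w' (L E : set (rel_limit_config R B B')) :
  composable p.1.2 w -> composable p.2.2 w' -> (word_size w + word_size w')%N == 1%N ->
  absorbed L E -> nbhs (rc (rn w w' p)) (L `|` E) ->
  exists2 E', absorbed L E' & nbhs (rc p) E'.
Proof.
move=> cw cw' w1 [cE hE] nE; have [D [cD pD hD]] := renorm_absorb1 cw cw' nE.
have sub (v : rel_limit_config R B B') : nbhs v (L `|` E) -> nbhs v (L `|` (D `|` E)).
  by move=> h; apply: (rel_nbhsS _ h) => x [Lx|Ex]; [left|right; right].
exists (D `|` E); last by apply: (rel_nbhsS _ pD) => x; left.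
split=> [|v [Dv|Ev]]; first exact: compactU.
  by have [h1 h2] := hD v Dv; exists w, w'; split=> //; exact: sub.
by have [u [u' [h1 h2 h3]]] := hE v Ev; exists u, u'; split=> //; exact: sub.
Qed.

(** A long renormalization is decomposed into elementary ones; compact
    neighbourhoods of the intermediate points are chosen from the last one
    backwards, each one being sent into the interior of the next one. *)
Lemma absorbed_exists n (p : pairs) w w' (L : set (rel_limit_config R B B')) :
  (word_size w + word_size w')%N = n.+1 -> composable p.1.2 w -> composable p.2.2 w' ->
  nbhs (rc (rn w w' p)) L -> exists2 E, absorbed L E & nbhs (rc p) E.
Proof.
elim: n p w w' => [|n IH] p w w' ws cw cw' nL.
  apply: (absorbed_step (E := set0) cw cw'); first by rewrite ws.
    by split=> //; exact: compact0.
  by rewrite setU0.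
case: w ws cw nL => [|a [|b w]] ws cw nL; last first.
  rewrite renorm_pair_splitl// in nL; have [c1 c2] := composable_cons cw.
  have [||E hE nE] := IH (rn [:: a; b] [::] p) (b :: w) w' _ c2 _ nL.
  - by move: ws; rewrite /word_size /= addSn => -[].
  - by rewrite /= concat0//; exact: composable_nil.
  apply: (absorbed_step c1 (composable_nil _) _ hE) => //.
  by apply: (rel_nbhsS _ nE) => x; right.
all: case: w' ws cw' nL => [|a' [|b' w']] // ws cw' nL.
all: rewrite renorm_pair_splitr// in nL; have [c1 c2] := composable_cons cw'.
all: have [||E hE nE] := IH (rn [::] [:: a'; b'] p) _ (b' :: w') _ _ c2 nL.
all: try by move: ws; rewrite /word_size /= ?add0n => -[].
all: try by rewrite /= concat0//; exact: composable_nil.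
all: apply: (absorbed_step (composable_nil _) c1 _ hE) => //.
all: by apply: (rel_nbhsS _ nE) => x; right.
Qed.

Lemma immediately_recurrent_hull (L : set (rel_limit_config R B B')) :
  recurrent K K' c c' L ->
  exists2 L1 : set (rel_limit_config R B B'),
    immediately_recurrent K K' c c' L1 & L `<=` L1.
Proof.
move=> [cL hL].
have [|E1 E2 [cE1 h1] [cE2 h2]|v Lv|E [cE hE] LE] :=
    @compact_directed_cover _ L (absorbed L) cL.
- by split=> //; exact: compact0.
- split=> [|v]; first exact: compactU.
  by move=> [/h1|/h2] [w [w' [k1 k2 k3]]]; exists w, w'; split=> //;
    apply: (rel_nbhsS _ k3) => x [Lx|Ex]; [left|right; left|left|right; right].
- have [p Ep] := rel_class_surj v; subst v.
  have [w [w' [cww ws nL]]] := hL _ Lv.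
  rewrite rel_composable_class in cww; case/andP: cww => cw cw'.
  rewrite renorm_class in nL.
  by apply: (absorbed_exists (esym (prednK ws)) cw cw').
exists (L `|` E) => [|v]; last by left.
split=> [|v Lv]; first exact: compactU.
by apply: hE; case: Lv => // /LE.
Qed.

End ImmediateRecurrence.

(** * Deviation of a perturbed configuration from the limit geometry *)

Section PerturbedConfigurations.
Context {R : realType} {eps : R} {A : finType} {B : rel A}.
Hypothesis eps0 : 0 < eps.
Local Notation C := (Rcomplex R).

(** The Taylor remainder and the differential at one point together bound the
    increments of the difference, without any convexity of [E]. *)
Lemma C1eps_close_lipschitz (d D0 : R) (E : set C) (f h : C -> C) x y :
  C1eps_close eps d E f h -> E x -> E y -> `|x - y| <= D0 ->
  `|h x - f x| <= d /\ `|(h x - f x) - (h y - f y)| <= d * (1 + D0 `^ eps) * `|x - y|.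
Proof.
move=> [r /andP[r0 rd] hr] Ex Ey xy.
have [h1 h2 _ h4] := hr x Ex; split; first by rewrite distrC (le_trans h1)// ltW.
have := h4 y Ey; have := h2 (y - x).
set u := 'd f x (y - x) - 'd h x (y - x) => hu.
set t := (f y - h y) - (f x - h x) => ht.
have -> : h x - f x - (h y - f y) = t by rewrite /t; ring.
have {}ht : `|t| <= r * `|x - y| `^ (1 + eps) + r * `|x - y|.
  apply: le_trans (norm_le_sub t u) _; rewrite distrC; apply: lerD => //.
  by rewrite [`|x - y|]distrC.
apply: le_trans ht _.
have -> : `|x - y| `^ (1 + eps) = `|x - y| `^ eps * `|x - y|.
  have E0 : (1 + eps == 0) = false by rewrite gt_eqF// addr_gt0.
  by rewrite [1 + eps]addrC powRD ?[eps + 1]addrC ?E0// powRr1.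
have -> : r * (`|x - y| `^ eps * `|x - y|) + r * `|x - y| =
  r * (1 + `|x - y| `^ eps) * `|x - y| by ring.
rewrite ler_wpM2r//; apply: ler_pM; rewrite ?(ltW rd)// ?addr_ge0 ?powR_ge0//.
by rewrite lerD2l; apply: powR_mono.
Qed.

Context (K : Omega eps B) (N : nat) (mu kap r M delta0 : R).
Hypotheses (delta00 : 0 < delta0)
  (hct : forall Kt, Omega_nbhd K delta0 Kt -> controlled N mu kap r M Kt).
Context (c : A -> C) (hc : base_points K c).
Local Notation G := (piece K).
Local Notation g := (cmap K).
Local Notation q := (dist_rate (eps := eps) mu).
Local Notation A1 := (strict_const1 (eps := eps) N kap r M).
Local Notation ks := (kstrict_const (eps := eps) N mu kap r M).
Local Notation ctt := (ctK delta00 hct).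

Lemma shadow_point (e : R) : 0 < e -> exists2 delta : R, 0 < delta &
  forall Kt, Omega_nbhd K delta Kt -> forall a x, cantor_piece Kt a x ->
  exists2 y : C, cantor_piece K a y & `|x - y| < e.
Proof.
move=> e0; have hp := letter_pred hc.
have [d d0 h] := shadow_close eps0 delta00 hct hp e0; exists d => // Kt near a x [Kx Gx].
have [s [s0 Bs hs]] := itinerary_exists Kx Gx.
have [y hy] := shadow_exists ctt hp Bs.
exists y; last exact: h Bs _ _ hs hy.
by split; [exact: itinerary_cantor hy|rewrite -s0; exact: (hy 0%N)].
Qed.

Context (theta : past B) (S : aff R) (W : set C) (H : C -> C).
Hypothesis ext : config_extension K (pastE theta 0) (aff_fun S \o kfun K c theta) W H.
Local Notation a := (pastE theta 0).
Local Notation al := ((\val S).1).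

Lemma aff_funB (T : aff R) (x y : C) : aff_fun T x - aff_fun T y = (\val T).1 * (x - y).
Proof. by rewrite /aff_fun; ring. Qed.

(** The limit geometry is strictly differentiable at the points of the Cantor set,
    and the piece is the closure of its interior, so the derivative of any
    extension is forced. *)
Lemma config_diff x : cantor_set K x -> G a x ->
  forall v, 'd H x v = (al * kder K c theta x * v : C).
Proof.
move=> Kx Gx; have [oW GW /embedding_C1eps cH HE] := ext.
have [L EL] : exists L : {linear C -> C}, (fun v : C => al * kder K c theta x * v : C) = L.
  by apply: linear_pack => k u v; rewrite mulrDr mulc_scale.
move=> v; rewrite -[RHS]/((fun v : C => al * kder K c theta x * v : C) v) EL.
have ks0 := kstrict_const_ge0 eps0 ctt; have nal : 0 <= `|al| by [].
have b0 : 0 < `|al| * ks + 1 by rewrite ltr_wpDl// mulr_ge0.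
apply: (diff_regular_eq eps0 oW cH GW (piece_regular (Omega_axioms K) a) Gx) => e e0.
have [d d0 hd] := powR_small eps0 (divr_gt0 e0 b0).
exists d => // y z Gy Gz yx zx; rewrite -EL !HE//= aff_funB.
have -> : al * (kfun K c theta y - kfun K c theta z) - al * kder K c theta x * (y - z) =
  al * (kfun K c theta y - kfun K c theta z - kder K c theta x * (y - z)) by ring.
have hs := kfun_strict eps0 ctt hc Kx Gx Gy Gz.
have hP : (Num.max `|y - x| `|z - x|) `^ eps <= e / (`|al| * ks + 1).
  by apply: hd; rewrite powR_max_ge0 ge_max !ltW.
set k := ks in ks0 b0 hs hP; set P := _ `^ eps in hs hP.
have P0 : 0 <= P by exact: powR_ge0.
rewrite cnormM; apply: le_trans (ler_wpM2l nal hs) _.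
rewrite mulrA ler_wpM2r// mulrA.
apply: le_trans (_ : (`|al| * k + 1) * P <= _); last by rewrite mulrC -ler_pdivlMr.
by apply: ler_wpM2r => //; rewrite lerDl.
Qed.

(** For points of the perturbed Cantor set that are close to each other the two
    maps have close derivatives and both are uniformly differentiable; for distant
    points it is enough that their values are close. *)
Lemma extension_close (e : R) : 0 < e -> exists2 delta : R, 0 < delta &
  forall Kt ct, Omega_nbhd K delta Kt -> base_near c Kt ct delta ->
  let E x := H x - aff_fun S (kfun Kt ct theta x) in
  (forall x, cantor_piece Kt a x -> W x /\ `|E x| <= e) /\
  forall x y, cantor_piece Kt a x -> cantor_piece Kt a y ->
    `|E x - E y| <= e * `|x - y|.
Proof.
move=> e0; have [oW GW /embedding_C1eps cH HE] := ext.
have [d1 d10 hd1] := C1eps_tame_compact eps0 oW cH (piece_compact (Omega_axioms K) (a := a)) GW.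
have ks0 := kstrict_const_ge0 eps0 ctt.
have s0 : 0 < `|al| by rewrite normr_gt0 aff_neq0.
have i10 : 0 < d1^-1 by rewrite invr_gt0.
set k := ks in ks0; set s := `|al| in s0.
have b0 : 0 < d1^-1 + s * k + 1.
  by apply: ltr_wpDl => //; apply: addr_ge0; [exact: ltW|apply: mulr_ge0 => //; exact: ltW].
have e40 : 0 < e / 4 by rewrite divr_gt0.
have [p1 p10 hp1] := powR_small eps0 (divr_gt0 e40 b0).
pose rho := Num.min p1 d1 / 2.
have m0 : 0 < Num.min p1 d1 by rewrite lt_min p10.
have rho0 : 0 < rho by rewrite divr_gt0.
have rhop : rho + rho <= p1 by rewrite -splitr ge_min lexx.
have rhod : rho + rho <= d1 by rewrite -splitr ge_min lexx orbT.
have [n1 [d2 d20 hk]] := kder_close eps0 delta00 hct hc (divr_gt0 e40 s0).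
pose e2 := Num.min e (e * rho / 2).
have e20 : 0 < e2 by rewrite lt_min e0 divr_gt0// mulr_gt0.
have e22 : 0 < e2 / 2 by rewrite divr_gt0.
have [n2 [d3 d30 hf]] := kfun_close eps0 delta00 hct hc (divr_gt0 e22 s0).
have gC := geo_const_gt0 A1 q.
pose b1 := s * geo_const A1 q + d1^-1.
have b10 : 0 < b1 by rewrite addr_gt0// mulr_gt0.
pose d4 := Num.min (Num.min rho 1) (Num.min (e2 / 2 / b1) (Num.min d2 d3)).
have d40 : 0 < d4 by rewrite !lt_min rho0 ltr01 d20 d30 !divr_gt0.
have l1 : d4 <= rho by rewrite !ge_min lexx.
have l2 : d4 <= 1 by rewrite !ge_min lexx !orbT.
have l3 : d4 <= e2 / 2 / b1 by rewrite !ge_min lexx !orbT.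
have l4 : d4 <= d2 by rewrite !ge_min lexx !orbT.
have l5 : d4 <= d3 by rewrite !ge_min lexx !orbT.
have [d5 d50 hs] := shadow_point d40.
pose d := Num.min (Num.min delta0 d5) (Num.min d2 d3).
have d0 : 0 < d by rewrite !lt_min delta00 d50 d20 d30.
have k0 : d <= delta0 by rewrite !ge_min lexx.
have k5 : d <= d5 by rewrite !ge_min lexx !orbT.
have k2 : d <= d2 by rewrite !ge_min lexx !orbT.
have k3 : d <= d3 by rewrite !ge_min lexx !orbT.
exists d => // Kt ct near bn; have ctu := hct (Omega_nbhd_le k0 near).
have hct' : base_points Kt ct by case: bn.
cbv zeta; set E := fun x : C => H x - aff_fun S (kfun Kt ct theta x).
have C0 x : cantor_piece Kt a x -> W x /\ `|E x| <= e2.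
  move=> Kx; have [y [Ky Gy] xy] := hs Kt (Omega_nbhd_le k5 near) a x Kx.
  have [Wy [_ _ t3]] := hd1 y Gy.
  have xyd : `|x - y| < d1 by have := normr_ge0 (x - y); lra.
  split; first exact: Wy.
  have yy : `|y - y| < d1 by rewrite subrr normr0.
  have := t3 y x y yy xyd yy; rewrite (config_diff Ky Gy) subrr normr0 => h1.
  have {}h1 : `|H x - H y| <= b1 * `|x - y|.
    apply: le_trans (norm_le_sub _ (al * kder K c theta y * (x - y))) _.
    rewrite distrC /b1 mulrDl addrC; apply: lerD.
      rewrite cnormM; apply: ler_wpM2r => //; rewrite cnormM -/s.
      apply: ler_wpM2l; first exact: ltW.
      exact: (kder_upper eps0 ctt hc Gy).
    apply: le_trans h1 _; rewrite ler_wpM2r// ler_piMr ?(ltW i10)//.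
    have m1 : Num.max `|x - y| 0 <= 1 :> R by rewrite ge_max ler01 andbT (le_trans (ltW xy)).
    have m0' : 0 <= Num.max `|x - y| 0 :> R by rewrite le_max lexx orbT.
    by have := powR_mono eps0 m0' m1; rewrite powR1.
  have hkf := hf Kt ct (Omega_nbhd_le k3 near) (base_near_le k3 bn) theta theta
    (fun _ _ => erefl) x y (proj2 Kx) Gy (lt_le_trans xy l5).
  have -> : E x = (H x - H y) - al * (kfun Kt ct theta x - kfun K c theta y).
    by rewrite /E (HE _ Gy) /= /aff_fun; ring.
  apply: le_trans (ler_normB _ _) _; rewrite [e2]splitr; apply: lerD.
    apply: le_trans h1 _; rewrite mulrC -ler_pdivlMr//.
    by apply: le_trans (ltW xy) l3.
  by rewrite cnormM -/s mulrC -ler_pdivlMr// ltW.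
have e2e : e2 <= e by rewrite ge_min lexx.
split=> [x Kx|x y Kx Ky]; first by have [h1 h2] := C0 x Kx; split=> //; exact: le_trans e2e.
have [far|near1] := leP rho `|x - y|.
  apply: le_trans (ler_normB _ _) _.
  apply: le_trans (lerD (proj2 (C0 x Kx)) (proj2 (C0 y Ky))) _.
  apply: le_trans (_ : e * rho <= _); last by rewrite ler_wpM2l// ltW.
  have : e2 <= e * rho / 2 by rewrite ge_min lexx orbT.
  lra.
have [x' [Kx' Gx'] xx'] := hs Kt (Omega_nbhd_le k5 near) a x Kx.
have [_ [_ _ t3]] := hd1 x' Gx'.
have xd : `|x - x'| < d1 by have := normr_ge0 (x - x'); lra.
have yd' : `|y - x'| < rho + rho.
  apply: (@dist_sub_le _ y x); first by rewrite distrC.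
  by apply: le_trans (ltW xx') l1.
have yd : `|y - x'| < d1 by apply: lt_le_trans yd' rhod.
have zz : `|x' - x'| < d1 by rewrite subrr normr0.
have := t3 x' x y zz xd yd; rewrite (config_diff Kx' Gx') => h1.
have h2 := kfun_strict eps0 ctu hct' (theta := theta) (proj1 Kx) (proj2 Kx) (proj2 Kx) (proj2 Ky).
rewrite -/k in h2.
have h3 := hk Kt ct (Omega_nbhd_le k2 near) (base_near_le k2 bn) theta theta
    (fun _ _ => erefl) x x' (proj2 Kx) Gx' (lt_le_trans xx' l4).
pose P := e / 4 / (d1^-1 + s * k + 1).
have P1 : Num.max `|x - x'| `|y - x'| `^ eps <= P.
  apply: hp1; rewrite powR_max_ge0 /= ge_max; apply/andP; split; last by apply: ltW; exact: lt_le_trans rhop.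
  by have := normr_ge0 (x - x'); lra.
have P2 : Num.max `|x - x| `|y - x| `^ eps <= P.
  apply: hp1; rewrite powR_max_ge0 /= ge_max subrr normr0 [`|y - x|]distrC.
  by apply/andP; split; lra.
have EE (hx hy l kx ky v0 v1 be d' : C) : hx - (l * kx + be) - (hy - (l * ky + be)) =
  (hx - hy - l * v0 * d') - l * (kx - ky - v1 * d') - l * (v1 - v0) * d' by ring.
rewrite /E /aff_fun (EE _ _ _ _ _ (kder K c theta x') (kder Kt ct theta x) _ (x - y)).
apply: le_trans (ler_normB _ _) _.
apply: le_trans (lerD (ler_normB _ _) (lexx _)) _.
rewrite !cnormM -/s.
have xy0 := normr_ge0 (x - y).
have PB : (d1^-1 + s * k + 1) * P = e / 4 by rewrite /P mulrC divfK ?gt_eqF.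
have P0 : 0 <= P by apply: divr_ge0; exact: ltW.
have sk0 : 0 <= s * k by apply: mulr_ge0 => //; exact: ltW.
have B1 : `|H x - H y - al * kder K c theta x' * (x - y)| <= e / 4 * `|x - y|.
  apply: le_trans h1 _; rewrite ler_wpM2r//.
  apply: le_trans (ler_wpM2l (ltW i10) P1) _.
  by rewrite -PB; apply: ler_wpM2r => //; lra.
have B2 : s * `|kfun Kt ct theta x - kfun Kt ct theta y - kder Kt ct theta x * (x - y)|
   <= e / 4 * `|x - y|.
  apply: le_trans (ler_wpM2l (ltW s0) h2) _; rewrite mulrA; apply: ler_wpM2r => //; rewrite mulrA.
  apply: le_trans (ler_wpM2l sk0 P2) _.
  by rewrite -PB; apply: ler_wpM2r => //; lra.
have B3 : s * `|kder Kt ct theta x - kder K c theta x'| * `|x - y| <= e / 4 * `|x - y|.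
  by rewrite ler_wpM2r// mulrC -ler_pdivlMr// ltW.
have e4 : e * `|x - y| = 4 * (e / 4 * `|x - y|) by field.
have : 0 <= e / 4 * `|x - y| by rewrite mulr_ge0// ltW.
lra.
Qed.

Lemma config_close (e : R) : 0 < e -> exists2 delta : R, 0 < delta &
  forall Kt ct, Omega_nbhd K delta Kt -> base_near c Kt ct delta ->
  forall Ht, C1eps_close eps delta (W `&` piece Kt a) H Ht ->
  let D x := Ht x - aff_fun S (kfun Kt ct theta x) in
  (forall x, cantor_piece Kt a x -> `|D x| <= e) /\
  forall x y, cantor_piece Kt a x -> cantor_piece Kt a y ->
    `|D x - D y| <= e * `|x - y|.
Proof.
move=> e0; have e20 : 0 < e / 2 by rewrite divr_gt0.
have [d1 d10 h1] := extension_close e20.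
pose b := 1 + diam_const N kap r `^ eps.
have b1 : 1 <= b by rewrite lerDl powR_ge0.
have b0 : 0 < b by exact: lt_le_trans b1.
pose d := Num.min (Num.min delta0 d1) (e / 2 / b).
have d0 : 0 < d by rewrite !lt_min delta00 d10 !divr_gt0.
have k0 : d <= delta0 by rewrite !ge_min lexx.
have k1 : d <= d1 by rewrite !ge_min lexx !orbT.
have k2 : d * b <= e / 2 by rewrite -ler_pdivlMr// !ge_min lexx !orbT.
have k3 : d <= e / 2 by apply: le_trans k2; rewrite ler_peMr// ltW.
exists d => // Kt ct near bn Ht cl; have ctu := hct (Omega_nbhd_le k0 near).
have [h2 h3] := h1 Kt ct (Omega_nbhd_le k1 near) (base_near_le k1 bn).
have key x y : cantor_piece Kt a x -> cantor_piece Kt a y ->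
    `|Ht x - H x| <= d /\ `|(Ht x - H x) - (Ht y - H y)| <= d * b * `|x - y|.
  move=> Kx Ky; apply: (C1eps_close_lipschitz cl).
  - by have [] := h2 x Kx; case: Kx.
  - by have [] := h2 y Ky; case: Ky.
  - by apply: (piece_diam ctu (theta := theta)); [case: Kx|case: Ky].
split=> [x Kx|x y Kx Ky].
  have [l1 _] := key x x Kx Kx; have [_ l2] := h2 x Kx.
  set k := aff_fun _ _ in l2 *; have -> : Ht x - k = (Ht x - H x) + (H x - k) by ring.
  by apply: le_trans (ler_normD _ _) _; lra.
have [_ l1] := key x y Kx Ky; have l2 := h3 x y Kx Ky.
set k := aff_fun _ _ in l2 *; set k' := aff_fun _ _ in l2 *.
have -> : Ht x - k - (Ht y - k') = (Ht x - H x - (Ht y - H y)) + (H x - k - (H y - k')) by ring.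
apply: le_trans (ler_normD _ _) _; rewrite [e]splitr mulrDl; apply: lerD => //.
by apply: le_trans l1 _; rewrite ler_wpM2r.
Qed.

End PerturbedConfigurations.

(** * Orbits of renormalized configurations *)

Section Separation.
Context {R : realType}.
Local Notation C := (Rcomplex R).

Lemma compact_closed_C (S : set C) : compact S -> closed S.
Proof. by apply: compact_closed; exact: norm_hausdorff. Qed.

Lemma compact_separated (S T : set C) : compact S -> compact T -> ~ ((S `&` T) !=set0) ->
  exists2 d : R, 0 < d & forall x y, S x -> T y -> d <= `|x - y|.
Proof.
move=> cS cT ST; have oT : open (~` T) by apply: closed_openC; exact: compact_closed_C.
have sub : S `<=` ~` T by move=> x Sx Tx; apply: ST; exists x.
have [d d0 hd] := compact_subset_ball cS oT sub; exists d => // x y Sx Ty.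
by rewrite leNgt; apply/negP; rewrite distrC => /(hd _ Sx _).
Qed.

End Separation.

Section CantorPieces.
Context {R : realType} {eps : R} {A : finType} {B : rel A}.
Hypothesis eps0 : 0 < eps.
Local Notation C := (Rcomplex R).
Context (K : Omega eps B).
Local Notation G := (piece K).
Local Notation g := (cmap K).

(** The closure of the Cantor set stays in the pieces and is forward invariant,
    by continuity of the map on them. *)
Lemma cantor_set_closed : closed (cantor_set K).
Proof.
have cl : closure (cantor_set K) `<=` pieces K.
  have cP : closed (pieces K) by apply: compact_closed_C; exact: pieces_compact.
  move=> x cx; apply: cP => U Ux; have [y [Ky Uy]] := cx U Ux.
  by exists y; split=> //; exact: Ky 0%N.
have inv x : closure (cantor_set K) x -> closure (cantor_set K) (g x).
  move=> cx U Ux; have [e e0 he] := proj1 (nbhs_cP _ _) Ux.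
  have [d d0 hd] := cmap_cont (pieces_dom (cl _ cx)) e0.
  have [y [Ky xy]] : (cantor_set K `&` [set y | `|y - x| < d]) !=set0.
    by apply: cx; apply/nbhs_cP; exists d.
  by exists (g y); split; [move=> n; have := Ky n.+1; rewrite iterSr|exact/he/hd].
move=> x cx n; suff /cl : closure (cantor_set K) (iter n g x) by [].
by elim: n => // n IH; rewrite iterS; exact: inv.
Qed.

Lemma cantor_piece_compact a : compact (cantor_piece K a).
Proof.
apply: (@subclosed_compact _ _ (G a)) => [||x []//]; last first.
  exact: (piece_compact (Omega_axioms K) (a := a)).
apply: closedI; first exact: cantor_set_closed.
apply: compact_closed_C; exact: (piece_compact (Omega_axioms K) (a := a)).
Qed.

End CantorPieces.

Section BoundedShape.
Context {R : realType} {A A' : finType} {B : rel A} {B' : rel A'}.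
Local Notation C := (Rcomplex R).
Local Notation pairs := (limit_pair R B B').
Local Notation rc := (@rel_class R A A' B B').

(** Both ratios are invariant under the affine group, so they are functions on the
    space of relative configurations. *)
Definition bounded_shape (b : R) (p : pairs) : Prop :=
  `|(\val p.1.1).2 - (\val p.2.1).2| <= b * `|(\val p.1.1).1| /\
  `|(\val p.1.1).1| <= b * `|(\val p.2.1).1|.

Lemma bounded_shape_act b T p : bounded_shape b p -> bounded_shape b (aff_act T p).
Proof.
case: p => [[S th] [S' th']]; rewrite /bounded_shape /= => -[h1 h2].
have E (t x y s : C) : t * x + s - (t * y + s) = t * (x - y) by ring.
rewrite E !cnormM; split; rewrite mulrCA.
  by apply: ler_wpM2l.
by apply: ler_wpM2l.
Qed.

Lemma compact_bounded_shape (L : set (rel_limit_config R B B')) : compact L ->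
  exists2 b : R, 0 < b & forall p, L (rc p) -> bounded_shape b p.
Proof.
move=> cL; pose Q (e : R) v := forall p, rc p = v -> bounded_shape e^-1 p.
have [v Lv|e e0 he] := @compact_uniform_top R _ L Q cL; last first.
  by exists e^-1 => [|p Lp]; [rewrite invr_gt0|exact: he Lp _ erefl].
have [p0 Ep] := rel_class_surj v; subst v.
have n1 : 0 < `|(\val p0.1.1).1| by rewrite normr_gt0 aff_neq0.
have n2 : 0 < `|(\val p0.2.1).1| by rewrite normr_gt0 aff_neq0.
set x1 := `|(\val p0.1.1).1| in n1; set x2 := `|(\val p0.2.1).1| in n2.
set y := `|(\val p0.1.1).2 - (\val p0.2.1).2|.
have y0 : 0 <= y by exact: normr_ge0.
pose m := Num.min (x1 / 2) (Num.min (x2 / 2) 1).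
have m0 : 0 < m by rewrite !lt_min ltr01 !divr_gt0.
have m1 : m <= x1 / 2 by rewrite ge_min lexx.
have m2 : m <= x2 / 2 by rewrite !ge_min lexx !orbT.
have m3 : m <= 1 by rewrite !ge_min lexx !orbT.
pose V := [set p : pairs | near_pair m 0 p p0].
exists (rc @` V).
  by apply: rel_class_open; apply/pair_nbhsP; exists 0%N, m.
pose b := (y + 2) / m + (x1 + 1) / m.
have b0 : 0 < b by apply: addr_gt0; apply: divr_gt0 => //; [exact: ltr_wpDl|exact: addr_gt0].
exists b^-1; first by rewrite invr_gt0.
move=> _ e [p [[[h1 h2] _] [[h3 h4] _]] <-] /andP[e0 eb] p' /rel_classP [T Ep].
have be : b <= e^-1 by rewrite -[b]invrK lef_pV2 ?posrE ?invr_gt0// ltW.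
have ie0 : 0 < e^-1 by rewrite invr_gt0.
suff hp : bounded_shape e^-1 p.
  have [U ->] : exists U, p' = aff_act U p by apply/rel_classP/esym/rel_classP; exists T.
  exact: bounded_shape_act.
have g1 : m <= `|(\val p.1.1).1|.
  by have := norm_le_sub (\val p0.1.1).1 (\val p.1.1).1; rewrite -/x1; lra.
have g2 : m <= `|(\val p.2.1).1|.
  by have := norm_le_sub (\val p0.2.1).1 (\val p.2.1).1; rewrite -/x2; lra.
have d1 : 0 <= (y + 2) / m by apply: divr_ge0; [exact: addr_ge0|exact: ltW].
have d2 : 0 <= (x1 + 1) / m by apply: divr_ge0; [apply: addr_ge0 => //; exact: ltW|exact: ltW].
split.
  apply: le_trans (_ : y + 2 <= _).
    have E (s t s0 t0 : C) : s - t = (s0 - t0) + ((s - s0) - (t - t0)) by ring.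
    rewrite (E _ _ (\val p0.1.1).2 (\val p0.2.1).2).
    apply: le_trans (ler_normD _ _) _; apply: lerD => //.
    by apply: le_trans (ler_normB _ _) _; lra.
  have -> : y + 2 = (y + 2) / m * m by rewrite divfK ?gt_eqF.
  by apply: ler_pM => //; [exact: ltW|apply: le_trans be; rewrite /b lerDl].
apply: le_trans (_ : x1 + 1 <= _).
  by have := norm_le_sub (\val p.1.1).1 (\val p0.1.1).1; rewrite -/x1 distrC; lra.
have -> : x1 + 1 = (x1 + 1) / m * m by rewrite divfK ?gt_eqF.
by apply: ler_pM => //; [exact: ltW|apply: le_trans be; rewrite /b lerDr].
Qed.

End BoundedShape.

Section Orbit.
Context {R : realType} {eps : R} {A : finType} {B : rel A}.
Hypothesis eps0 : 0 < eps.
Local Notation C := (Rcomplex R).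
Context (N : nat) (mu kap r M : R) (K : Omega eps B)
  (ct : controlled N mu kap r M K) (c : A -> C) (hc : base_points K c).
Local Notation G := (piece K).
Local Notation kf := (kfun K c).
Local Notation q := (dist_rate (eps := eps) mu).
Local Notation A1 := (strict_const1 (eps := eps) N kap r M).
Context (theta : past B) (S : aff R) (D : C -> C) (e : R).
Local Notation a := (pastE theta 0).
Hypotheses (e0 : 0 <= e) (D0 : forall x, cantor_piece K a x -> `|D x| <= e)
  (DL : forall x y, cantor_piece K a x -> cantor_piece K a y -> `|D x - D y| <= e * `|x - y|).

(** It bounds [`|D x - D y| / (e * |F|)] for [x] and [y] in the image of an inverse
    branch with [F o k^u = k^theta o f]; the additional 1 accounts for the initial
    state, where [d = 0] is not a value of [D]. *)
Definition defect_const : R := geo_const A1 q * (geo_const A1 q * diam_const N kap r) + 1.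

Lemma defect_const_ge1 : 1 <= defect_const.
Proof.
have gC := geo_const_gt0 A1 q; have dc := diam_const_ge0 ct.
by rewrite lerDr mulr_ge0// ?(ltW gC)// mulr_ge0// ltW.
Qed.

(** The renormalized configuration [S o k^theta o f] of the piece of [u], where [f] is
    the inverse branch given by the last [m] letters of [u], is written as
    [S o F o k^u]; [D] is the deviation from [S o k^theta] of the actual
    configuration, and [d] represents its values on the image of [f]. *)
Definition renormalized_state (u : past B) (m : nat) (F : aff R) (d : C) : Prop :=
  [/\ pastE u m = a,
      forall z, G (pastE u 0) z -> aff_fun F (kf u z) = kf theta (back K u m z) &
      forall z, cantor_piece K (pastE u 0) z ->
        `|D (back K u m z) - d| <= e * defect_const * `|(\val F).1|].

Definition deviated (F : aff R) (d : C) : aff R :=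
  aff_comp (translate d) (aff_comp S F).

Lemma initial_state : renormalized_state theta 0 (aff1 R) 0.
Proof.
split=> // z; first by rewrite back0 /aff_fun /= mul1r addr0.
move=> Kz; rewrite back0 subr0 /= cnorm1 mulr1.
by apply: le_trans (D0 Kz) _; rewrite ler_peMr// defect_const_ge1.
Qed.

Lemma deviated_initial : deviated (aff1 R) 0 = S.
Proof. by rewrite /deviated aff_comp1r translate0. Qed.

Lemma state_point u m F d z : renormalized_state u m F d -> cantor_piece K (pastE u 0) z ->
  cantor_piece K a (back K u m z).
Proof.
move=> [um _ _] [Kz Gz]; split; first exact: back_cantor.
by rewrite -um; exact: back_in.
Qed.

(** The deviation is almost constant on the image of [f], at the scale of [F]; its
    variation from one step to the next is a translation [tau] in the coordinates
    of the renormalized piece. *)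
Lemma next_state u m F d w : renormalized_state u m F d -> composable u w ->
  let u1 := concat u w in let m1 := (m + word_size w)%N in
  let T := transition K c u w in
  let d1 := D (back K u1 m1 (c (pastE u1 0))) in
  renormalized_state u1 m1 (aff_comp F T) d1 /\
  exists2 tau : C, `|tau| <= e * defect_const / `|(\val S).1| &
    aff_comp (deviated F d) (aff_comp (translate tau) T) = deviated (aff_comp F T) d1.
Proof.
move=> st cw u1 m1 T d1; have [um hF hd] := st.
have bk z : G (pastE u1 0) z -> back K u m (word_map K w z) = back K u1 m1 z.
  by move=> Gz; rewrite -(back_concat m cw Gz).
have um1 : pastE u1 m1 = a by rewrite /u1 /m1 concat_shift.
have Kc : cantor_piece K (pastE u1 0) (c (pastE u1 0)) by exact: hc.
have hF1 z : G (pastE u1 0) z -> aff_fun (aff_comp F T) (kf u1 z) = kf theta (back K u1 m1 z).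
  move=> Gz; rewrite aff_funM (transitionP eps0 ct hc cw Gz) hF ?bk//.
  exact: word_map_in cw Gz.
have pt z : cantor_piece K (pastE u1 0) z -> cantor_piece K a (back K u1 m1 z).
  move=> [Kz Gz]; split; first exact: back_cantor.
  by rewrite -um1; exact: back_in.
have gC := geo_const_gt0 A1 q; have gC0 := ltW gC.
split.
  split=> // z Kz; have [_ Gz] := Kz; have [_ Gc] := Kc.
  apply: le_trans (DL (pt _ Kz) (pt _ Kc)) _; rewrite -mulrA; apply: ler_wpM2l => //.
  apply: le_trans (kfun_lower eps0 ct hc (proj2 (pt _ Kz)) (proj2 (pt _ Kc))) _.
  rewrite -!hF1// aff_funB cnormM mulrCA mulrC; apply: ler_wpM2r => //.
  apply: le_trans (_ : geo_const A1 q * (geo_const A1 q * diam_const N kap r) <= _); last by rewrite lerDl.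
  apply: ler_wpM2l => //; apply: le_trans (kfun_upper eps0 ct hc Gz Gc) _.
  apply: ler_wpM2l => //; exact (piece_diam ct Gz Gc).
have s0 := aff_neq0 S; have f0 := aff_neq0 F.
(* This [tau] is the increment of the deviation, read in the coordinates of the piece of [u]. *)
exists ((d1 - d) / ((\val S).1 * (\val F).1)).
  rewrite cnormM cnormV cnormM ler_pdivrMr ?mulr_gt0 ?normr_gt0//.
  have -> : e * defect_const / `|(\val S).1| * (`|(\val S).1| * `|(\val F).1|) =
    e * defect_const * `|(\val F).1|.
    by field; rewrite normr_eq0.
  have [_ Gc] := Kc; rewrite /d1 -bk//; apply: hd; split.
    exact: word_map_cantor cw Gc (proj1 Kc).
  exact: word_map_in cw Gc.
apply: val_inj => /=; rewrite !mul1r.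
congr pair; first by rewrite mulrA.
by field; rewrite s0 f0.
Qed.

(** [F] carries [k^u], whose values at two well chosen points of each piece are
    distinct, to the restriction of [k^theta] to the image of a branch that
    contracts by [mu^-1] at each letter. *)
Lemma state_decay : exists2 b : R, 0 < b & forall u m F d,
  renormalized_state u m F d -> `|(\val F).1| <= b * mu^-1 ^+ m.
Proof.
pose P x (l : R) := exists2 z, G x z & l <= `|z - c x|.
have [x|x l l' l'0 ll' [z Gz hz]|l l0 hl] := @fin_uniform R A P.
- have [z Gz zc] := piece_other K x (c x).
  by exists `|z - c x|; [rewrite normr_gt0 subr_eq0|exists z].
- by exists z => //; exact: le_trans hz.
have gC := geo_const_gt0 A1 q; have dc := diam_const_ge0 ct.
have mu1 := ctrl_mu ct; have mu0 : 0 < mu by exact: lt_trans mu1.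
pose b := geo_const A1 q * (diam_const N kap r + 1) * (geo_const A1 q / l).
have b0 : 0 < b by rewrite !mulr_gt0 ?invr_gt0// ltr_wpDl.
exists b => // u m F d [um hF _].
have [z Gz hz] := hl (pastE u 0); have Gc := base_piece hc (pastE u 0).
have h1 : l <= geo_const A1 q * `|kf u z|.
  apply: le_trans hz _; have := kfun_lower eps0 ct hc Gz Gc.
  by rewrite (kfun_base eps0 ct hc) subr0.
have h2 : `|(\val F).1| * `|kf u z| <= geo_const A1 q * (diam_const N kap r * mu^-1 ^+ m).
  have E : (\val F).1 * kf u z = aff_fun F (kf u z) - aff_fun F (kf u (c (pastE u 0))).
    by rewrite aff_funB (kfun_base eps0 ct hc) subr0.
  rewrite -cnormM E !hF//.
  have Gz' : G a (back K u m z) by rewrite -um; exact: back_in.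
  have Gc' : G a (back K u m (c (pastE u 0))) by rewrite -um; exact: back_in.
  apply: le_trans (kfun_upper eps0 ct hc Gz' Gc') _.
  by apply: ler_wpM2l; [exact: ltW|exact (back_diam ct m Gz Gc)].
have nu0 : 0 <= mu^-1 ^+ m by rewrite exprn_ge0// invr_ge0 ltW.
have h3 : `|(\val F).1| <= `|(\val F).1| * `|kf u z| * (geo_const A1 q / l).
  rewrite -mulrA ler_peMr// mulrA ler_pdivlMr// mul1r mulrC; exact: h1.
apply: le_trans h3 _.
have -> : b * mu^-1 ^+ m = geo_const A1 q * ((diam_const N kap r + 1) * mu^-1 ^+ m) * (geo_const A1 q / l).
  by rewrite /b; ring.
apply: ler_wpM2r; first by apply: divr_ge0; exact: ltW.
apply: le_trans h2 _; apply: ler_wpM2l; first exact: ltW.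
by apply: ler_wpM2r => //; rewrite lerDl.
Qed.

Lemma deviated_value u m F d (h : C -> C) : renormalized_state u m F d ->
  (forall x, D x = h x - aff_fun S (kf theta x)) ->
  d = D (back K u m (c (pastE u 0))) ->
  (\val (deviated F d)).2 = h (back K u m (c (pastE u 0))).
Proof.
move=> [_ hF _] hD ->; have Gc := base_piece hc (pastE u 0).
rewrite hD -(hF _ Gc) (kfun_base eps0 ct hc) /aff_fun /=.
by ring.
Qed.

End Orbit.

(** * Stable intersections *)

Section Tracking.
Context {R : realType} {eps : R} {A : finType} {B : rel A}.
Hypothesis eps0 : 0 < eps.
Local Notation C := (Rcomplex R).

(** What the argument on pairs retains of [renormalized_state]: [T] is the affine
    map [S o F] corrected by the deviation [d].  The boolean is false for the initial
    state only, where the correction is absent and nothing is said of the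
    translation part. *)
Record tracking (K : Omega eps B) (c : A -> C) (theta : past B) (S : aff R)
    (h : C -> C) (tol : R) (St : bool -> past B -> nat -> aff R -> Prop) : Prop := Tracking {
  tracking_init : St false theta 0%N S ;
  tracking_next : forall b u m T w, St b u m T -> composable u w ->
    exists2 tau : C, `|tau| < tol &
      St true (concat u w) (m + word_size w)%N
         (aff_comp T (aff_comp (translate tau) (transition K c u w))) ;
  tracking_decay : forall eta : R, 0 < eta -> exists n, forall b u m T,
    St b u m T -> (n <= m)%N -> `|(\val T).1| <= eta ;
  tracking_value : forall u m T, St true u m T ->
    (h @` cantor_piece K (pastE theta 0)) (\val T).2 }.

Lemma tracking_exists (N : nat) (mu kap r M : R) (K : Omega eps B) (c : A -> C)
    (theta : past B) (S : aff R) (h : C -> C) (e tol : R) :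
  controlled N mu kap r M K -> base_points K c -> 0 <= e ->
  let D x := h x - aff_fun S (kfun K c theta x) in
  (forall x, cantor_piece K (pastE theta 0) x -> `|D x| <= e) ->
  (forall x y, cantor_piece K (pastE theta 0) x -> cantor_piece K (pastE theta 0) y ->
    `|D x - D y| <= e * `|x - y|) ->
  e * defect_const (eps := eps) N mu kap r M / `|(\val S).1| < tol ->
  exists St, tracking K c theta S h tol St.
Proof.
move=> ct hc e0 D D0 DL etol.
pose St (b : bool) (u : past B) (m : nat) (T : aff R) : Prop := exists F d,
  [/\ renormalized_state N mu kap r M K c theta D e u m F d, T = deviated S F d &
      b -> d = D (back K u m (c (pastE u 0)))].
exists St; split.
- exists (aff1 R), 0; split=> //; first exact: (initial_state ct c e0 D0).
  by rewrite deviated_initial.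
- move=> b u m T w [F [d [st -> _]]] cw.
  have [st1 [tau htau ET]] := next_state eps0 ct hc S e0 DL st cw.
  exists tau; first exact: le_lt_trans etol.
  rewrite ET; exists (aff_comp F (transition K c u w)).
  by exists (D (back K (concat u w) (m + word_size w) (c (pastE (concat u w) 0)))).
- move=> eta eta0; have [b b0 hb] := state_decay eps0 ct hc theta D e.
  have mu0 : 0 < mu by exact: lt_trans (ctrl_mu ct).
  have nu : 0 <= mu^-1 < 1 by rewrite invr_ge0 (ltW mu0) invf_lt1// (ctrl_mu ct).
  have s0 : 0 < `|(\val S).1| by rewrite normr_gt0 aff_neq0.
  have [n hn] := expr_lt_exists nu (divr_gt0 eta0 (mulr_gt0 s0 b0)).
  exists n => _ u m T [F [d [st -> _]]] nm /=; rewrite mul1r cnormM.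
  apply: le_trans (ler_wpM2l (ltW s0) (hb _ _ _ _ st)) _.
  rewrite mulrA mulrC -ler_pdivlMr ?mulr_gt0//; apply: le_trans (ltW hn).
  by case/andP: nu => nu0 nu1; exact: ler_wiXn2l nu0 (ltW nu1) _ _ nm.
move=> u m T [F [d [st -> hd]]].
exists (back K u m (c (pastE u 0))).
  by apply: state_point st _; exact: hc.
by rewrite (deviated_value eps0 ct hc (h := h) st (fun=> erefl) (hd isT)).
Qed.

End Tracking.

Section Intersection.
Context {R : realType} {eps : R} {A A' : finType} {B : rel A} {B' : rel A'}.
Hypothesis eps0 : 0 < eps.
Local Notation C := (Rcomplex R).
Local Notation rc := (@rel_class R A A' B B').

(** The pairs of affine maps stay in [L], where the distance between their
    translation parts is at most a multiple of either linear part.  At each step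
    one of the two words grows, so after many steps one of the linear parts is
    small, while both translation parts are points of the two images. *)
Lemma tracked_intersection (K : Omega eps B) (K' : Omega eps B') (c : A -> C) (c' : A' -> C)
    (theta : past B) (theta' : past B') (S S' : aff R) (h h' : C -> C) (tol : R) St St'
    (L : set (rel_limit_config R B B')) :
  tracking K c theta S h tol St -> tracking K' c' theta' S' h' tol St' ->
  compact (h @` cantor_piece K (pastE theta 0)) ->
  compact (h' @` cantor_piece K' (pastE theta' 0)) ->
  compact L -> L (rc ((S, theta), (S', theta'))) ->
  (forall p, L (rc p) -> exists w w', [/\ composable p.1.2 w, composable p.2.2 w',
      (word_size w + word_size w')%N == 1%N &
      forall tau tau' : C, `|tau| < tol -> `|tau'| < tol ->
        interior L (rc (renorm_pair K K' c c' tau tau' w w' p))]) ->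
  ((h @` cantor_piece K (pastE theta 0)) `&` (h' @` cantor_piece K' (pastE theta' 0))) !=set0.
Proof.
move=> tr tr' cX cX' cL L0 hL; apply: contrapT => disj.
have [d d0 hd] := compact_separated cX cX' disj.
have orbit j : exists u m T u' m' T', [/\ St (0 < j)%N u m T, St' (0 < j)%N u' m' T',
    (m + m')%N = j & L (rc ((T, u), (T', u')))].
  elim: j => [|j [u [m [T [u' [m' [T' [st st' mm Lp]]]]]]]].
    by exists theta, 0%N, S, theta', 0%N, S'; split=> //;
      [exact: tracking_init tr|exact: tracking_init tr'].
  have [w [w' [/= cw cw' ww hw]]] := hL _ Lp.
  have [tau ht st1] := tracking_next tr st cw.
  have [tau' ht' st1'] := tracking_next tr' st' cw'.
  exists (concat u w), (m + word_size w)%N.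
  exists (aff_comp T (aff_comp (translate tau) (transition K c u w))).
  exists (concat u' w'), (m' + word_size w')%N.
  exists (aff_comp T' (aff_comp (translate tau') (transition K' c' u' w'))).
  split=> //; last exact: (interior_subset (hw _ _ ht ht')).
  by rewrite addnACA mm (eqP ww) addn1.
have [b b0 hb] := compact_bounded_shape cL.
have bn0 : b != 0 by rewrite gt_eqF.
(* The thresholds are such that either alternative yields the contradiction [d <= d / 2]. *)
have e10 : 0 < d / (2 * b) by rewrite divr_gt0// mulr_gt0.
have e20 : 0 < d / (2 * (b * b)) by rewrite divr_gt0// !mulr_gt0.
have [n hn] := tracking_decay tr e10; have [n' hn'] := tracking_decay tr' e20.
have [u [m [T [u' [m' [T' [st st' mm Lp]]]]]]] := orbit (n + n').+1.
have [/= s1 s2] := hb _ Lp.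
have dT := hd _ _ (tracking_value tr st) (tracking_value tr' st').
have [nm|mn] := leqP n m.
  have h1 := hn _ _ _ _ st nm.
  have : d <= b * (d / (2 * b)).
    by apply: le_trans dT (le_trans s1 _); rewrite ler_wpM2l// ltW.
  have -> : b * (d / (2 * b)) = d / 2 by field.
  lra.
have nm' : (n' <= m')%N.
  by rewrite -(leq_add2l n); apply: ltnW; rewrite -mm leq_add2r ltnW.
have h1 := hn' _ _ _ _ st' nm'.
have : d <= b * (b * (d / (2 * (b * b)))).
  apply: le_trans dT (le_trans s1 _); rewrite ler_wpM2l ?(ltW b0)//.
  by apply: le_trans s2 _; rewrite ler_wpM2l// ltW.
have -> : b * (b * (d / (2 * (b * b)))) = d / 2 by field.
lra.
Qed.

End Intersection.

Section StableIntersections.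
Context {R : realType} {eps : R} {A A' : finType} {B : rel A} {B' : rel A'}.
Hypothesis eps0 : 0 < eps.
Local Notation C := (Rcomplex R).
Local Notation rc := (@rel_class R A A' B B').

Lemma config_extension_eq (A1 : finType) (B1 : rel A1) (K : Omega eps B1) a (h h' : C -> C) W H :
  (forall z, piece K a z -> h z = h' z) ->
  config_extension K a h W H -> config_extension K a h' W H.
Proof. by move=> hh [h1 h2 h3 h4]; split=> // z Gz; rewrite h4// hh. Qed.

Lemma limit_config_eq (A1 : finType) (B1 : rel A1) (K : Omega eps B1) (c : A1 -> C)
    (hc : base_points K c) (S : aff R) (theta : past B1) z : piece K (pastE theta 0) z ->
  (aff_fun S \o kfun K c theta) z = (aff_fun S \o limit_geometry K c theta) z.
Proof. by move=> Gz /=; rewrite (limit_geometryE eps0 hc Gz). Qed.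

(** The Lipschitz constant of the deviation is chosen so small that the translations
    produced along the orbit remain below the tolerance. *)
Lemma tracking_near (A1 : finType) (B1 : rel A1) (K : Omega eps B1) (c : A1 -> C)
    (hc : base_points K c) (theta : past B1) (S : aff R) W H (tol : R) : 0 < tol ->
  config_extension K (pastE theta 0) (aff_fun S \o limit_geometry K c theta) W H ->
  exists2 delta : R, 0 < delta & forall Kt ct,
    Omega_nbhd K delta Kt -> base_near c Kt ct delta -> forall ht Wt Ht,
    config_extension Kt (pastE theta 0) ht Wt Ht ->
    C1eps_close eps delta (W `&` piece Kt (pastE theta 0)) H Ht ->
    exists St, tracking Kt ct theta S ht tol St.
Proof.
move=> tol0 ext; have [N [mu [kap [r [M [d0 d00 hct]]]]]] := near_controlled eps0 K.
have {}ext : config_extension K (pastE theta 0) (aff_fun S \o kfun K c theta) W H.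
  by apply: config_extension_eq ext => z Gz; rewrite (limit_config_eq hc).
have s0 : 0 < `|(\val S).1| by rewrite normr_gt0 aff_neq0.
have dc0 : 0 < defect_const (eps := eps) N mu kap r M.
  exact: lt_le_trans ltr01 (defect_const_ge1 (ctK d00 hct)).
set dc := defect_const _ _ _ _ _ in dc0.
pose e := tol * `|(\val S).1| / dc / 2.
have e0 : 0 < e by rewrite !divr_gt0// mulr_gt0.
have [d d'0 hd] := config_close eps0 d00 hct hc ext e0.
exists (Num.min d0 d) => [|Kt ct near bn ht Wt Ht ext' cl]; first by rewrite lt_min d00.
have l0 : Num.min d0 d <= d0 by rewrite ge_min lexx.
have l1 : Num.min d0 d <= d by rewrite ge_min lexx orbT.
have cl' : C1eps_close eps d (W `&` piece Kt (pastE theta 0)) H Ht.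
  by case: cl => s /andP[s1 s2] hs; exists s => //; rewrite s1 (lt_le_trans s2).
have [h1 h2] := hd Kt ct (Omega_nbhd_le l1 near) (base_near_le l1 bn) Ht cl'.
have [_ _ _ HE] := ext'.
have tr := @tracking_exists R eps A1 B1 eps0 N mu kap r M Kt ct theta S ht e tol
  (hct _ (Omega_nbhd_le l0 near)) (proj1 bn) (ltW e0).
apply: tr.
- by move=> x Kx; rewrite -HE; [exact: h1|case: Kx].
- by move=> x y Kx Ky; rewrite -!HE; [exact: h2|case: Ky|case: Kx].
rewrite -/dc; have -> : e * dc / `|(\val S).1| = tol / 2.
  by rewrite /e; field; rewrite (gt_eqF dc0) (gt_eqF s0).
lra.
Qed.

Lemma config_image_compact (A1 : finType) (B1 : rel A1) (K : Omega eps B1) a (h : C -> C) W H :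
  config_extension K a h W H -> compact (h @` cantor_piece K a).
Proof.
move=> [oW GW /embedding_C1eps cH HE].
have -> : h @` cantor_piece K a = H @` cantor_piece K a.
  by apply/seteqP; split=> _ [x [Kx Gx] <-]; exists x => //; rewrite HE.
apply: (compact_image cH); last exact: cantor_piece_compact.
by move=> x [_ Gx]; exact: GW.
Qed.

Context (K : Omega eps B) (K' : Omega eps B') (c : A -> C) (c' : A' -> C)
  (hc : base_points K c) (hc' : base_points K' c').

Lemma limit_geometry_config (A1 : finType) (B1 : rel A1) (K1 : Omega eps B1) (c1 : A1 -> C)
    (S : aff R) (theta : past B1) : base_points K1 c1 ->
  is_config K1 (pastE theta 0) (aff_fun S \o limit_geometry K1 c1 theta).
Proof.
move=> h1; have [N [mu [kap [r [M [d d0 hct]]]]]] := near_controlled eps0 K1.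
have [W [H ext]] := kfun_config eps0 (hct _ (Omega_nbhd_refl _ d0)) h1 theta S.
by exists W, H; apply: config_extension_eq ext => z; exact: limit_config_eq.
Qed.

Lemma recurrent_stable (L : set (rel_limit_config R B B')) (S S' : aff R)
    (theta : past B) (theta' : past B') :
  recurrent K K' c c' L -> L (rc ((S, theta), (S', theta'))) ->
  stable_intersections K K' (pastE theta 0) (pastE theta' 0)
    (aff_fun S \o limit_geometry K c theta) (aff_fun S' \o limit_geometry K' c' theta').
Proof.
move=> hL Lp; split; try exact: limit_geometry_config.
move=> W H W' H' ext ext'.
have [L1 hL1 LL1] := immediately_recurrent_hull eps0 hc hc' hL.
have [e e0 he] := uniform_recurrence eps0 hc hc' hL1.
have [d d0 hd] := tracking_near hc e0 ext.
have [d' d'0 hd'] := tracking_near hc' e0 ext'.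
pose m := Num.min e (Num.min d d').
have m0 : 0 < m by rewrite !lt_min e0 d0.
have lme : m <= e by rewrite ge_min lexx.
have lmd : m <= d by rewrite !ge_min lexx !orbT.
have lmd' : m <= d' by rewrite !ge_min lexx !orbT.
have [b b0 hb] := base_points_exist eps0 hc m0.
have [b' b'0 hb'] := base_points_exist eps0 hc' m0.
exists m => //.
exists (Omega_nbhd K (Num.min m b), Omega_nbhd K' (Num.min m b')).
  by split; apply: Omega_nbhd_nbhs => //; rewrite lt_min m0.
move=> [Kt Kt'] /= [near near'] ht Wt Ht ht' Wt' Ht' extt extt' cl cl'.
have nm : Omega_nbhd K m Kt by apply: Omega_nbhd_le near; rewrite ge_min lexx.
have nm' : Omega_nbhd K' m Kt' by apply: Omega_nbhd_le near'; rewrite ge_min lexx.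
have [|ct bn] := hb Kt; first by apply: Omega_nbhd_le near; rewrite ge_min lexx orbT.
have [|ct' bn'] := hb' Kt'; first by apply: Omega_nbhd_le near'; rewrite ge_min lexx orbT.
have close (A1 : finType) (B1 : rel A1) (E : set C) (f k : C -> C) (s : R) :
  m <= s -> C1eps_close eps m E f k -> C1eps_close eps s E f k.
  by move=> ms [t /andP[t1 t2] ht0]; exists t => //; rewrite t1 (lt_le_trans t2).
have [St tr] := hd Kt ct (Omega_nbhd_le lmd nm) (base_near_le lmd bn) ht Wt Ht extt
  (close _ B _ _ _ _ lmd cl).
have [St' tr'] := hd' Kt' ct' (Omega_nbhd_le lmd' nm') (base_near_le lmd' bn') ht' Wt' Ht' extt'
  (close _ B' _ _ _ _ lmd' cl').
apply: (tracked_intersection tr tr' _ _ (proj1 hL1) (LL1 _ Lp)).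
- exact: config_image_compact extt.
- exact: config_image_compact extt'.
- move=> p L1p.
  exact: he Kt Kt' ct ct' p (Omega_nbhd_le lme nm) (Omega_nbhd_le lme nm')
    (base_near_le lme bn) (base_near_le lme bn') L1p.
Qed.

End StableIntersections.

Theorem theoremB (R : realType) (eps : R) (eps_gt0 : 0 < eps)
    (A A' : finType) (B : rel A) (B' : rel A')
    (K : Omega eps B) (K' : Omega eps B')
    (c : A -> Rcomplex R) (c' : A' -> Rcomplex R)
    (hc : base_points K c) (hc' : base_points K' c') :
  [/\ (forall L : set (rel_limit_config R B B'),
         recurrent K K' c c' L ->
         exists2 L1 : set (rel_limit_config R B B'),
           immediately_recurrent K K' c c' L1 & L `<=` L1),
      (forall L : set (rel_limit_config R B B'),
         recurrent K K' c c' L ->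
         forall rho : R, 0 < rho -> \forall KK \near (K, K'),
         exists (ct : A -> Rcomplex R) (ct' : A' -> Rcomplex R),
           [/\ base_points KK.1 ct, base_points KK.2 ct',
               forall a, `|ct a - c a| < rho,
               forall a', `|ct' a' - c' a'| < rho &
               recurrent KK.1 KK.2 ct ct' L]),
      (forall L : set (rel_limit_config R B B'),
         immediately_recurrent K K' c c' L ->
         forall rho : R, 0 < rho -> \forall KK \near (K, K'),
         exists (ct : A -> Rcomplex R) (ct' : A' -> Rcomplex R),
           [/\ base_points KK.1 ct, base_points KK.2 ct',
               forall a, `|ct a - c a| < rho,
               forall a', `|ct' a' - c' a'| < rho &
               immediately_recurrent KK.1 KK.2 ct ct' L]) &
      (forall (L : set (rel_limit_config R B B'))
         (T T' : aff R) (theta : past B) (theta' : past B'),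
         recurrent K K' c c' L ->
         L (rel_class ((T, theta), (T', theta'))) ->
         forall hh, relative_config (aff_fun T \o limit_geometry K c theta)
                      (aff_fun T' \o limit_geometry K' c' theta') hh ->
           stable_intersections K K' (pastE theta 0%N) (pastE theta' 0%N)
             hh.1 hh.2)].
Proof.
split.
- by move=> L; exact: immediately_recurrent_hull.
- by move=> L hL rho; exact: recurrence_persists.
- by move=> L hL rho; exact: recurrence_persists.
move=> L T T' theta theta' hL Lp _ [U _ <-].
have E (S : aff R) (f : Rcomplex R -> Rcomplex R) :
  aff_fun U \o (aff_fun S \o f) = aff_fun (aff_comp U S) \o f.
  by apply/funext => z /=; rewrite aff_funM.
have Up : L (rel_class ((aff_comp U T, theta), (aff_comp U T', theta'))).
  suff -> : rel_class ((aff_comp U T, theta), (aff_comp U T', theta')) =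
    rel_class ((T, theta), (T', theta')) by [].
  by apply/esym/rel_classP; exists U.
have h := recurrent_stable eps_gt0 hc hc' hL Up.
by rewrite -(E T (limit_geometry K c theta)) -(E T' (limit_geometry K' c' theta')) in h.
Qed.
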